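(* Let $Y=\mathrm{Spec}\,R$ be an affine $W$-scheme with an étale map $W[T_1,\dots,T_d]\to R$ over $W$, let $Z\subset Y$ be the divisor defined by $T_1\cdots T_s=0$ with $s\le d$, and let $\mathcal Y=\mathrm{Spf}\,\widehat R$ and $\mathcal Z$ be the $p$-adic formal completions. Assume $0\le b-a\le p-1$ and $p>2$. Then for any two Frobenius lifts $\Phi,\Psi:\widehat R\to\widehat R$ (i.e. lifts of the absolute Frobenius of $R/pR$ with $\Phi(T_i)=w_iT_i^p$, $\Psi(T_i)=w_i'T_i^p$ for some $w_i,w_i'\in\widehat R^\times$, $1\le i\le d$) there is an equivalence of categories $$E_{\Phi,\Psi}:\mathcal{MF}^{\nabla,\Psi}_{[a,b]}((\mathcal Y,\mathcal Z)/W)\to\mathcal{MF}^{\nabla,\Phi}_{[a,b]}((\mathcal Y,\mathcal Z)/W).$$ These equivalences satisfy the cocycle condition $E_{\Phi_1,\Phi_2}\circ E_{\Phi_2,\Phi_3}=E_{\Phi_1,\Phi_3}$ for any three such Frobenius lifts $\Phi_1,\Phi_2,\Phi_3$, so that up to canonical equivalence the category $\mathcal{MF}^{\nabla,\Phi}_{[a,b]}((\mathcal Y,\mathcal Z)/W)$ is independent of the choice of $\Phi$.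
   Context: $k$ is a perfect field of characteristic $p>2$, $W=W(k)$; $\widehat R$ is the $p$-adic completion of $R$. $\Omega^{\log}$ is the free $\widehat R$-module on $d\log T_j$ ($j\le s$) and $dT_j$ ($j>s$). For a Frobenius lift $\Phi$ as in the claim, an object of $\mathcal{MF}^{\nabla,\Phi}_{[a,b]}((\mathcal Y,\mathcal Z)/W)$ (a logarithmic Fontaine-Faltings module with Hodge-Tate weights in $[a,b]$) is a quadruple $(V,\nabla,\mathrm{Fil},\varphi)$ where: - $V$ is a finitely generated $\widehat R$-module (allowed to be $p$-primary torsion) and $\nabla:V\to V\otimes\Omega^{\log}$ is an integrable connection with logarithmic poles along $T_1\cdots T_s=0$; - $V=\mathrm{Fil}^aV\supset\mathrm{Fil}^{a+1}V\supset\cdots\supset\mathrm{Fil}^bV\supset\mathrm{Fil}^{b+1}V=0$ is a filtration by locally split submodules, with graded pieces locally finite direct sums of modules of the form $\widehat R/p^e$ (or $\widehat R$), satisfying Griffiths transversality $\nabla(\mathrm{Fil}^i)\subset\mathrm{Fil}^{i-1}\otimes\Omega^{\log}$; - $\widetilde V$ is the quotient of $\bigoplus_{i=a}^b\mathrm{Fil}^iV$ by the relations $[v]_{i-1}=p\,[v]_i$ for $v\in\mathrm{Fil}^iV$, where $[v]_i$ is the image of $v\in\mathrm{Fil}^iV$ in $\widetilde V$; - $\varphi:\widetilde V\otimes_\Phi\widehat R\to V$ is an $\widehat R$-linear isomorphism; - $\varphi$ is horizontal, where $\widetilde V\otimes_\Phi\widehat R$ carries the logarithmic connection sending $[v]_i\otimes1$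 to $\sum_{j\le s}([v_j]_{i-1}\otimes1)\otimes\frac{d\log\Phi(T_j)}p+\sum_{j>s}([v_j]_{i-1}\otimes1)\otimes\frac{d\Phi(T_j)}p$ whenever $\nabla(v)=\sum_{j\le s}v_j\otimes d\log T_j+\sum_{j>s}v_j\otimes dT_j$ (with $[v]_{a-1}:=p[v]_a$). Morphisms are $\widehat R$-linear maps commuting with $\nabla$ and $\varphi$ and strict for the filtrations. *)

(* Defs.v *)
From HB Require Import structures.
From mathcomp Require Import all_boot all_order all_algebra.
From mathcomp Require Import boolp classical_sets functions.
From mathcomp Require Import mpoly.

Set Implicit Arguments.
Unset Strict Implicit.
Unset Printing Implicit Defensive.

Import Order.TTheory GRing.Theory Num.Theory.
Local Open Scope ring_scope.
Local Open Scope quotient_scope.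

Record category := Category {
  Ob :> Type;
  Mor : Ob -> Ob -> Type;
  idc : forall X, Mor X X;
  compc : forall X Y Z, Mor Y Z -> Mor X Y -> Mor X Z;
  compc1 : forall X Y (f : Mor X Y), compc f (idc X) = f;
  comp1c : forall X Y (f : Mor X Y), compc (idc Y) f = f;
  compcA : forall X Y Z T (h : Mor Z T) (g : Mor Y Z) (f : Mor X Y),
    compc h (compc g f) = compc (compc h g) f }.

Arguments Mor {_} _ _.
Arguments idc {_} _.
Arguments compc {_ X Y Z} _ _.

Record functor (C D : category) := Functor {
  fob :> Ob C -> Ob D;
  fmap : forall X Y : C, Mor X Y -> Mor (fob X) (fob Y);
  fmap1 : forall X : C, fmap (idc X) = idc (fob X);
  fmapM : forall (X Y Z : C) (g : Mor Y Z) (f : Mor X Y),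
    fmap (compc g f) = compc (fmap g) (fmap f) }.

Arguments fmap {C D} _ {X Y} _.

Section FunctorOps.
Variables C D E : category.

Definition functor_id : functor C C :=
  @Functor C C id (fun _ _ f => f) (fun _ => erefl) (fun _ _ _ _ _ => erefl).

Lemma functor_comp_id (G : functor D E) (F : functor C D) (X : C) :
  fmap G (fmap F (idc X)) = idc (G (F X)).
Proof. by rewrite !fmap1. Qed.

Lemma functor_comp_comp (G : functor D E) (F : functor C D) (X Y Z : C)
    (g : Mor Y Z) (f : Mor X Y) :
  fmap G (fmap F (compc g f)) = compc (fmap G (fmap F g)) (fmap G (fmap F f)).
Proof. by rewrite !fmapM. Qed.

Definition functor_comp (G : functor D E) (F : functor C D) : functor C E :=
  @Functor C E (fun X => G (F X)) (fun X Y f => fmap G (fmap F f))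
    (functor_comp_id G F) (functor_comp_comp G F).

Definition nat_iso (F G : functor C D) : Prop :=
  exists (eta : forall X, Mor (F X) (G X)) (eta' : forall X, Mor (G X) (F X)),
  [/\ forall X, compc (eta' X) (eta X) = idc (F X),
      forall X, compc (eta X) (eta' X) = idc (G X)
    & forall (X Y : C) (f : Mor X Y),
        compc (fmap G f) (eta X) = compc (eta Y) (fmap F f)].

End FunctorOps.

Definition is_equivalence (C D : category) (F : functor C D) : Prop :=
  exists G : functor D C,
    nat_iso (functor_comp G F) (functor_id C) /\
    nat_iso (functor_comp F G) (functor_id D).

Section Submodule.
Variables (A : pzRingType) (V : lmodType A).

Implicit Type S : submodClosed V.

Definition subm (S : submodClosed V) := {x : V | x \in S}.

HB.instance Definition _ S := SubChoice.on (subm S).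
HB.instance Definition _ (S : submodClosed V) :=
  [SubChoice_isSubLmodule of subm S by <:].

Definition submod_span_pred (X : set V) : {pred V} :=
  fun x => `[< forall S : submodClosed V, (forall y, X y -> y \in S) -> x \in S >].

Lemma submod_span_closed X : submod_closed (submod_span_pred X).
Proof.
split; first by apply/asboolP => S _; exact: rpred0.
move=> c x y /asboolP xX /asboolP yX; apply/asboolP => S SX.
by rewrite rpredD ?rpredZ ?xX ?yX.
Qed.

HB.instance Definition _ X :=
  GRing.isSubmodClosed.Build A V (submod_span_pred X) (submod_span_closed X).

Definition submod_span (X : set V) : submodClosed V := submod_span_pred X.

(* Quotient.quot expects a zmodClosed predicate *)
Definition as_zmod (S : submodClosed V) : {pred V} := S.

HB.instance Definition _ (S : submodClosed V) :=
  GRing.isZmodClosed.Build V (as_zmod S) (GRing.submod_closedB (GRing.submodClosedP S)).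

Definition quotm (S : submodClosed V) := Quotient.quot (as_zmod S).

HB.instance Definition _ S := GRing.Zmodule.on (quotm S).

Definition quotm_pi (S : submodClosed V) : V -> quotm S := \pi_(Quotient.quot (as_zmod S)).

Definition quotm_scale S (c : A) : quotm S -> quotm S :=
  fun x => quotm_pi S (c *: repr x).

Lemma quotm_piE S (x y : V) : x - y \in S -> quotm_pi S x = quotm_pi S y.
Proof. by move=> xyS; apply/eqP; rewrite -Quotient.idealrBE. Qed.

Lemma quotm_repr S (x : V) : repr (quotm_pi S x) - x \in S.
Proof.
by rewrite -[_ \in _]/(_ \in as_zmod S) Quotient.idealrBE reprK.
Qed.

Lemma quotm_reprK S (x : quotm S) : quotm_pi S (repr x) = x.
Proof. exact: reprK. Qed.

Lemma quotm_piD S (x y : V) : quotm_pi S (x + y) = quotm_pi S x + quotm_pi S y.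
Proof. by rewrite /quotm_pi piE. Qed.

Lemma quotm_piZ S c (x : V) : quotm_scale c (quotm_pi S x) = quotm_pi S (c *: x).
Proof. by apply: quotm_piE; rewrite -scalerBr rpredZ ?quotm_repr. Qed.

Fact quotm_scaleA S (c e : A) (x : quotm S) :
  quotm_scale c (quotm_scale e x) = quotm_scale (c * e) x.
Proof. by rewrite -[x]quotm_reprK !quotm_piZ scalerA. Qed.

Fact quotm_scale1 S : left_id 1 (@quotm_scale S).
Proof. by move=> x; rewrite -[x]quotm_reprK quotm_piZ scale1r. Qed.

Fact quotm_scaleDr S : right_distributive (@quotm_scale S) +%R.
Proof.
move=> c x y; rewrite -[x]quotm_reprK -[y]quotm_reprK -quotm_piD !quotm_piZ.
by rewrite scalerDr quotm_piD.
Qed.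

Fact quotm_scaleDl S (x : quotm S) :
  {morph (@quotm_scale S)^~ x : c e / c + e}.
Proof.
by move=> c e; rewrite -[x]quotm_reprK !quotm_piZ scalerDl quotm_piD.
Qed.

HB.instance Definition _ S := GRing.Zmodule_isLmodule.Build A (quotm S)
  (@quotm_scaleA S) (@quotm_scale1 S) (@quotm_scaleDr S) (@quotm_scaleDl S).

End Submodule.

Section BaseChange.
Variables (A B : pzRingType) (Phi : {rmorphism A -> B}) (M : lmodType A).

(* The free B-module on the set M: finitely supported functions M -> B *)
Definition finsupp_pred : {pred M -> B^o} :=
  fun g => `[< exists s : seq M, forall m, m \notin s -> g m = 0 >].

Lemma finsupp_closed : submod_closed finsupp_pred.
Proof.
split; first by apply/asboolP; exists [::].
move=> c g h /asboolP[s gs] /asboolP[t ht]; apply/asboolP; exists (s ++ t) => m.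
rewrite mem_cat negb_or => /andP[ms mt].
by rewrite fctE /= fctE /= gs // ht // scaler0 addr0.
Qed.

HB.instance Definition _ :=
  GRing.isSubmodClosed.Build B (M -> B^o) finsupp_pred finsupp_closed.

Definition free_mod := subm (finsupp_pred : submodClosed (M -> B^o)).
HB.instance Definition _ := GRing.Lmodule.on free_mod.

Lemma free_gen_subproof (m : M) :
  (fun x : M => (x == m)%:R : B^o) \in finsupp_pred.
Proof.
by apply/asboolP; exists [:: m] => x; rewrite inE => /negPf ->.
Qed.

Definition free_gen (m : M) : free_mod :=
  exist (fun g => g \in finsupp_pred) _ (free_gen_subproof m).

Definition base_change_rel : set free_mod :=
  [set x | (exists m m' : M, x = free_gen (m + m') - free_gen m - free_gen m') \/
           (exists (c : A) (m : M), x = free_gen (c *: m) - Phi c *: free_gen m)].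

(* M ⊗_Phi B: with m ⊗ b := b *: (m ⊗ 1), the relations are those of the
   tensor product over A, where A acts on B through Phi. *)
Definition base_change := quotm (submod_span base_change_rel).
HB.instance Definition _ := GRing.Lmodule.on base_change.

Definition tens1 (m : M) : base_change := quotm_pi _ (free_gen m).

End BaseChange.

Definition nat_dvd (A : pzRingType) (m : nat) (x : A) : Prop :=
  exists y, x = y *+ m.

Definition ring_unit (A : comPzRingType) (u : A) : Prop := exists v, u * v = 1.

Definition perfect_field (p : nat) (k : fieldType) : Prop :=
  p \in [pchar k] /\ forall x : k, exists y, y ^+ p = x.

(* A -> lim_n A / p^n A is bijective *)
Definition padically_complete (p : nat) (A : pzRingType) : Prop :=
  forall x : nat -> A, (forall n, nat_dvd (p ^ n) (x n.+1 - x n)) ->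
    exists! l, forall n, nat_dvd (p ^ n) (l - x n).

(* W, with the reduction map red, is W(k): the strict p-ring with residue field
   k (Serre, Local Fields, II, 5-6), unique up to unique isomorphism. *)
Definition is_witt_ring (p : nat) (W : comPzRingType) (k : fieldType)
    (red : {rmorphism W -> k}) : Prop :=
  [/\ padically_complete p W,
      forall x : W, x *+ p = 0 -> x = 0,
      forall y : k, exists x, red x = y
    & forall x : W, red x = 0 <-> nat_dvd p x].

(* iota identifies A' with lim_n A / p^n A: A' is p-adically complete and
   A / p^n A -> A' / p^n A' is bijective for all n. *)
Definition is_padic_completion (p : nat) (A A' : comPzRingType)
    (iota : {rmorphism A -> A'}) : Prop :=
  [/\ padically_complete p A',
      forall n x, nat_dvd (p ^ n) (iota x) -> nat_dvd (p ^ n) x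
    & forall n y, exists x, nat_dvd (p ^ n) (y - iota x)].

(* EGA IV 17.3.1: étale = formally étale and of finite presentation.  The
   surjection q plays the role of C -> C / I with I ^ 2 = 0. *)
Definition formally_etale (A B : comPzRingType) (f : {rmorphism A -> B}) : Prop :=
  forall (C C' : comPzRingType) (q : {rmorphism C -> C'})
    (g : {rmorphism A -> C}) (h : {rmorphism B -> C'}),
    (forall y, exists x, q x = y) ->
    (forall x y, q x = 0 -> q y = 0 -> x * y = 0) ->
    (forall x, q (g x) = h (f x)) ->
    exists h' : {rmorphism B -> C},
      [/\ forall x, h' (f x) = g x, forall y, q (h' y) = h y
        & forall h'' : {rmorphism B -> C},
            (forall x, h'' (f x) = g x) -> (forall y, q (h'' y) = h y) ->
            h'' =1 h'].

Definition finitely_presented (A : comNzRingType) (B : comPzRingType)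
    (f : {rmorphism A -> B}) : Prop :=
  exists (n : nat) (q : {rmorphism {mpoly A[n]} -> B})
    (m : nat) (r : 'I_m -> {mpoly A[n]}),
    [/\ forall c, q c%:MP = f c,
        forall y, exists x, q x = y
      & forall x, q x = 0 <-> exists c : 'I_m -> {mpoly A[n]},
                                x = \sum_i c i * r i].

Definition etale (A : comNzRingType) (B : comPzRingType)
    (f : {rmorphism A -> B}) : Prop :=
  formally_etale f /\ finitely_presented f.

(* The z with y * z = x; only used when y is a non-zero-divisor dividing x *)
Definition exact_quo (A : comPzRingType) (x y : A) : A :=
  xget 0 [set z : A | y * z = x].

(* A is covered by the basic opens D(f l).  When A is p-adically complete these
   are also the covers of Spf A by basic opens, since p lies in every maximal
   ideal. *)
Definition unimodular (A : comPzRingType) (r : nat) (f : 'I_r -> A) : Prop :=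
  exists c : 'I_r -> A, \sum_l c l * f l = 1.

Section LocalConditions.
Variables (A : comPzRingType) (V : lmodType A).

Definition finitely_generated : Prop :=
  exists (n : nat) (g : 'I_n -> V),
    forall v, exists c : 'I_n -> A, v = \sum_j c j *: g j.

(* Localized at each f l, N is a direct summand of V; [C] is a submodule of V
   whose localization is a complement, and identities in the localized module
   are written after multiplication by a power of f l. *)
Definition locally_split (N : submodClosed V) : Prop :=
  exists (r : nat) (f : 'I_r -> A), unimodular f /\
  forall l, exists C : submodClosed V,
    (forall v, exists (n : nat) (x y : V),
      [/\ x \in N, y \in C & f l ^+ n *: v = x + y]) /\
    (forall x, x \in N -> x \in C -> exists n, f l ^+ n *: x = 0).

(* A / p^e for e = Some n, and A itself for e = None *)
Definition pexp (p : nat) (e : option nat) : A :=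
  if e is Some n then (p ^ n)%:R else 0.

(* For P contained in N: localized at each f l, the module N / P is isomorphic
   to the direct sum of the A / p^(e j), j < n.  Such an isomorphism is given by
   the images of the n standard generators, which lie in N / P after scaling by
   a power of f l; the two clauses are surjectivity, and well-definedness
   together with injectivity, of the map it induces. *)
Definition locally_sum_cyclic (p : nat) (N P : submodClosed V) : Prop :=
  exists (r : nat) (f : 'I_r -> A), unimodular f /\
  forall l, exists (n : nat) (m : 'I_n -> V) (e : 'I_n -> option nat),
    [/\ forall j, m j \in N,
        forall x, x \in N -> exists (u : nat) (c : 'I_n -> A),
          f l ^+ u *: x - \sum_j c j *: m j \in P
      & forall c : 'I_n -> A,
          (exists u : nat, f l ^+ u *: (\sum_j c j *: m j) \in P) <->
          (exists u : nat, forall j, exists c', f l ^+ u * c j = pexp p (e j) * c')].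

End LocalConditions.

Section Tilde.
Variables (A : comPzRingType) (V : lmodType A) (p : nat) (a b : int).
Variable Fil : int -> submodClosed V.

(* The summand of index l : 'I_(b - a + 1) has degree a + l. *)
Let n := `|b - a|%N.

Definition dsum_pred : {pred {ffun 'I_n.+1 -> V}} :=
  fun x => [forall l : 'I_n.+1, x l \in Fil (a + l%:Z)].

Lemma dsum_closed : submod_closed dsum_pred.
Proof.
split; first by apply/forallP => l; rewrite ffunE rpred0.
move=> c x y /forallP xF /forallP yF; apply/forallP => l.
by rewrite !ffunE rpredD ?rpredZ.
Qed.

HB.instance Definition _ :=
  GRing.isSubmodClosed.Build A {ffun 'I_n.+1 -> V} dsum_pred dsum_closed.

Definition dsum := subm (dsum_pred : submodClosed {ffun 'I_n.+1 -> V}).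
HB.instance Definition _ := GRing.Lmodule.on dsum.

(* v placed in degree i, when a <= i <= b and v \in Fil i *)
Definition dsum_in (i : int) (v : V) : dsum :=
  insubd 0 [ffun l : 'I_n.+1 => if a + l%:Z == i then v else 0].

Definition tilde_rel : set dsum :=
  [set x | exists (i : int) (v : V),
     [/\ a < i, i <= b, v \in Fil i
       & x = dsum_in (i - 1) v - p%:R *: dsum_in i v]].

Definition tilde := quotm (submod_span tilde_rel).
HB.instance Definition _ := GRing.Lmodule.on tilde.

(* [v]_i for v \in Fil i, a <= i <= b, and [v]_(a - 1) = p [v]_a *)
Definition tilde_in (i : int) (v : V) : tilde :=
  if i == a - 1 then p%:R *: quotm_pi _ (dsum_in a v)
  else quotm_pi _ (dsum_in i v).

End Tilde.

Record frob_lift (p : nat) (A : comPzRingType) (d : nat) (T : 'I_d -> A) :=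
  FrobLift {
    frob :> {rmorphism A -> A};
    frob_mod : forall x, nat_dvd p (frob x - x ^+ p);
    frob_coord : forall i, exists w, ring_unit w /\ frob (T i) = w * T i ^+ p }.

Section LogForms.
Variables (W : comNzRingType) (d s : nat) (A : comPzRingType).
Variable chart : {rmorphism {mpoly W[d]} -> A}.

Definition Tcoord (i : 'I_d) : A := chart 'X_i.

(* W-linear derivations D l = d/dT_l of A with d T_i / dT_l = delta_il *)
Definition is_coord_der (D : 'I_d -> A -> A) : Prop :=
  forall l,
  [/\ forall x y, D l (x + y) = D l x + D l y,
      forall x y, D l (x * y) = x * D l y + D l x * y,
      forall w, D l (chart w%:MP) = 0
    & forall i, D l (Tcoord i) = (i == l)%:R].

(* When A is the p-adic completion of an étale W[T_1..T_d]-algebra, there is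
   exactly one such family. *)
Definition coord_der : 'I_d -> A -> A :=
  xget (fun _ _ => 0) [set D | is_coord_der D].

(* A 1-form is given by its coordinates in the basis w_l = dlog T_l (l < s),
   dT_l (s <= l) of Omega^log, indices starting at 0: [log_der l x] is the
   coordinate of dx at w_l. *)
Definition log_der (l : 'I_d) (x : A) : A :=
  if (l < s)%N then Tcoord l * coord_der l x else coord_der l x.

(* The coordinate at w_l of dlog(Phi T_j) / p = d(Phi T_j) / (p Phi T_j) for
   j < s, and of d(Phi T_j) / p for s <= j *)
Definition frob_form (p : nat) (Phi : frob_lift p Tcoord) (j l : 'I_d) : A :=
  if (j < s)%N then exact_quo (log_der l (Phi (Tcoord j))) (p%:R * Phi (Tcoord j))
  else exact_quo (log_der l (Phi (Tcoord j))) p%:R.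

End LogForms.

Section FontaineFaltings.
Variables (p : nat) (W : comNzRingType) (d s : nat) (A : comPzRingType).
Variable chart : {rmorphism {mpoly W[d]} -> A}.
Variables (a b : int) (Phi : frob_lift p (Tcoord chart)).

(* nabla v = sum_l (nab l v) ⊗ w_l.  The w_l are closed, so the curvature is
   the sum over i < j of [nab i, nab j] ⊗ w_i /\ w_j up to sign. *)
Definition is_log_connection (V : lmodType A) (nab : 'I_d -> V -> V) : Prop :=
  [/\ forall l u v, nab l (u + v) = nab l u + nab l v,
      forall l c v, nab l (c *: v) = c *: nab l v + log_der s chart l c *: v
    & forall i j v, nab i (nab j v) = nab j (nab i v)].

(* The filtration is extended by V below a and by 0 above b. *)
Record is_filtration (V : lmodType A) (Fil : int -> submodClosed V) : Prop :=
  IsFiltration {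
    fil_low : forall i v, i <= a -> v \in Fil i;
    fil_high : forall i v, b < i -> v \in Fil i -> v = 0;
    fil_dec : forall i v, v \in Fil (i + 1) -> v \in Fil i;
    fil_split : forall i, locally_split (Fil i);
    fil_graded : forall i, locally_sum_cyclic p (Fil i) (Fil (i + 1)) }.

Record mf_module := MFModule {
  mf_sort :> lmodType A;
  mf_nabla : 'I_d -> mf_sort -> mf_sort;
  mf_fil : int -> submodClosed mf_sort;
  mf_phi : {linear base_change Phi (tilde p a b mf_fil) -> mf_sort};
  mf_fg : finitely_generated mf_sort;
  mf_connection : is_log_connection mf_nabla;
  mf_filtration : is_filtration mf_fil;
  mf_griffiths : forall i l v, v \in mf_fil i -> mf_nabla l v \in mf_fil (i - 1);
  mf_phi_iso : bijective mf_phi;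
  (* Horizontality of phi, tested on the generators [v]_i ⊗ 1 *)
  mf_horizontal : forall i v l, a <= i <= b -> v \in mf_fil i ->
    mf_nabla l (mf_phi (tens1 Phi (tilde_in p a b mf_fil i v))) =
    \sum_j frob_form s Phi j l *:
      mf_phi (tens1 Phi (tilde_in p a b mf_fil (i - 1) (mf_nabla j v))) }.

(* Linear maps that commute with nabla and phi and are strict.  Compatibility
   with phi is tested on the generators [v]_i ⊗ 1. *)
Record is_strict_mor (X Y : mf_module) (f : X -> Y) : Prop := IsStrictMor {
  mor_linear : linear f;
  mor_nabla : forall l v, f (mf_nabla l v) = mf_nabla l (f v);
  mor_fil : forall i v, v \in mf_fil X i -> f v \in mf_fil Y i;
  mor_strict : forall i v, f v \in mf_fil Y i ->
    exists2 u, u \in mf_fil X i & f u = f v;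
  mor_phi : forall i v, a <= i <= b -> v \in mf_fil X i ->
    f (mf_phi X (tens1 Phi (tilde_in p a b (mf_fil X) i v))) =
    mf_phi Y (tens1 Phi (tilde_in p a b (mf_fil Y) i (f v))) }.

(* Strict maps of filtered modules need not compose to strict maps; for
   Fontaine-Faltings modules they do, by the theorem of Faltings that every map
   compatible with Fil, nabla and phi is strict.  Closing under composition
   therefore adds no morphism, and makes the category laws formal. *)
Inductive is_mf_mor : forall X Y : mf_module, (X -> Y) -> Prop :=
| StrictMor (X Y : mf_module) (f : X -> Y) of is_strict_mor f : is_mf_mor f
| CompMor (X Y Z : mf_module) (g : Y -> Z) (f : X -> Y) of is_mf_mor g & is_mf_mor f :
    is_mf_mor (g \o f).

Definition mf_hom (X Y : mf_module) := {f : X -> Y | is_mf_mor f}.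

Lemma strict_mor_id (X : mf_module) : is_strict_mor (id : X -> X).
Proof. by split => // i v vX; exists v. Qed.

Definition mf_id (X : mf_module) : mf_hom X X :=
  exist _ id (StrictMor (strict_mor_id X)).

Definition mf_comp (X Y Z : mf_module) (g : mf_hom Y Z) (f : mf_hom X Y) :
  mf_hom X Z := exist _ (sval g \o sval f) (CompMor (svalP g) (svalP f)).

Lemma mf_hom_eq (X Y : mf_module) (f g : mf_hom X Y) : sval f = sval g -> f = g.
Proof. by case: f g => [f fP] [g gP] /= fg; apply: eq_exist. Qed.

Lemma mf_comp1 X Y (f : mf_hom X Y) : mf_comp f (mf_id X) = f.
Proof. exact: mf_hom_eq. Qed.

Lemma mf_1comp X Y (f : mf_hom X Y) : mf_comp (mf_id Y) f = f.
Proof. exact: mf_hom_eq. Qed.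

Lemma mf_compA X Y Z T (h : mf_hom Z T) (g : mf_hom Y Z) (f : mf_hom X Y) :
  mf_comp h (mf_comp g f) = mf_comp (mf_comp h g) f.
Proof. exact: mf_hom_eq. Qed.

Definition MF : category := Category mf_comp1 mf_1comp mf_compA.

End FontaineFaltings.

(* Main.v *)
Require Import Defs.
From HB Require Import structures.
From mathcomp Require Import all_boot all_order all_algebra mpoly.
From mathcomp Require Import boolp classical_sets functions.
From mathcomp Require Import ring zify.

Set Implicit Arguments.
Unset Strict Implicit.
Unset Printing Implicit Defensive.

Import Order.TTheory GRing.Theory Num.Theory.
Local Open Scope ring_scope.

(** Write A for the completed ring.  The functor from Psi to Phi keeps V, the
    connection nabla and the filtration, and composes the Frobenius phi with a
    comparison map alpha from the twist of V~ by Phi to its twist by Psi.  This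
    alpha is parallel transport from Psi to Phi, that is, Taylor's formula.
    Define lam_l by Phi(T_l) = exp(p lam_l) Psi(T_l) along the divisor and by
    Phi(T_l) = Psi(T_l) + p lam_l elsewhere.  Then alpha maps [v]_(a+r) to the sum
    over n of
      p^max(n-r,0) / n! * sum over l_1 ... l_n of
         lam_(l_1) ... lam_(l_n) [nabla_(l_1) ... nabla_(l_n) v]_(a+max(r-n,0)).
    Taylor's formula has p^n / n! and a class of degree a + r here; but n-fold
    derivatives w of v only lie in degree a + max(r-n,0) of Fil, and the relations
    p [w]_i = [w]_(i-1) of V~ say how to read p^min(n,r) [w]_(a+r).  The remaining
    coefficient is p-integral because r <= b - a < p, and it tends to 0 because
    p > 2.  These coefficients are [kap], the sums are [taylor].

    The sum over n is an exponential of the operator sum_l lam_l nabla_l, and the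
    nabla_l commute, so that its properties are formal.
    Transporting by mu and then by lam is transporting by lam + mu
    ([taylor_taylor]), and lam is additive in composition ([lam_cocycle]): this is
    the cocycle condition, and it makes alpha an isomorphism.  On the ring A
    itself, the transport of Psi is a ring endomorphism that has the values of Phi
    on the coordinates and modulo p, so it is Phi ([taylor_frob]); hence alpha is
    linear.  Differentiating the series in lam shifts it by one step and brings
    out d lam, which is the difference of the forms dlog Phi(T) / p and
    dlog Psi(T) / p ([frob_form_lam]); hence the new Frobenius is horizontal
    ([taylor_derive]).  Morphisms commute with nabla, so with alpha, and the
    underlying maps of the functor are the identity on morphisms.

    Two bodies of facts make the series meaningful.  First, A is p-torsion free,
    A / p is reduced, the T_l are regular modulo p, and derivations of W[T]
    extend to A.  All of this is drawn from the infinitesimal lifting property.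
    A presentation P / I of an étale algebra has an endomorphism of P that induces
    the identity on P / I and maps I to its square; iterating it moves I deep into
    its own powers, and a Frobenius splitting of P / p brings this back to
    reducedness ([etale_reduced]).  Flatness over p comes from lifting R / p^n to
    its Witt vectors of length two ([ghost_section], [presented_flat]).  Second,
    the twist of V~ must be p-adically separated and complete.  The local
    hypotheses on Fil produce global coordinate functions on each graded piece,
    valued in A / p^e ([quasi_basis_of_local]); lifted through the filtration they
    exhibit the twist as a direct summand of a finite sum of modules A / p^e
    ([base_change_padic]). *)

(** * Divisibility by integers and p-adic completeness *)

Definition zdvd (M : zmodType) (m : nat) (x : M) : Prop := exists y, x = y *+ m.

Section Zdvd.
Variable M : zmodType.
Implicit Types (x y : M) (m n : nat).

Lemma zdvd0 m : zdvd m (0 : M).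
Proof. by exists 0; rewrite mul0rn. Qed.

Lemma zdvdD m x y : zdvd m x -> zdvd m y -> zdvd m (x + y).
Proof. by move=> [u ->] [v ->]; exists (u + v); rewrite mulrnDl. Qed.

Lemma zdvdN m x : zdvd m x -> zdvd m (- x).
Proof. by move=> [u ->]; exists (- u); rewrite mulNrn. Qed.

Lemma zdvdB m x y : zdvd m x -> zdvd m y -> zdvd m (x - y).
Proof. by move=> hx hy; apply: zdvdD => //; exact: zdvdN. Qed.

Lemma zdvd_sym m x y : zdvd m (x - y) -> zdvd m (y - x).
Proof. by move=> /zdvdN; rewrite opprB. Qed.

Lemma zdvd_chain m y x z : zdvd m (x - y) -> zdvd m (y - z) -> zdvd m (x - z).
Proof. by move=> h1 h2; have := zdvdD h1 h2; rewrite addrA subrK. Qed.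

Lemma zdvd_sum m (I : Type) (s : seq I) (P : pred I) (F : I -> M) :
  (forall i, P i -> zdvd m (F i)) -> zdvd m (\sum_(i <- s | P i) F i).
Proof. by move=> h; elim/big_ind: _ => //; [exact: zdvd0|exact: zdvdD]. Qed.

Lemma zdvd_dvd m n x : (m %| n)%N -> zdvd n x -> zdvd m x.
Proof. by move=> /dvdnP[q ->] [y ->]; exists (y *+ q); rewrite -mulrnA. Qed.

Lemma zdvd_exp p m n x : (m <= n)%N -> zdvd (p ^ n) x -> zdvd (p ^ m) x.
Proof. by move=> mn; apply: zdvd_dvd; exact: dvdn_exp2l. Qed.

Lemma zdvd1 x : zdvd 1 x.
Proof. by exists x. Qed.

Lemma zdvd_mulrn m n x : zdvd m x -> zdvd m (x *+ n).
Proof. by move=> [y ->]; exists (y *+ n); rewrite mulrnAC. Qed.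

Lemma zdvd_mulrn2 m n x : zdvd m x -> zdvd (m * n) (x *+ n).
Proof. by move=> [y ->]; exists y; rewrite -mulrnA. Qed.

(** Separatedness and completeness are kept apart because homomorphisms and direct
    summands transport them separately. *)
Definition padic_sep (p : nat) := forall x : M, (forall n, zdvd (p ^ n) x) -> x = 0.

Definition padic_lim (p : nat) := forall x : nat -> M,
  (forall n, zdvd (p ^ n) (x n.+1 - x n)) ->
  exists l, forall n, zdvd (p ^ n) (l - x n).

End Zdvd.

Lemma zdvd_additive (M M' : zmodType) (F : M -> M') m x :
  (forall x y, F (x + y) = F x + F y) -> zdvd m x -> zdvd m (F x).
Proof.
move=> Fadd [y ->]; exists (F y); elim: m => [|m IH].
  by rewrite !mulr0n; apply: (addrI (F 0)); rewrite -Fadd !addr0.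
by rewrite !mulrS Fadd IH.
Qed.

Lemma zdvdZ (A : pzRingType) (M : lmodType A) m (a : A) (x : M) :
  zdvd m x -> zdvd m (a *: x).
Proof. by apply: (zdvd_additive (F := fun x => a *: x)) => ? ?; rewrite scalerDr. Qed.

Lemma zdvdZl (A : pzRingType) (M : lmodType A) m (a : A) (x : M) :
  zdvd m a -> zdvd m (a *: x).
Proof. by move=> [y ->]; exists (y *: x); rewrite scalerMnl. Qed.

Lemma zdvdMl (A : pzRingType) m (a x : A) : zdvd m x -> zdvd m (a * x).
Proof. by move=> [y ->]; exists (a * y); rewrite mulrnAr. Qed.

Lemma zdvdMr (A : pzRingType) m (a x : A) : zdvd m x -> zdvd m (x * a).
Proof. by move=> [y ->]; exists (y * a); rewrite mulrnAl. Qed.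

Lemma zdvd_nat (A : pzRingType) m n : (m %| n)%N -> zdvd m (n%:R : A).
Proof. by move=> /dvdnP[q ->]; exists q%:R; rewrite natrM mulr_natr. Qed.

Lemma zdvdM (A : comPzRingType) m n (x y : A) : zdvd m x -> zdvd n y -> zdvd (m * n) (x * y).
Proof.
by move=> [u ->] [v ->]; exists (u * v); rewrite mulrnAl mulrnAr -mulrnA mulnC.
Qed.

(** Legendre's formula in the form v(n!) <= n / (p - 1): the estimate behind the
    convergence of every series below. *)
Lemma logn_fact_le p n : prime p -> (logn p n`! * p.-1 <= n)%N.
Proof.
move=> p_pr; rewrite logn_fact //.
have h m : ((\sum_(1 <= k < m.+1) n %/ p ^ k) * p.-1 + n %/ p ^ m <= n)%N.
  elim: m => [|m IH]; first by rewrite big_geq // expn0 divn1.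
  rewrite big_nat_recr //= mulnDl; apply: leq_trans IH.
  rewrite -addnA leq_add2l.
  have := leq_trunc_div (n %/ p ^ m) p; rewrite -divnMA -expnSr.
  have := prime_gt0 p_pr; case: (p) => // q _ /=; rewrite mulnS; lia.
by apply: leq_trans (h n); exact: leq_addr.
Qed.

Record padic_ring (p : nat) (A : comPzRingType) : Prop := PadicRing {
  padic_prime : prime p;
  padic_gt2 : (2 < p)%N;
  padic_tf : forall x : A, x *+ p = 0 -> x = 0;
  padic_completeness : padically_complete p A }.

Section PadicRing.
Variables (p : nat) (A : comPzRingType).
Hypothesis HA : padic_ring p A.

Let p_pr : prime p. Proof. by case: HA. Qed.
Let p_gt2 : (2 < p)%N. Proof. by case: HA. Qed.
Let A_tf : forall x : A, x *+ p = 0 -> x = 0. Proof. by case: HA. Qed.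
Let A_c : padically_complete p A. Proof. by case: HA. Qed.

Lemma complete_sep : padic_sep A p.
Proof.
move=> x xd.
have [|l [_ lu]] := A_c (x := fun=> 0).
  by move=> n; rewrite subrr; exact: zdvd0.
transitivity l; first by apply/esym/lu => n; rewrite subr0; exact: xd.
by apply: lu => n; rewrite subr0; exact: zdvd0.
Qed.

Lemma complete_lim : padic_lim A p.
Proof. by move=> x /A_c[l [lP _]]; exists l. Qed.

Lemma tf_pexp n (x : A) : x *+ (p ^ n) = 0 -> x = 0.
Proof.
elim: n x => [|n IH] x; first by rewrite mulr1n.
by rewrite expnSr mulrnA => /A_tf /IH.
Qed.

(** The geometric series in - x p converges. *)
Lemma unit_1p (x : A) : exists y, (1 + x *+ p) * y = 1.
Proof.
pose u n := \sum_(k < n) (- (x *+ p)) ^+ k.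
have pw n : zdvd (p ^ n) ((- (x *+ p)) ^+ n).
  by exists ((- x) ^+ n); rewrite -mulNrn exprMn_n.
have [|l lP] := complete_lim (x := u).
  by move=> n; rewrite /u big_ord_recr /= addrAC subrr add0r.
exists l; apply/eqP; rewrite -subr_eq0; apply/eqP/complete_sep => n.
have -> : (1 + x *+ p) * l - 1 = (1 + x *+ p) * (l - u n) + ((1 + x *+ p) * u n - 1).
  by ring.
apply: zdvdD; first exact: zdvdMl.
have := subrXX_comm n (commr1 (- (x *+ p))); rewrite expr1n.
under eq_bigr do rewrite expr1n mulr1.
set s := \sum_(i < n) _; have -> : s = u n.
  rewrite /s /u (reindex_inj rev_ord_inj) /=; apply: eq_bigr => i _.
  by congr (_ ^+ _); have := ltn_ord i; lia.
move=> e; have -> : (1 + x *+ p) * u n - 1 = - (- (x *+ p)) ^+ n.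
  have -> : (1 + x *+ p) * u n = - ((- (x *+ p) - 1) * u n) by ring.
  by rewrite -e; ring.
exact: zdvdN.
Qed.

(** A Bezout relation makes a multiple of m congruent to 1 modulo p, hence a unit. *)
Lemma nat_inv m : coprime p m -> exists u : A, u *+ m = 1.
Proof.
move=> cop; have m_gt0 : (0 < m)%N.
  by case: m cop => //; rewrite /coprime gcdn0 => /eqP pe; move: p_gt2; rewrite pe.
have [a b e _] := egcdnP p m_gt0.
move: cop; rewrite coprime_sym /coprime => /eqP g; rewrite g in e.
have [y yP] := unit_1p b%:R.
exists (a%:R * y); rewrite -mulrnAl -[RHS]yP; congr (_ * _).
by rewrite -mulrnA e natrD natrM mulr_natr addrC.
Qed.

Lemma tf_nat m (x : A) : (0 < m)%N -> x *+ m = 0 -> x = 0.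
Proof.
move=> m_gt0 xm; have [n cop mE] := pfactor_coprime p_pr m_gt0.
have [u uP] := nat_inv cop.
rewrite mE mulrnA in xm; have := tf_pexp xm => /(congr1 (fun y => u * y)).
by rewrite mulr0 mulrnAr -mulrnAl uP mul1r.
Qed.

Lemma tf_inj m (x y : A) : (0 < m)%N -> x *+ m = y *+ m -> x = y.
Proof.
move=> m0 /eqP; rewrite -subr_eq0 -mulrnBl => /eqP /(tf_nat m0) /eqP.
by rewrite subr_eq0 => /eqP.
Qed.

Lemma tf_zdvd m n (x : A) : zdvd (p ^ (m + n)) (x *+ p ^ n) -> zdvd (p ^ m) x.
Proof.
move=> [y]; rewrite expnD mulrnA => e; exists y.
by apply: (tf_inj (m := p ^ n)) => //; rewrite expn_gt0 prime_gt0.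
Qed.

(** * Divided powers of p *)

(** The divided power p^max(n-r,0) / n!.  Division by n! is unambiguous in a
    p-adic ring, and exact as long as r < p. *)
Definition kap (r n : nat) : A :=
  xget 0 [set k : A | k *+ n`! = (p ^ (n - r))%:R].

(** A rank from which the divided powers of p are divisible by p^N. *)
Definition kbnd (N : nat) := (2 * (N + p))%N.

Lemma fact_inj n (x y : A) : x *+ n`! = y *+ n`! -> x = y.
Proof. by apply: tf_inj; rewrite ?fact_gt0. Qed.

Lemma kap_exists r n N : (N + logn p n`! <= n - r)%N ->
  exists k : A, k *+ n`! = (p ^ (n - r))%:R /\ zdvd (p ^ N) k.
Proof.
move=> h; have [m cop mE] := pfactor_coprime p_pr (fact_gt0 n).
have [u uP] := nat_inv cop.
move: (logn p n`!) mE h => v mE h; exists (u *+ p ^ (n - r - v)); split.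
  rewrite mE mulnC -mulrnA mulnA -expnD subnK; last by lia.
  by rewrite mulnC mulrnA uP.
by apply: (@zdvd_exp _ _ _ (n - r - v)); [lia|exists u].
Qed.

Lemma logn_fact_lt n : (n < p)%N -> logn p n`! = 0%N.
Proof.
move=> np; rewrite logn_fact // big_nat_cond big1 // => k /andP[/andP[k0 _] _].
rewrite divn_small // (leq_trans np) // -[X in (X <= _)%N]expn1.
by rewrite leq_exp2l // prime_gt1.
Qed.

(** Both cases use r < p: below p the factorial is prime to p, and beyond it
    n - r >= n - p + 1 outgrows n / (p - 1). *)
Lemma kap_bound r n : (r < p)%N -> (logn p n`! <= n - r)%N.
Proof.
move=> rp; case: (ltnP n p) => np; first by rewrite logn_fact_lt.
have := logn_fact_le n p_pr; move: np p_gt2 rp; case: p => // q /=; nia.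
Qed.

Lemma kapE r n : (r < p)%N -> kap r n *+ n`! = (p ^ (n - r))%:R.
Proof.
move=> rp; have [|k [kP _]] := @kap_exists r n 0; first by rewrite add0n kap_bound.
by rewrite /kap; case: xgetP => [y _ //|/(_ k)].
Qed.

Lemma kap_dvd r n N : (r < p)%N -> (N + logn p n`! <= n - r)%N -> zdvd (p ^ N) (kap r n).
Proof.
move=> rp h; have [k [kP kd]] := kap_exists h.
by have -> : kap r n = k by apply: (@fact_inj n); rewrite kapE.
Qed.

Lemma kap_small r n N : (r < p)%N -> (kbnd N <= n)%N -> zdvd (p ^ N) (kap r n).
Proof.
move=> rp; rewrite /kbnd => h; apply: kap_dvd => //.
have := logn_fact_le n p_pr; move: p_gt2 rp h; case: p => // q /=; nia.
Qed.

Lemma kap_n0 r : (r < p)%N -> kap r 0 = 1.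
Proof. by move=> rp; have := kapE 0 rp; rewrite mulr1n. Qed.

Lemma kap01 : kap 0 1 = p%:R.
Proof. by have := kapE 1 (prime_gt0 p_pr); rewrite mulr1n expn1. Qed.

(** Passing from degree r + 1 to degree r costs one factor p when n > r, as
    the filtration absorbs min(n,r) of them. *)
Lemma kap_level r n : (r.+1 < p)%N ->
  kap r n = if (n <= r)%N then kap r.+1 n else kap r.+1 n *+ p.
Proof.
move=> rp; apply: (@fact_inj n); rewrite kapE ?(ltnW rp) //.
case: (leqP n r) => h.
  by rewrite kapE //; congr (_ ^ _)%:R; lia.
rewrite /= mulrnAC kapE // -mulrnA -expnSr; congr (_ ^ _)%:R; lia.
Qed.

(** The multiplication rule of divided powers; the degree drops from r to r - m
    because m factors p have been used. *)
Lemma kap_mul r m n : (r < p)%N ->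
  kap r m * kap (r - m) n = kap r (m + n) *+ 'C(m + n, m).
Proof.
move=> rp; apply: (@tf_inj (m`! * n`!)).
  by rewrite muln_gt0 !fact_gt0.
rewrite -[RHS]mulrnA [('C(_, _) * _)%N]mulnC.
have -> : (m`! * n`! * 'C(m + n, m) = (m + n)`!)%N.
  by rewrite -(bin_fact (leq_addr n m)) addKn mulnC.
rewrite kapE // mulrnA -mulrnAl -mulrnAr !kapE //; last by lia.
rewrite -natrM -expnD; congr (_ ^ _)%:R; lia.
Qed.

Lemma kap_min r n : (r < p)%N -> kap 0 n = kap r n *+ (p ^ minn r n).
Proof.
move=> rp; apply: (@fact_inj n); rewrite mulrnAC !kapE ?(leq_ltn_trans _ rp) //.
rewrite -mulrnA -expnD; congr (_ ^ _)%:R; lia.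
Qed.

Lemma kap_shift r n : (r.+1 < p)%N -> kap r.+1 n.+1 *+ n.+1 = kap r n.
Proof.
by move=> rp; apply: (@fact_inj n); rewrite -mulrnA -factS !kapE ?(ltnW rp).
Qed.

Lemma kap_shift0 n : kap 0 n.+1 *+ n.+1 = kap 0 n *+ p.
Proof.
have p0 := prime_gt0 p_pr.
apply: (@fact_inj n); rewrite -mulrnA -factS mulrnAC !kapE //.
by rewrite !subn0 expnSr mulrnA.
Qed.

Lemma kap0_p n : (0 < n)%N -> zdvd p (kap 0 n).
Proof.
move=> n0; rewrite -[p in zdvd p]expn1; apply: kap_dvd; first exact: prime_gt0.
have := logn_fact_le n p_pr; move: p_gt2 n0; case: p => // q /=; nia.
Qed.

Lemma kap0_p2 n : (1 < n)%N -> zdvd (p ^ 2) (kap 0 n).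
Proof.
move=> n0; apply: kap_dvd; first exact: prime_gt0.
case: (ltnP n p) => np; first by rewrite logn_fact_lt //; lia.
have := logn_fact_le n p_pr; move: p_gt2 n0 np; case: p => // q /=; nia.
Qed.

End PadicRing.

(** * Series with divided-power coefficients *)

Section Ksum.
Variables (p : nat) (A : comPzRingType).
Hypothesis HA : padic_ring p A.

Let p_pr : prime p. Proof. by case: HA. Qed.

Section OneModule.
Variable M : lmodType A.
Hypothesis Msep : padic_sep M p.
Hypothesis Mcomp : padic_lim M p.

(** Convergence is stated with an explicit rate, so that sums of series, double
    series and images of series can be compared termwise. *)
Definition is_ksum (r : nat) (y : nat -> M) (x : M) :=
  forall N n, (kbnd p N <= n)%N -> zdvd (p ^ N) (x - \sum_(k < n) kap p A r k *: y k).

Definition ksum r y : M := xget 0 [set x | is_ksum r y x].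

Lemma ksum_tail r (y : nat -> M) N m n : (r < p)%N -> (kbnd p N <= m)%N -> (m <= n)%N ->
  zdvd (p ^ N) (\sum_(k < n) kap p A r k *: y k - \sum_(k < m) kap p A r k *: y k).
Proof.
move=> rp Nm mn; rewrite -!(big_mkord xpredT (fun k => kap p A r k *: y k)).
rewrite (big_cat_nat (leq0n _) mn) //= addrAC subrr add0r big_nat_cond.
apply: zdvd_sum => k /andP[/andP[mk _] _]; apply: zdvdZl; apply: kap_small => //.
exact: leq_trans mk.
Qed.

Lemma kbndS N : (kbnd p N <= kbnd p N.+1)%N.
Proof. by rewrite /kbnd; lia. Qed.

Lemma ksumP r y : (r < p)%N -> is_ksum r y (ksum r y).
Proof.
move=> rp; rewrite /ksum; case: xgetP => [//|no]; exfalso.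
have [N|l lP] := Mcomp (x := fun N => \sum_(k < kbnd p N) kap p A r k *: y k).
  by apply: ksum_tail => //; exact: kbndS.
apply: (no l) => N n Nn; apply: zdvd_chain (lP N) _.
by apply: zdvd_sym; exact: ksum_tail.
Qed.

Lemma ksum_uniq r y x : (r < p)%N -> is_ksum r y x -> ksum r y = x.
Proof.
move=> rp xP; apply/eqP; rewrite -subr_eq0; apply/eqP/Msep => N.
apply: zdvd_chain (ksumP y rp (leqnn (kbnd p N))) _.
by apply: zdvd_sym; exact: xP.
Qed.

Lemma eq_ksum r (y z : nat -> M) : (forall k, y k = z k) -> ksum r y = ksum r z.
Proof. by move=> /funext ->. Qed.

Lemma ksum_eq0 (r : nat) (y : nat -> M) : (r < p)%N ->
  (forall k, (0 < k)%N -> y k = 0) -> ksum r y = y 0%N.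
Proof.
move=> rp y0; apply: ksum_uniq => // N n; case: n => [|n] Nn.
  by move: Nn (prime_gt0 p_pr); rewrite /kbnd; lia.
rewrite big_ord_recl big1; last by move=> i _; rewrite y0 ?scaler0.
by rewrite (kap_n0 HA) // scale1r addr0 subrr; exact: zdvd0.
Qed.

Lemma ksumD r y z : (r < p)%N -> ksum r (fun k => y k + z k) = ksum r y + ksum r z.
Proof.
move=> rp; apply: ksum_uniq => // N n Nn.
under eq_bigr do rewrite scalerDr.
rewrite big_split opprD addrACA; apply: zdvdD; exact: ksumP.
Qed.

Lemma ksum_big r (I : finType) (y : I -> nat -> M) : (r < p)%N ->
  ksum r (fun k => \sum_i y i k) = \sum_i ksum r (y i).
Proof.
move=> rp; apply: ksum_uniq => // N n Nn.
under [X in _ - X]eq_bigr do rewrite scaler_sumr.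
rewrite exchange_big /= -sumrB; apply: zdvd_sum => i _; exact: ksumP.
Qed.

(** Differentiating an exponential series shifts it: n / n! = 1 / (n-1)!.  The
    default 0.-1 = 0 is harmless, since the term n = 0 is multiplied by 0. *)
Lemma ksum_shift r (z : nat -> M) : (r.+1 < p)%N ->
  ksum r.+1 (fun n => z n.-1 *+ n) = ksum r z.
Proof.
move=> rp; apply: ksum_uniq => // N n Nn.
have n0 : (0 < n)%N by move: Nn (prime_gt0 p_pr); rewrite /kbnd; lia.
case: n n0 Nn => // n _ Nn; rewrite big_ord_recl mulr0n scaler0 add0r.
under eq_bigr do rewrite /= -scalerMnr scalerMnl (kap_shift HA) //.
have := @ksumP r z (ltnW rp) N _ Nn; rewrite big_ord_recr /= opprD addrA => h.
rewrite -[X in zdvd _ X](subrK (kap p A r n *: z n)).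
apply: zdvdD => //; apply: zdvdZl.
have [k ->] : exists k, kap p A r n = kap p A r.+1 n.+1 *+ k.
  by exists n.+1; rewrite (kap_shift HA).
by apply: zdvd_mulrn; apply: (kap_small HA).
Qed.

(** In degree 0 no power of p is absorbed, so the shift leaves a factor p. *)
Lemma ksum_shift0 (z : nat -> M) :
  ksum 0 (fun n => z n.-1 *+ n) = ksum 0 z *+ p.
Proof.
have p0 := prime_gt0 p_pr.
apply: ksum_uniq => // N n Nn.
have n0 : (0 < n)%N by move: Nn p0; rewrite /kbnd; lia.
case: n n0 Nn => // n _ Nn; rewrite big_ord_recl mulr0n scaler0 add0r.
under eq_bigr do rewrite /= -scalerMnr scalerMnl (kap_shift0 HA) // -scalerMnl.
have := @ksumP 0 z p0 N _ Nn; rewrite big_ord_recr /= opprD addrA => h.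
rewrite sumrMnl -mulrnBl.
rewrite -[X in zdvd _ (X *+ _)](subrK (kap p A 0 n *: z n)) mulrnDl.
apply: zdvdD; first exact: zdvd_mulrn.
rewrite scalerMnl; apply: zdvdZl; rewrite -(kap_shift0 HA).
by apply: zdvd_mulrn; apply: (kap_small HA).
Qed.

(** The product rule of exponential series: [kap_mul] turns the coefficients into
    those of the diagonal m + j = k; the truncation square exceeds the triangle
    only by p-adically small terms. *)
Lemma ksum_double r (Y : nat -> nat -> M) : (r < p)%N ->
  ksum r (fun m => ksum (r - m) (Y m)) =
  ksum r (fun k => \sum_(m < k.+1) Y m (k - m)%N *+ 'C(k, m)).
Proof.
move=> rp; have rmp m : (r - m < p)%N by lia.
apply: ksum_uniq => // N n Nn.
apply: zdvd_chain (ksumP _ rp Nn) _.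
pose T m j := kap p A r (m + j) *: (Y m j *+ 'C(m + j, m)).
have e1 : zdvd (p ^ N) (\sum_(m < n) kap p A r m *: ksum (r - m) (Y m) -
    \sum_(m < n) \sum_(j < n) T m j).
  rewrite -sumrB; apply: zdvd_sum => m _.
  have -> : \sum_(j < n) T m j = kap p A r m *: \sum_(j < n) kap p A (r - m) j *: Y m j.
    rewrite scaler_sumr; apply: eq_bigr => j _.
    by rewrite scalerA (kap_mul HA) // -scalerMnl scalerMnr.
  by rewrite -scalerBr; apply: zdvdZ; exact: ksumP.
apply: zdvd_sym; apply: zdvd_chain e1 _.
have -> : \sum_(k < n) kap p A r k *: (\sum_(m < k.+1) Y m (k - m)%N *+ 'C(k, m)) =
    \sum_(m < n) \sum_(j < n | (m + j < n)%N) T m j.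
  transitivity (\sum_(k < n) \sum_(m < n | (m <= k)%N) T m (k - m)%N).
    apply: eq_bigr => k _; rewrite scaler_sumr.
    rewrite (big_ord_widen_cond n xpredT
      (fun m => kap p A r k *: (Y m (k - m)%N *+ 'C(k, m)))) //=.
    apply: eq_big => [m|m mk]; first by rewrite ltnS.
    by rewrite /T subnKC // -ltnS.
  rewrite (exchange_big_dep xpredT) //=; apply: eq_bigr => m _.
  rewrite -(big_mkord (fun k => (m <= k)%N) (fun k => T m (k - m)%N)).
  rewrite -(big_mkord (fun j => (m + j < n)%N) (fun j => T m j)).
  rewrite (big_cat_nat (leq0n _) (ltnW (ltn_ord m))) //= big_nat_cond big1 ?add0r; last first.
    by move=> k; lia.
  rewrite [in RHS](big_cat_nat (leq0n (n - m)%N) (leq_subr m n)) //=.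
  rewrite [X in _ = _ + X]big_nat_cond [X in _ = _ + X]big1 ?addr0; last by move=> k; lia.
  rewrite -{1}[nat_of_ord m]add0n big_addn big_nat_cond [RHS]big_nat_cond.
  by apply: eq_big => [j|j _]; [lia|rewrite addnK].
rewrite -sumrB; apply: zdvd_sum => m _.
rewrite (bigID (fun j : 'I_n => (m + j < n)%N)) /= addrAC subrr add0r.
apply: zdvd_sum => j; rewrite -leqNgt => h; apply: zdvdZl; apply: (kap_small HA) => //.
exact: leq_trans h.
Qed.

End OneModule.

(** F need not be continuous by hypothesis: an additive map respects divisibility
    by p^N.  Commutation with the scalars [kap] only is asked for, because F may
    be a derivation. *)
Lemma ksum_map (M M' : lmodType A) (F : M -> M') r y z : (r < p)%N ->
  padic_lim M p -> padic_sep M' p -> padic_lim M' p ->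
  (forall u v, F (u + v) = F u + F v) ->
  (forall k, F (kap p A r k *: y k) = kap p A r k *: z k) ->
  F (ksum r y) = ksum r z.
Proof.
move=> rp Mc M's M'c Fadd Fk; apply/esym/ksum_uniq => // N n Nn.
have F0 : F 0 = 0 by apply: (addrI (F 0)); rewrite -Fadd !addr0.
have FN u : F (- u) = - F u by apply: (addrI (F u)); rewrite -Fadd !subrr.
have -> : \sum_(k < n) kap p A r k *: z k = F (\sum_(k < n) kap p A r k *: y k).
  by rewrite (big_morph F Fadd F0); apply: eq_bigr => k _; rewrite Fk.
rewrite -FN -Fadd; apply: zdvd_additive => //; exact: ksumP.
Qed.

Lemma ksum_level (M : lmodType A) r s (y z : nat -> M) : (r < p)%N -> (s < p)%N ->
  padic_sep M p -> padic_lim M p ->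
  (forall n, kap p A r n *: y n = kap p A s n *: z n) -> ksum r y = ksum s z.
Proof.
move=> rp sp Ms Mc yz; apply: ksum_uniq => // N n Nn.
by under eq_bigr do rewrite yz; exact: ksumP.
Qed.

Lemma ksumZ (M : lmodType A) (a : A) r (y : nat -> M) : (r < p)%N ->
  padic_sep M p -> padic_lim M p -> a *: ksum r y = ksum r (fun k => a *: y k).
Proof.
move=> rp Ms Mc; apply: (ksum_map (F := fun x => a *: x)) => //.
  by move=> u v; rewrite scalerDr.
by move=> k; rewrite !scalerA mulrC.
Qed.

Lemma ksumZl (M : lmodType A) r (y : nat -> A) (x : M) : (r < p)%N ->
  padic_sep M p -> padic_lim M p -> ksum r (y : nat -> A^o) *: x = ksum r (fun k => y k *: x).
Proof.
move=> rp Ms Mc.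
have Ac := complete_lim HA.
apply: (@ksum_map A^o M (fun a => a *: x)) => //.
  by move=> u v; rewrite scalerDl.
by move=> k; rewrite scalerA.
Qed.

Lemma ksumMn (M : lmodType A) n r (y : nat -> M) : (r < p)%N ->
  padic_sep M p -> padic_lim M p -> ksum r y *+ n = ksum r (fun k => y k *+ n).
Proof.
move=> rp Ms Mc; rewrite -scaler_nat ksumZ //; apply: eq_ksum => k.
by rewrite scaler_nat.
Qed.

End Ksum.

(** * Parallel transport along a connection *)

(** Pascal's rule for sums over a diagonal, the induction step of both the
    binomial formula and the Leibniz formula for [lop]. *)
Lemma pascal_sum (M : nmodType) n (P : nat -> nat -> M) :
  \sum_(m < n.+1) P m.+1 (n - m)%N *+ 'C(n, m) +
  \sum_(m < n.+1) P m (n - m).+1 *+ 'C(n, m) =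
  \sum_(m < n.+2) P m (n.+1 - m)%N *+ 'C(n.+1, m).
Proof.
rewrite [RHS]big_ord_recl /= bin0 subn0.
under [X in _ = _ + X]eq_bigr => i _ do
  rewrite -[bump 0 i]/(i.+1) subSS binS mulrnDr.
rewrite big_split /= addrA addrC; congr (_ + _).
rewrite big_ord_recl [X in _ = _ + X]big_ord_recr /= bin0 subn0 bin_small // mulr0n addr0.
congr (_ + _); apply: eq_bigr => i _.
by rewrite -[bump 0 i]/(i.+1) subnSK.
Qed.

Section Taylor.
Variables (p : nat) (A : comPzRingType) (d : nat).
Hypothesis HA : padic_ring p A.
Implicit Types (lam mu : 'I_d -> A).

Section Iterate.
Variable V : lmodType A.
Variable nab : 'I_d -> V -> V.

(** The n-th power of sum_l lam_l nabla_l in which the lam_l are treated as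
    constants, followed by h.  Keeping the lam_l outside of h lets them live on
    the target side, where the scalars are twisted by Frobenius. *)
Fixpoint lop (M : lmodType A) lam n (h : V -> M) (v : V) : M :=
  if n is n'.+1 then \sum_l lam l *: lop lam n' h (nab l v) else h v.

Lemma lop_comm (M : lmodType A) lam n (h : V -> M) (D : V -> V) v :
  (forall l u, nab l (D u) = D (nab l u)) ->
  lop lam n (fun w => h (D w)) v = lop lam n h (D v).
Proof.
move=> Dnab; elim: n v => //= n IH v.
by apply: eq_bigr => l _; rewrite IH Dnab.
Qed.

Lemma lop_map (M M' : lmodType A) lam n (G : M -> M') (h : V -> M) v :
  (forall x y, G (x + y) = G x + G y) -> (forall l x, G (lam l *: x) = lam l *: G x) ->
  lop lam n (fun w => G (h w)) v = G (lop lam n h v).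
Proof.
move=> GD GZ; have G0 : G 0 = 0 by apply: (addrI (G 0)); rewrite -GD !addr0.
elim: n v => //= n IH v; rewrite (big_morph G GD G0).
by apply: eq_bigr => l _; rewrite IH GZ.
Qed.

Lemma lopZ (M : lmodType A) lam n a (h : V -> M) v :
  lop lam n (fun w => a *: h w) v = a *: lop lam n h v.
Proof.
apply: (@lop_map _ _ _ _ (fun x => a *: x)) => [x y|l x]; first by rewrite scalerDr.
by rewrite !scalerA mulrC.
Qed.

Lemma lopMn (M : lmodType A) lam n k (h : V -> M) v :
  lop lam n (fun w => h w *+ k) v = lop lam n h v *+ k.
Proof.
apply: (@lop_map _ _ _ _ (fun x => x *+ k)) => [x y|l x]; first by rewrite mulrnDl.
by rewrite scalerMnr.
Qed.

Lemma lop_sum (M : lmodType A) lam n (I : finType) (h : I -> V -> M) v :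
  lop lam n (fun w => \sum_i h i w) v = \sum_i lop lam n (h i) v.
Proof.
elim: n v => //= n IH v; rewrite exchange_big /=; apply: eq_bigr => l _.
by rewrite IH scaler_sumr.
Qed.

(** The nabla_l commute and the lam_l are treated as constants, so this is the
    binomial theorem. *)
Lemma lop_binomial (M : lmodType A) lam mu n (h : V -> M) v :
  (forall i j u, nab i (nab j u) = nab j (nab i u)) ->
  lop (fun l => lam l + mu l) n h v =
  \sum_(m < n.+1) lop lam m (lop mu (n - m) h) v *+ 'C(n, m).
Proof.
move=> nabC; elim: n v => [|n IH] v; first by rewrite big_ord_recl big_ord0 addr0.
rewrite [LHS]/=.
have -> : \sum_l (lam l + mu l) *: lop (fun l => lam l + mu l) n h (nab l v) =
    \sum_(m < n.+1) lop lam m.+1 (lop mu (n - m) h) v *+ 'C(n, m) +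
    \sum_(m < n.+1) lop lam m (lop mu (n - m).+1 h) v *+ 'C(n, m).
  under eq_bigr do rewrite IH scalerDl.
  rewrite big_split /=; congr (_ + _).
    under eq_bigr do rewrite scaler_sumr.
    rewrite exchange_big /=; apply: eq_bigr => m _; rewrite /= -sumrMnl.
    by apply: eq_bigr => l _; rewrite scalerMnr.
  under eq_bigr do rewrite scaler_sumr.
  rewrite exchange_big /=; apply: eq_bigr => m _.
  rewrite (lop_sum lam m (fun l w => mu l *: lop mu (n - m) h (nab l w))) -sumrMnl.
  apply: eq_bigr => l _; rewrite lopZ -scalerMnr.
  by rewrite (@lop_comm _ _ _ _ (nab l)).
exact: (pascal_sum n (fun a b => lop lam a (lop mu b h) v)).
Qed.

End Iterate.

Lemma lop_morph (V V' M : lmodType A) (nab : 'I_d -> V -> V) (nab' : 'I_d -> V' -> V')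
    lam n (h : V' -> M) (D : V -> V') v :
  (forall l u, D (nab l u) = nab' l (D u)) ->
  lop nab lam n (fun w => h (D w)) v = lop nab' lam n h (D v).
Proof.
move=> Dnab; elim: n v => //= n IH v.
by apply: eq_bigr => l _; rewrite IH Dnab.
Qed.

Section Filtered.
Variables (b : nat) (V : lmodType A).
Variables (nab : 'I_d -> V -> V) (der : 'I_d -> A -> A) (F : nat -> V -> Prop).
Hypothesis bp : (b < p)%N.
Hypothesis F_scale : forall r c v, F r v -> F r (c *: v).
Hypothesis F_dec : forall r v, F r.+1 v -> F r v.
Hypothesis F_nab : forall r l v, F r v -> F r.-1 (nab l v).
Hypothesis nabD : forall l u v, nab l (u + v) = nab l u + nab l v.
Hypothesis nab_leibniz : forall l c v, nab l (c *: v) = c *: nab l v + der l c *: v.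
Hypothesis nabC : forall i j v, nab i (nab j v) = nab j (nab i v).

Lemma F_le r s v : (r <= s)%N -> F s v -> F r v.
Proof.
by elim: s => [|s IH]; [case: r|rewrite leq_eqVlt => /orP[/eqP ->//|] rs /F_dec; exact: IH].
Qed.

Section OneTarget.
Variable M : lmodType A.
Hypothesis Ms : padic_sep M p.
Hypothesis Mc : padic_lim M p.

(** The properties of v |-> [v]_(a+r): such families are the semilinear maps on V~,
    described on generators and relations. *)
Record is_family (Psi : A -> A) (g : nat -> V -> M) : Prop := IsFamily {
  famD : forall r u v, (r <= b)%N -> F r u -> F r v -> g r (u + v) = g r u + g r v;
  famZ : forall r c v, (r <= b)%N -> F r v -> g r (c *: v) = Psi c *: g r v;
  fam_rel : forall r v, (r < b)%N -> F r.+1 v -> g r v = g r.+1 v *+ p }.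

(** Transport of the family g by lam.  In degree r the first r applications of
    nabla lower the degree of g, and the later ones stay in degree 0: truncated
    subtraction in the index of g and in [kap] does the bookkeeping. *)
Definition taylor lam (g : nat -> V -> M) (r : nat) (v : V) : M :=
  ksum p r (fun n => lop nab lam n (g (r - n)%N) v).

Lemma lop_ext lam r n (h h' : V -> M) v :
  (forall w, F (r - n) w -> h w = h' w) -> F r v ->
  lop nab lam n h v = lop nab lam n h' v.
Proof.
elim: n r v => [|n IH] r v hh' Fv /=; first by apply: hh'; rewrite subn0.
apply: eq_bigr => l _; congr (_ *: _); apply: (IH r.-1); last exact: F_nab.
by move=> w Fw; apply: hh'; move: Fw; rewrite -subn1 -subnDA add1n.
Qed.

Lemma lopD lam r n (h : V -> M) u v :
  (forall u v, F (r - n) u -> F (r - n) v -> h (u + v) = h u + h v) ->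
  F r u -> F r v -> lop nab lam n h (u + v) = lop nab lam n h u + lop nab lam n h v.
Proof.
elim: n r u v => [|n IH] r u v hD Fu Fv /=; first by apply: hD; rewrite subn0.
rewrite -big_split /=; apply: eq_bigr => l _; rewrite nabD -scalerDr; congr (_ *: _).
apply: (IH r.-1); try exact: F_nab.
by move=> ? ?; rewrite -subn1 -subnDA add1n; exact: hD.
Qed.

Lemma lop_ksum lam n r (h : nat -> V -> M) v : (r < p)%N ->
  lop nab lam n (fun w => ksum p r (fun k => h k w)) v =
  ksum p r (fun k => lop nab lam n (h k) v).
Proof.
move=> rp; elim: n v => //= n IH v.
rewrite (ksum_big HA) //; apply: eq_bigr => l _.
by rewrite IH (ksumZ HA).
Qed.

(** The Leibniz rule iterated n times; the derivatives of the scalar c are the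
    same construction, for the ring itself in place of V. *)
Lemma lop_leibniz Psi lam r n (h : V -> M) c v :
  (forall u v, F (r - n) u -> F (r - n) v -> h (u + v) = h u + h v) ->
  (forall c v, F (r - n) v -> h (c *: v) = Psi c *: h v) ->
  F r v ->
  lop nab lam n h (c *: v) =
  \sum_(m < n.+1) lop (der : 'I_d -> A^o -> A^o) lam m (Psi : A^o -> A^o) c *:
                  lop nab lam (n - m) h v *+ 'C(n, m).
Proof.
elim: n r c v => [|n IH] r c v hD hZ Fv.
  by rewrite big_ord_recl big_ord0 addr0 /= hZ // subn0.
have e : (r - n.+1 = r.-1 - n)%N by rewrite -subn1 -subnDA add1n.
rewrite e in hD hZ.
set PA := fun m => lop (der : 'I_d -> A^o -> A^o) lam m (Psi : A^o -> A^o).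
rewrite -(pascal_sum n (fun a b => PA a c *: lop nab lam b h v)) /=.
have Fv' : F r.-1 v by apply: F_le Fv; exact: leq_pred.
have step l : lop nab lam n h (nab l (c *: v)) =
    \sum_(m < n.+1) PA m (der l c) *: lop nab lam (n - m) h v *+ 'C(n, m) +
    \sum_(m < n.+1) PA m c *: lop nab lam (n - m) h (nab l v) *+ 'C(n, m).
  have Fl : F r.-1 (nab l v) by exact: F_nab.
  rewrite nab_leibniz (@lopD lam r.-1) //; try exact: F_scale.
  by rewrite !(IH r.-1) // addrC.
under eq_bigr do rewrite step scalerDr.
rewrite big_split /=; congr (_ + _).
  under eq_bigr do rewrite scaler_sumr.
  rewrite exchange_big /=; apply: eq_bigr => m _; rewrite scaler_suml -sumrMnl.
  by apply: eq_bigr => l _; rewrite -scalerMnr scalerA.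
under eq_bigr do rewrite scaler_sumr.
rewrite exchange_big /=; apply: eq_bigr => m _; rewrite scaler_sumr -sumrMnl.
by apply: eq_bigr => l _; rewrite -scalerMnr !scalerA mulrC.
Qed.

Lemma taylor_ext lam (g g' : nat -> V -> M) r v :
  (forall s w, (s <= r)%N -> F s w -> g s w = g' s w) -> F r v ->
  taylor lam g r v = taylor lam g' r v.
Proof.
move=> gg Fv; apply: eq_ksum => n; apply: (@lop_ext lam r) => // w.
by apply: gg; exact: leq_subr.
Qed.

Section Family.
Variables (Psi : A -> A) (g : nat -> V -> M).
Hypothesis gF : is_family Psi g.

Lemma fam_pow r n v : (r <= b)%N -> F r v -> g (r - n)%N v = g r v *+ p ^ minn r n.
Proof.
move=> rb Fv; elim: n => [|n IH]; first by rewrite subn0 minn0 mulr1n.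
case: (ltnP n r) => nr; last first.
  by have -> : (r - n.+1 = r - n)%N by [lia]; rewrite IH; congr (_ *+ _ ^ _); lia.
rewrite (fam_rel gF); last 2 first.
- lia.
- by apply: F_le Fv; lia.
have -> : ((r - n.+1).+1 = r - n)%N by lia.
by rewrite IH -mulrnA -expnSr; congr (_ *+ _ ^ _); lia.
Qed.

Lemma taylorD lam r u v : (r <= b)%N -> F r u -> F r v ->
  taylor lam g r (u + v) = taylor lam g r u + taylor lam g r v.
Proof.
move=> rb Fu Fv; rewrite /taylor -(ksumD HA) ?(leq_ltn_trans rb) //.
apply: eq_ksum => n; apply: (@lopD lam r) => // *; apply: (famD gF) => //; lia.
Qed.

(** Termwise, the power of p gained from [kap] when n > r is the one gained from
    the relation of the family when n <= r. *)
Lemma taylor_rel lam r v : (r < b)%N -> F r.+1 v ->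
  taylor lam g r v = taylor lam g r.+1 v *+ p.
Proof.
move=> rb Fv; have rp := leq_ltn_trans rb bp; rewrite /taylor (ksumMn HA) //.
apply: (ksum_level HA); [exact: ltnW|exact: rp|exact: Ms|exact: Mc|move=> n].
rewrite (kap_level HA) //; case: leqP => nr; last first.
  have [-> ->] : (r - n = 0 /\ r.+1 - n = 0)%N by lia.
  by rewrite -scalerMnl scalerMnr.
rewrite -lopMn; congr (_ *: _); apply: (@lop_ext lam r.+1) => // w.
rewrite subSn // => Fw; apply: (fam_rel gF) => //; lia.
Qed.

(** Transport is multiplicative: by the Leibniz formula and the product of
    exponential series, the scalar comes out as its own transport along the
    derivations, in degree 0. *)
Lemma taylorZ lam r c v : (r <= b)%N -> F r v ->
  taylor lam g r (c *: v) =
  (ksum p 0 (fun m => lop (der : 'I_d -> A^o -> A^o) lam m (Psi : A^o -> A^o) c) : A)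
    *: taylor lam g r v.
Proof.
move=> rb Fv; have rp := leq_ltn_trans rb bp.
have p0 : (0 < p)%N by exact: leq_ltn_trans rp.
set PA := fun m => lop (der : 'I_d -> A^o -> A^o) lam m (Psi : A^o -> A^o).
rewrite /taylor (ksumZ HA) //.
transitivity (ksum p r (fun k => ksum p (r - k) (fun m =>
   PA m c *: lop nab lam k (g (r - k - m)%N) v))); last first.
  apply: eq_ksum => k; rewrite (ksumZl HA) //; apply: (ksum_level HA) => //.
    exact: leq_ltn_trans (leq_subr _ _) rp.
  move=> m; rewrite !scalerA ![_ * PA m c]mulrC -!scalerA; congr (_ *: _).
  rewrite (kap_min HA m (leq_ltn_trans (leq_subr k r) rp)) -scalerMnl scalerMnr.
  congr (_ *: _); rewrite -lopMn; apply: (@lop_ext lam r) => // w Fw.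
  by apply: fam_pow Fw; lia.
apply/esym; apply: etrans (@ksum_double _ _ HA M Ms Mc r
  (fun k m => PA m c *: lop nab lam k (g (r - k - m)%N) v) rp) _.
apply: eq_ksum => n.
rewrite [RHS](@lop_leibniz Psi lam r) //; last 2 first.
- by move=> *; apply: (famD gF) => //; lia.
- by move=> *; apply: (famZ gF) => //; lia.
rewrite (reindex_inj rev_ord_inj) /=; apply: eq_bigr => m _.
rewrite subSS subKn ?bin_sub -1?ltnS //.
by congr (_ *: lop _ _ _ (g _) _ *+ _); have := ltn_ord m; lia.
Qed.

(** exp(lam nabla) exp(mu nabla) = exp((lam + mu) nabla) for commuting nabla. *)
Lemma taylor_taylor lam mu r v : (r <= b)%N -> F r v ->
  taylor lam (taylor mu g) r v = taylor (fun l => lam l + mu l) g r v.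
Proof.
move=> rb Fv; have rp := leq_ltn_trans rb bp; rewrite /taylor.
under eq_ksum => n do rewrite lop_ksum ?(leq_ltn_trans (leq_subr _ _) rp) //.
apply: etrans (@ksum_double _ _ HA M Ms Mc r
  (fun m n => lop nab lam m (fun w => lop nab mu n (g (r - m - n)%N) w) v) rp) _.
apply: eq_ksum => n; rewrite lop_binomial //; apply: eq_bigr => m _; congr (_ *+ _).
apply: (@lop_ext lam r) => // w _.
by congr (lop _ _ _ (g _) _); have := ltn_ord m; lia.
Qed.

Lemma taylor_id r v : (r <= b)%N -> taylor (fun _ => 0) g r v = g r v.
Proof.
move=> rb; rewrite /taylor (ksum_eq0 HA) ?subn0 ?(leq_ltn_trans rb) //.
by case=> // n _ /=; rewrite big1 // => l _; rewrite scale0r.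
Qed.

End Family.

(** The value in degree r - 1; below degree 0 it is p times the value in degree 0,
    as in the convention [v]_(a-1) = p [v]_a. *)
Definition lower (g : nat -> V -> M) r v := if r is r'.+1 then g r' v else g 0%N v *+ p.

(** Differentiating one of the n factors lam_l produces d lam_l times one
    application of nabla_l; commutativity moves that application to the right. *)
Lemma lop_derive lam (D : M -> M) (dl : 'I_d -> A) n (h : V -> M) v :
  (forall x y, D (x + y) = D x + D y) ->
  (forall l x, D (lam l *: x) = lam l *: D x + dl l *: x) ->
  D (lop nab lam n h v) = lop nab lam n (fun w => D (h w)) v +
     (\sum_l dl l *: lop nab lam n.-1 h (nab l v)) *+ n.
Proof.
move=> DD DZ; have D0 : D 0 = 0 by apply: (addrI (D 0)); rewrite -DD !addr0.
elim: n v => [|n IH] v /=; first by rewrite mulr0n addr0.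
rewrite (big_morph D DD D0).
under eq_bigr => l _ do rewrite DZ IH scalerDr -addrA.
rewrite big_split /=; congr (_ + _); rewrite big_split /= mulrS addrC; congr (_ + _).
under eq_bigr do rewrite -scalerMnr.
rewrite sumrMnl; case: n {IH} => [|n]; first by rewrite !mulr0n.
congr (_ *+ _); under eq_bigr do rewrite scaler_sumr.
rewrite exchange_big /=; apply: eq_bigr => k _; rewrite scaler_sumr.
by apply: eq_bigr => l _; rewrite !scalerA mulrC nabC.
Qed.

(** The derivative of exp(lam nabla) g is exp(lam nabla)(dg) plus d lam times the
    same series shifted by one step, which is the transport one degree lower.  So
    the coefficients ff of the connection matrix become ff + d lam. *)
Lemma taylor_derive lam g (D : M -> M) (dl ff : 'I_d -> A) r v :
  (forall x y, D (x + y) = D x + D y) ->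
  (forall l x, D (lam l *: x) = lam l *: D x + dl l *: x) ->
  (forall n x, D (kap p A r n *: x) = kap p A r n *: D x) ->
  (forall s w, (s <= b)%N -> F s w ->
     D (g s w) = \sum_j ff j *: lower g s (nab j w)) ->
  (r <= b)%N -> F r v ->
  D (taylor lam g r v) = \sum_j (ff j + dl j) *: lower (taylor lam g) r (nab j v).
Proof.
move=> DD DZ Dk Dg rb Fv; have rp := leq_ltn_trans rb bp.
under [RHS]eq_bigr do rewrite scalerDl.
rewrite big_split /= /taylor.
rewrite (@ksum_map _ _ HA _ _ D _ _ (fun n => lop nab lam n (fun w => D (g (r - n)%N w)) v +
  (\sum_l dl l *: lop nab lam n.-1 (g (r - n)%N) (nab l v)) *+ n)) //; last first.
  by move=> n; rewrite Dk (lop_derive _ _ _ DD DZ).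
rewrite (ksumD HA) //; congr (_ + _).
  transitivity (ksum p r (fun n => \sum_j ff j *: lop nab lam n (lower g (r - n)) (nab j v))).
    apply: eq_ksum => n.
    rewrite (@lop_ext lam r _ _
      (fun w => \sum_j ff j *: lower g (r - n) (nab j w))) //; last first.
      by move=> w; apply: Dg; lia.
    rewrite lop_sum; apply: eq_bigr => j _; rewrite lopZ (@lop_comm _ _ _ _ _ _ (nab j)) //.
  rewrite (ksum_big HA) //; apply: eq_bigr => j _; rewrite -(ksumZ HA) //; congr (_ *: _).
  case: r rb rp {Fv Dk} => [|r] rb rp /=.
    rewrite (ksumMn HA) //; apply: eq_ksum => n; rewrite sub0n /= lopMn //.
  apply: (ksum_level HA); [exact: rp|exact: ltnW|exact: Ms|exact: Mc|move=> n].
  rewrite (kap_level HA n rp) //; case: leqP => nr; first by rewrite subSn.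
  have [-> ->] : (r - n = 0 /\ r.+1 - n = 0)%N by lia.
  by rewrite lopMn -scalerMnl scalerMnr.
under eq_ksum do rewrite -sumrMnl.
rewrite (ksum_big HA) //; apply: eq_bigr => j _.
under eq_ksum do rewrite scalerMnr.
rewrite -(ksumZ HA) //; congr (_ *: _).
case: r rb rp {Fv Dk} => [|r] rb rp /=.
  rewrite -(ksum_shift0 HA) //; apply: eq_ksum => n; rewrite sub0n //.
rewrite -[RHS](ksum_shift HA) //; apply: eq_ksum => -[|n] //=.
Qed.

End OneTarget.

Lemma taylor_map (M M' : lmodType A) (G : M -> M') lam g r v : (r < p)%N ->
  padic_lim M p -> padic_sep M' p -> padic_lim M' p -> linear G ->
  G (taylor lam g r v) = taylor lam (fun s w => G (g s w)) r v.
Proof.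
move=> rp Mc M's M'c Gl.
have GD x y : G (x + y) = G x + G y by have := Gl 1 x y; rewrite !scale1r.
have G0 : G 0 = 0 by apply: (addrI (G 0)); rewrite -GD !addr0.
have GZ a x : G (a *: x) = a *: G x by have := Gl a x 0; rewrite G0 !addr0.
rewrite /taylor; apply: (ksum_map HA) => // n.
by rewrite GZ (@lop_map _ _ _ _ _ _ G).
Qed.

End Filtered.
End Taylor.

(** * The exponential of multiples of p *)

Section PadicExp.
Variables (p : nat) (A : comPzRingType).
Hypothesis HA : padic_ring p A.

Let p_pr : prime p. Proof. by case: HA. Qed.
Let p_gt0 : (0 < p)%N. Proof. exact: prime_gt0. Qed.
Let As : padic_sep A^o p. Proof. exact: (complete_sep HA). Qed.
Let Ac : padic_lim A^o p. Proof. exact: (complete_lim HA). Qed.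

Definition pexp1 (a : A) : A := ksum p 0 (fun n => (a ^+ n : A^o)).

Lemma pexp10 : pexp1 0 = 1.
Proof.
rewrite /pexp1 (ksum_eq0 HA) ?expr0 // => -[|n] // _.
by rewrite expr0n.
Qed.

Lemma pexp1D a b : pexp1 (a + b) = pexp1 a * pexp1 b.
Proof.
rewrite /pexp1; set eb := ksum p 0 (fun n => b ^+ n : A^o).
apply/esym; apply: etrans (ksumZl HA (M := A^o) (r := 0) (fun n => a ^+ n) eb p_gt0 As Ac) _.
transitivity (ksum p 0 (fun m => ksum p (0 - m) (fun n => (a ^+ m * b ^+ n : A^o)))).
  by apply: eq_ksum => m; rewrite sub0n /eb (ksumZ HA).
apply: etrans (ksum_double HA As Ac _ p_gt0) _; apply: eq_ksum => n.
rewrite exprDn (reindex_inj rev_ord_inj) /=; apply: eq_bigr => i _.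
by rewrite subSS subKn ?bin_sub // -ltnS.
Qed.

Lemma pexp1N a : pexp1 a * pexp1 (- a) = 1.
Proof. by rewrite -pexp1D subrr pexp10. Qed.

(** All terms of the series from n = 2 on are divisible by p^2 and contain
    a factor a. *)
Lemma pexp1_lin k a : zdvd (p ^ k) a -> zdvd (p ^ k.+2) (pexp1 a - (1 + a *+ p)).
Proof.
move=> ak; have := ksumP HA Ac (fun n => a ^+ n : A^o) p_gt0 (leqnn (kbnd p k.+2)).
have : (2 <= kbnd p k.+2)%N by rewrite /kbnd; lia.
case: (kbnd p k.+2) => [|[|n]] // _ h; apply: zdvd_chain h _.
rewrite !big_ord_recl /= (kap_n0 HA) // (kap01 HA) expr0 expr1 !scale1r scaler_nat.
have cancel m (x y z : A) : zdvd m z -> zdvd m (x + (y + z) - (x + y)).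
  by have -> : x + (y + z) - (x + y) = z by ring.
apply: cancel; apply: zdvd_sum => i _.
rewrite -[k.+2]addn2 addnC expnD; apply: zdvdM; first exact: (kap0_p2 HA).
by rewrite exprS; apply: zdvdMr.
Qed.

Lemma pexp1_eq1 k a : zdvd (p ^ k.+1) (pexp1 a - 1) -> zdvd (p ^ k) a.
Proof.
elim: k => [|k IH] h; first exact: zdvd1.
have ak : zdvd (p ^ k) a by apply: IH; exact: zdvd_exp h.
apply: (@tf_zdvd _ _ HA k.+1 1); rewrite addn1 expn1.
have -> : a *+ p = (pexp1 a - 1) - (pexp1 a - (1 + a *+ p)) by ring.
by apply: zdvdB h _; exact: pexp1_lin.
Qed.

Lemma pexp1_inj_mod k a b : zdvd (p ^ k.+1) (pexp1 a - pexp1 b) -> zdvd (p ^ k) (a - b).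
Proof.
move=> h; apply: pexp1_eq1; rewrite pexp1D -(pexp1N b) -mulrBl.
exact: zdvdMr.
Qed.

Lemma pexp1_inj a b : pexp1 a = pexp1 b -> a = b.
Proof.
move=> e; apply/eqP; rewrite -subr_eq0; apply/eqP/As => k.
by apply: pexp1_inj_mod; rewrite e subrr; exact: zdvd0.
Qed.

(** Successive approximation: a multiplicative error 1 + c p with c divisible by
    p^k is corrected by exp(c p) up to p^(k+2). *)
Lemma pexp1_surj x : exists a, pexp1 a = 1 + x *+ p.
Proof.
have ex k : exists a, zdvd (p ^ k.+1) (pexp1 a - (1 + x *+ p)).
  elim: k => [|k [a [y ya]]].
    by exists 0; exists (- x); rewrite pexp10 expn1 mulNrn; ring.
  pose c := - (pexp1 (- a) * y) *+ p ^ k.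
  exists (a + c); rewrite pexp1D.
  have -> : 1 + x *+ p = pexp1 a * (1 + c *+ p).
    rewrite /c -mulrnA -expnSr mulrDr mulr1 mulNrn mulrN -mulrnAr mulrA pexp1N mul1r.
    by rewrite -ya; ring.
  rewrite -mulrBr; apply: zdvdMl; apply: pexp1_lin.
  by exists (- (pexp1 (- a) * y)).
have [f fP] := choice ex.
have [k|l lP] := Ac (x := f).
  apply: pexp1_inj_mod; apply: zdvd_chain (zdvd_sym (fP k)).
  by apply: zdvd_exp (fP _).
exists l; apply/eqP; rewrite -subr_eq0; apply/eqP/As => k.
apply: zdvd_chain (zdvd_exp (leqnSn k) (fP k)).
have -> : pexp1 l - pexp1 (f k) = pexp1 (f k) * (pexp1 (l - f k) - 1).
  by rewrite mulrBr mulr1 -pexp1D [f k + _]addrC subrK.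
apply: zdvdMl.
have -> : pexp1 (l - f k) - 1 =
  (pexp1 (l - f k) - (1 + (l - f k) *+ p)) + (l - f k) *+ p by ring.
apply: zdvdD; first by apply: zdvd_exp (pexp1_lin (lP k)); lia.
by apply: zdvd_mulrn; exact: lP.
Qed.

Section Derivation.
Variable D : A -> A.
Hypothesis DD : forall x y, D (x + y) = D x + D y.
Hypothesis DM : forall x y, D (x * y) = x * D y + D x * y.

Lemma der0 : D 0 = 0.
Proof. by apply: (addrI (D 0)); rewrite -DD !addr0. Qed.

Lemma der1 : D 1 = 0.
Proof. by apply: (addrI (D 1)); rewrite addr0 -{3}[1]mulr1 DM mulr1 mul1r. Qed.

Lemma derMn n x : D (x *+ n) = D x *+ n.
Proof. by elim: n => [|n IH]; rewrite ?der0 // !mulrS DD IH. Qed.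

Lemma derXn n x : D (x ^+ n) = x ^+ n.-1 * D x *+ n.
Proof.
elim: n => [|n IH]; first by rewrite der1 mulr0n.
case: n IH => [|n] IH; first by rewrite expr1 expr0 mul1r.
by rewrite exprS DM IH /= mulrnAr mulrA -exprS [D x * _]mulrC -mulrSr.
Qed.

(** Derivations kill [kap] because n! [kap] is an integer and n! is cancellable. *)
Lemma der_kap r n x : (r < p)%N -> D (kap p A r n * x) = kap p A r n * D x.
Proof.
move=> rp; rewrite DM; have -> : D (kap p A r n) = 0; last by rewrite mul0r addr0.
apply: (fact_inj HA (n := n)).
by rewrite -derMn (kapE HA) // derMn der1 !mul0rn.
Qed.

Lemma der_pexp1 a : D (pexp1 a) = pexp1 a * D a *+ p.
Proof.
rewrite /pexp1.
apply: etrans (@ksum_map _ _ HA A^o A^o D 0 _ (fun n => (a ^+ n.-1 * D a *+ n : A^o))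
  p_gt0 Ac As Ac DD _) _.
  by move=> n; rewrite /= [LHS]der_kap // derXn.
apply: etrans (ksum_shift0 HA As Ac (fun n => a ^+ n * D a : A^o)) _.
by congr (_ *+ _); apply/esym; exact: (ksumZl HA (M := A^o)).
Qed.

End Derivation.
End PadicExp.

(** * Auxiliary rings: quotients, subrings, dual numbers *)

(** Ideals are predicates with values in propositions, since those that occur need
    not be decidable. *)
Record is_ideal (A : pzRingType) (I : A -> Prop) : Prop := IsIdeal {
  ideal0 : I 0;
  idealD : forall x y, I x -> I y -> I (x + y);
  idealMl : forall a x, I x -> I (a * x) }.

Section IdealTheory.
Variables (A : comPzRingType) (I : A -> Prop).
Hypothesis IP : is_ideal I.

Lemma idealMr a x : I x -> I (x * a).
Proof. by rewrite mulrC; exact: idealMl. Qed.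

Lemma idealN x : I x -> I (- x).
Proof. by rewrite -mulN1r; exact: idealMl. Qed.

Lemma idealB x y : I x -> I y -> I (x - y).
Proof. by move=> Ix Iy; apply: idealD => //; exact: idealN. Qed.

Lemma idealMn n x : I x -> I (x *+ n).
Proof. by rewrite -mulr_natl; exact: idealMl. Qed.

Lemma ideal_sum (T : Type) (s : seq T) (P : pred T) (F : T -> A) :
  (forall i, P i -> I (F i)) -> I (\sum_(i <- s | P i) F i).
Proof. by move=> h; elim/big_ind: _ => //; [exact: ideal0|exact: idealD]. Qed.

End IdealTheory.

Section QuotientRing.
Variable A : comPzRingType.

Definition ideal_pred (I : A -> Prop) (IP : is_ideal I) : {pred A^o} :=
  fun x => `[< I x >].

Lemma ideal_pred_closed I (IP : is_ideal I) : submod_closed (ideal_pred IP).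
Proof.
split; first by apply/asboolP; exact: ideal0.
move=> c x y /asboolP Ix /asboolP Iy; apply/asboolP.
by apply: idealD => //; exact: idealMl.
Qed.

HB.instance Definition _ I (IP : is_ideal I) :=
  GRing.isSubmodClosed.Build A A^o (ideal_pred IP) (ideal_pred_closed IP).

Definition ideal_quotient I (IP : is_ideal I) :=
  quotm (ideal_pred IP : submodClosed A^o).

Section Mul.
Variables (I : A -> Prop) (IP : is_ideal I).
Local Notation Q := (ideal_quotient IP).
Local Notation pi := (quotm_pi (ideal_pred IP : submodClosed A^o)).

HB.instance Definition _ := GRing.Zmodule.on Q.

Definition iq_mul (x y : Q) : Q := pi (repr x * repr y : A).

Lemma iq_mulE (a b : A) : iq_mul (pi a) (pi b) = pi (a * b).
Proof.
apply: quotm_piE; apply/asboolP.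
have /asboolP ha := quotm_repr (ideal_pred IP : submodClosed A^o) a.
have /asboolP hb := quotm_repr (ideal_pred IP : submodClosed A^o) b.
set a' : A := repr _ in ha *; set b' : A := repr _ in hb *.
have -> : a' * b' - a * b = a' * (b' - b) + b * (a' - a) by ring.
by apply: idealD => //; apply: idealMl.
Qed.

Lemma iq_ind (P : Q -> Prop) : (forall a : A, P (pi a)) -> forall x, P x.
Proof. by move=> Pa x; rewrite -[x]quotm_reprK; exact: Pa. Qed.

Lemma iq_mulA : associative iq_mul.
Proof.
move=> x y z; move: x; elim/iq_ind => x; move: y; elim/iq_ind => y.
by move: z; elim/iq_ind => z; rewrite !iq_mulE mulrA.
Qed.

Lemma iq_mulC : commutative iq_mul.
Proof. by move=> x y; rewrite /iq_mul mulrC. Qed.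

Lemma iq_mul1 : left_id (pi 1) iq_mul.
Proof. by elim/iq_ind => x; rewrite iq_mulE mul1r. Qed.

Lemma iq_mulDl : left_distributive iq_mul +%R.
Proof.
move=> x y z; move: x; elim/iq_ind => x; move: y; elim/iq_ind => y.
move: z; elim/iq_ind => z.
by rewrite -quotm_piD !iq_mulE -quotm_piD mulrDl.
Qed.

HB.instance Definition _ := GRing.Zmodule_isComPzRing.Build Q
  iq_mulA iq_mulC iq_mul1 iq_mulDl.

Lemma iq_pi_zmod : zmod_morphism (pi : A -> Q).
Proof.
move=> x y; apply/esym/eqP; rewrite subr_eq; apply/eqP.
by rewrite -quotm_piD subrK.
Qed.

Lemma iq_pi_monoid : monoid_morphism (pi : A -> Q).
Proof. by split=> // x y; rewrite -iq_mulE. Qed.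

Definition iq_pi : A -> Q := pi.
HB.instance Definition _ := GRing.isZmodMorphism.Build A Q iq_pi iq_pi_zmod.
HB.instance Definition _ := GRing.isMonoidMorphism.Build A Q iq_pi iq_pi_monoid.

End Mul.
End QuotientRing.

Lemma quotient_ring (A : comPzRingType) (I : A -> Prop) : is_ideal I ->
  exists (Q : comPzRingType) (pi : {rmorphism A -> Q}),
    (forall y, exists x, pi x = y) /\ (forall x, pi x = 0 <-> I x).
Proof.
move=> IP; exists (ideal_quotient IP), (iq_pi IP); split.
  by elim/iq_ind => x; exists x.
move=> x; split=> [e|Ix].
  have := quotm_repr (ideal_pred IP : submodClosed A^o) x.
  have := quotm_repr (ideal_pred IP : submodClosed A^o) 0.
  have -> : quotm_pi (ideal_pred IP : submodClosed A^o) 0 = iq_pi IP x.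
    by rewrite e -[RHS](rmorph0 (iq_pi IP)).
  move=> /asboolP h1 /asboolP h2; have := idealB IP h1 h2.
  by rewrite subr0 opprB addrC subrK.
by rewrite -(rmorph0 (iq_pi IP)); apply: quotm_piE; apply/asboolP; rewrite subr0.
Qed.

Section Factor.
Variables (A Q B : comPzRingType) (pi : {rmorphism A -> Q}) (f : {rmorphism A -> B}).
Hypothesis pi_surj : forall y, exists x, pi x = y.
Hypothesis ker_le : forall x, pi x = 0 -> f x = 0.

Let sec (y : Q) : A := xget 0 [set x | pi x = y].
Let secK y : pi (sec y) = y.
Proof. by rewrite /sec; case: xgetP => // no; have [x /no] := pi_surj y. Qed.

Definition factor (y : Q) : B := f (sec y).

Lemma factorE x : factor (pi x) = f x.
Proof.
apply/eqP; rewrite -subr_eq0 -rmorphB; apply/eqP/ker_le.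
by rewrite rmorphB secK subrr.
Qed.

Lemma factor_zmod : zmod_morphism factor.
Proof. by move=> x y; rewrite -[x]secK -[y]secK -rmorphB !factorE rmorphB. Qed.

Lemma factor_monoid : monoid_morphism factor.
Proof.
split; first by rewrite -(rmorph1 pi) factorE rmorph1.
by move=> x y; rewrite -[x]secK -[y]secK -rmorphM !factorE rmorphM.
Qed.

End Factor.

Lemma ring_factor (A Q B : comPzRingType) (pi : {rmorphism A -> Q})
    (f : {rmorphism A -> B}) :
  (forall y, exists x, pi x = y) -> (forall x, pi x = 0 -> f x = 0) ->
  exists g : {rmorphism Q -> B}, forall x, g (pi x) = f x.
Proof.
move=> ps kl.
pose m1 := GRing.isZmodMorphism.Build _ _ _ (factor_zmod ps kl).
pose m2 := GRing.isMonoidMorphism.Build _ _ _ (factor_monoid ps kl).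
pose g : {rmorphism Q -> B} := HB.pack (factor pi f) m1 m2.
by exists g => x; exact: (factorE ps kl).
Qed.

Record is_subring (A : pzRingType) (S : A -> Prop) : Prop := IsSubring {
  sub1 : S 1;
  subB : forall x y, S x -> S y -> S (x - y);
  subM : forall x y, S x -> S y -> S (x * y) }.

Section Subring.
Variables (A : comPzRingType) (S : A -> Prop) (SP : is_subring S).

Definition subring_pred (_ : is_subring S) : {pred A} := fun x => `[< S x >].

Lemma subring_pred_closed : subring_closed (subring_pred SP).
Proof.
split; first by apply/asboolP; exact: sub1.
  by move=> x y /asboolP Sx /asboolP Sy; apply/asboolP; exact: subB.
by move=> x y /asboolP Sx /asboolP Sy; apply/asboolP; exact: subM.
Qed.

Definition subring_type := {x : A | x \in subring_pred SP}.
HB.instance Definition _ := SubChoice.on subring_type.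
HB.instance Definition _ :=
  GRing.SubChoice_isSubComPzRing.Build A (subring_pred SP) subring_type subring_pred_closed.

End Subring.

Lemma subring_exists (A : comPzRingType) (S : A -> Prop) : is_subring S ->
  exists (B : comPzRingType) (j : {rmorphism B -> A}),
    injective j /\ (forall x, S x <-> exists y, j y = x).
Proof.
move=> SP; exists (subring_type SP), (val : {rmorphism subring_type SP -> A}).
split; first exact: val_inj.
move=> x; split=> [Sx|[y <-]]; last by have /asboolP := valP y.
have xS : x \in subring_pred SP by apply/asboolP.
by exists (exist _ x xS).
Qed.

Section DualNumbers.
Variable A : comPzRingType.

Definition dual_num := (A * A)%type.
HB.instance Definition _ := GRing.Zmodule.on dual_num.

Definition dual_mul (x y : dual_num) : dual_num :=
  (x.1 * y.1, x.1 * y.2 + x.2 * y.1).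

Lemma dual_mulA : associative dual_mul.
Proof. by move=> [a b] [c d] [e f]; rewrite /dual_mul /=; congr (_, _); ring. Qed.

Lemma dual_mulC : commutative dual_mul.
Proof. by move=> [a b] [c d]; rewrite /dual_mul /=; congr (_, _); ring. Qed.

Lemma dual_mul1 : left_id ((1, 0) : dual_num) dual_mul.
Proof. by move=> [a b]; rewrite /dual_mul /= !mul1r mul0r addr0. Qed.

Lemma dual_mulDl : left_distributive dual_mul +%R.
Proof.
move=> x y z; apply: injective_projections; first exact: mulrDl.
change ((x.1 + y.1) * z.2 + (x.2 + y.2) * z.1 =
  x.1 * z.2 + x.2 * z.1 + (y.1 * z.2 + y.2 * z.1)); ring.
Qed.

HB.instance Definition _ := GRing.Zmodule_isComPzRing.Build dual_num
  dual_mulA dual_mulC dual_mul1 dual_mulDl.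

Definition dual_re (x : dual_num) : A := x.1.

Lemma dual_re_zmod : zmod_morphism dual_re.
Proof. by []. Qed.
Lemma dual_re_monoid : monoid_morphism dual_re.
Proof. by []. Qed.

HB.instance Definition _ := GRing.isZmodMorphism.Build dual_num A dual_re dual_re_zmod.
HB.instance Definition _ :=
  GRing.isMonoidMorphism.Build dual_num A dual_re dual_re_monoid.

End DualNumbers.

Lemma rmorph_pack (A B : comPzRingType) (f : A -> B) :
  (forall x y, f (x + y) = f x + f y) -> (forall x y, f (x * y) = f x * f y) ->
  f 1 = 1 -> exists g : {rmorphism A -> B}, forall x, g x = f x.
Proof.
move=> fD fM f1.
have f0 : f 0 = 0 by apply: (addrI (f 0)); rewrite -fD !addr0.
have fB : zmod_morphism f.
  move=> x y; apply/eqP; rewrite eq_sym subr_eq -fD subrK //.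
have fm : monoid_morphism f by [].
pose m1 := GRing.isZmodMorphism.Build _ _ _ fB.
pose m2 := GRing.isMonoidMorphism.Build _ _ _ fm.
pose g : {rmorphism A -> B} := HB.pack f m1 m2.
by exists g.
Qed.

(** The zero ring is a possible target, and is treated apart because polynomial
    evaluation asks for a nonzero ring. *)
Lemma mpoly_lift (S : comNzRingType) (n : nat) (C : comPzRingType)
    (g : {rmorphism S -> C}) (h : 'I_n -> C) :
  exists G : {rmorphism {mpoly S[n]} -> C},
    (forall c, G c%:MP = g c) /\ (forall i, G 'X_i = h i).
Proof.
have [C0|C1] := pselect (1 = 0 :> C).
  have z (x : C) : x = 0 by rewrite -[x]mul1r C0 mul0r.
  have [|||G _] := @rmorph_pack {mpoly S[n]} C (fun=> 0).
  - by move=> *; rewrite addr0.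
  - by move=> *; rewrite mulr0.
  - by rewrite C0.
  by exists G; split=> x; apply: etrans (z _) (esym (z _)).
have C1' : (1 : C) != 0 by apply/eqP.
pose m := GRing.PzSemiRing_isNonZero.Build C C1'.
pose Cn : comNzRingType := HB.pack (GRing.ComPzRing.sort C) m.
pose g' : {rmorphism S -> Cn} := g.
pose h' : 'I_n -> Cn := h.
pose G : {rmorphism {mpoly S[n]} -> Cn} := mmap g' h'.
exists G; split=> [c|i]; first exact: (mmapC h' g' c).
by apply: etrans (mmapX h' g' U_(i)%MM) _; exact: mmap1U.
Qed.

Lemma mpoly_hom_eq (S : comNzRingType) (n : nat) (C : comPzRingType)
    (G H : {rmorphism {mpoly S[n]} -> C}) :
  (forall c, G c%:MP = H c%:MP) -> (forall i, G 'X_i = H 'X_i) -> G =1 H.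
Proof.
move=> GHc GHX; elim/mpolyind => [|c m x _ _ IH]; first by rewrite !rmorph0.
rewrite !rmorphD IH; congr (_ + _); rewrite -mul_mpolyC !rmorphM GHc; congr (_ * _).
rewrite mpolyXE_id !rmorph_prod; apply: eq_bigr => i _.
by rewrite !rmorphXn GHX.
Qed.

(** * Lifting along p-nilpotent kernels *)

Section EtaleLift.
Variables (S R : comPzRingType) (f : {rmorphism S -> R}) (p : nat).
Hypothesis fe : formally_etale f.

(** The kernel J of q satisfies J^2 <= p J and p^n J = 0, so C is reached from C'
    through the quotients C / p^i J, each a square-zero extension of the previous
    one. *)
Lemma etale_lift_nilp n (C C' : comPzRingType) (q : {rmorphism C -> C'})
    (g : {rmorphism S -> C}) (h : {rmorphism R -> C'}) :
  (forall y, exists x, q x = y) ->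
  (forall x y, q x = 0 -> q y = 0 -> exists z, q z = 0 /\ x * y = z *+ p) ->
  (forall x, q x = 0 -> x *+ p ^ n = 0) ->
  (forall x, q (g x) = h (f x)) ->
  exists h' : {rmorphism R -> C},
    [/\ forall x, h' (f x) = g x, forall y, q (h' y) = h y
      & forall h'' : {rmorphism R -> C},
          (forall x, h'' (f x) = g x) -> (forall y, q (h'' y) = h y) -> h'' =1 h'].
Proof.
elim: n C C' q g h => [|n IH] C C' q g h qs qq qn qgh.
  by apply: fe => // x y /qn x0 _; rewrite -[x]mulr1n x0 mul0r.
pose I (x : C) := exists z, q z = 0 /\ x = z *+ p ^ n.
have IP : is_ideal I.
  split; first by exists 0; rewrite rmorph0 mul0rn.
    move=> _ _ [z [z0 ->]] [t [t0 ->]]; exists (z + t).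
    by rewrite rmorphD z0 t0 addr0 mulrnDl.
  by move=> a _ [z [z0 ->]]; exists (a * z); rewrite rmorphM z0 mulr0 mulrnAr.
have [Q [pi [pis piI]]] := quotient_ring IP.
have [|qb qbE] := ring_factor (f := q) pis.
  by move=> x /piI[z [z0 ->]]; rewrite rmorphMn /= z0 mul0rn.
have [||||h1 [h1f qh1 h1u]] := IH _ _ qb (pi \o g) h.
- by move=> y; have [x <-] := qs y; exists (pi x).
- move=> x y; have [x' <-] := pis x; have [y' <-] := pis y.
  rewrite !qbE => /qq h1 /h1[z [z0 e]]; exists (pi z).
  by rewrite qbE z0 -rmorphM e rmorphMn.
- move=> x; have [x' <-] := pis x; rewrite qbE => x0.
  by rewrite -rmorphMn; apply/piI; exists x'.
- by move=> x; rewrite /= qbE.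
have [||//|h' [h'f pih' h'u]] := fe (q := pi) (g := g) (h := h1).
- exact: pis.
- move=> x y /piI[z [z0 ->]] /piI[t [t0 ->]].
  have [u [u0 e]] := qq _ _ z0 t0.
  by rewrite mulrnAl mulrnAr e -!mulrnA mulnA -expnS mulrnA qn // mul0rn.
exists h'; split=> //.
  by move=> y; rewrite -qbE pih' qh1.
move=> h'' h''f qh''; apply: h'u => // y.
have := h1u (pi \o h''); rewrite /=; apply => [x|z]; first by rewrite /= h''f.
by rewrite /= qbE.
Qed.

(** Reduced modulo p^n, both maps lift the same map to A / p along a kernel as in
    [etale_lift_nilp], where lifts are unique. *)
Lemma hom_unique_padic (A : comPzRingType) (g1 g2 : {rmorphism R -> A}) :
  padic_sep A p -> (forall x, g1 (f x) = g2 (f x)) ->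
  (forall x, zdvd p (g1 x - g2 x)) -> g1 =1 g2.
Proof.
move=> As gf gp x; apply/eqP; rewrite -subr_eq0; apply/eqP/As => -[|n].
  exact: zdvd1.
have idl m : is_ideal (fun x : A => zdvd m x).
  by split; [exact: zdvd0|exact: zdvdD|move=> a y; exact: zdvdMl].
have [Q [pi [pis piI]]] := quotient_ring (idl (p ^ n.+1)%N).
have [Q1 [pi1 [pi1s pi1I]]] := quotient_ring (idl p).
have [|qb qbE] := ring_factor (f := pi1) pis.
  by move=> y /piI h; apply/pi1I; apply: zdvd_dvd h; rewrite expnS dvdn_mulr.
have [||||h' [_ _ h'u]] := @etale_lift_nilp n.+1 _ _ qb (pi \o g1 \o f) (pi1 \o g1).
- by move=> y; have [z <-] := pi1s y; exists (pi z).
- move=> u v; have [u' <-] := pis u; have [v' <-] := pis v.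
  rewrite !qbE => /pi1I[a ->] /pi1I[b ->]; exists (pi ((a * b) *+ p)); split.
    by rewrite qbE; apply/pi1I; exists (a * b).
  by rewrite -rmorphM -rmorphMn /= mulrnAl mulrnAr.
- move=> u; have [u' <-] := pis u; rewrite qbE => /pi1I[a ->].
  rewrite -rmorphMn; apply/piI; exists (a *+ p); rewrite -!mulrnA mulnC //.
- by move=> y; rewrite /= qbE.
have e1 : pi (g1 x) = h' x by apply: (h'u (pi \o g1)) => y //=; rewrite qbE.
have e2 : pi (g2 x) = h' x.
  apply: (h'u (pi \o g2)) => y /=; first by rewrite gf.
  apply/eqP; rewrite qbE -subr_eq0 -rmorphB; apply/eqP/pi1I.
  exact: zdvd_sym.
by apply/piI; rewrite rmorphB e1 e2 subrr.
Qed.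

End EtaleLift.

(** * Reducedness of étale algebras modulo p *)

Section IdealSquares.
Variable P : comPzRingType.

(** The square of I, as an intersection of ideals. *)
Definition isq (I : P -> Prop) (x : P) : Prop :=
  forall K, is_ideal K -> (forall u v, I u -> I v -> K (u * v)) -> K x.

Lemma isq_ideal I : is_ideal (isq I).
Proof.
split=> [K KP _|x y xI yI K KP h|a x xI K KP h]; first exact: ideal0.
  by apply: idealD => //; [exact: xI|exact: yI].
by apply: idealMl => //; exact: xI.
Qed.

Lemma isqM I u v : I u -> I v -> isq I (u * v).
Proof. by move=> Iu Iv K _; exact. Qed.

Fixpoint isqn (j : nat) (I : P -> Prop) : P -> Prop :=
  if j is j'.+1 then isq (isqn j' I) else I.

Lemma isqn_map (s : {rmorphism P -> P}) I j :
  (forall x, I x -> isq I (s x)) -> forall x, isqn j I x -> isqn j.+1 I (s x).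
Proof.
move=> sI; elim: j => [|j IH] x /= h; first exact: sI.
apply: (h (fun x => isqn j.+2 I (s x))).
  have IP := isq_ideal (isqn j.+1 I); split; rewrite ?rmorph0; first exact: (ideal0 IP).
    by move=> u v hu hv; rewrite rmorphD; exact: (idealD IP).
  by move=> a u hu; rewrite rmorphM; exact: (idealMl IP).
by move=> u v /IH hu /IH hv; rewrite rmorphM; exact: (isqM (I := isqn j.+1 I)).
Qed.

Section Generators.
Variables (m : nat) (r : 'I_m -> P).

(** The N-th power of the ideal generated by the r_i. *)
Definition gpow (N : nat) (x : P) : Prop :=
  forall K, is_ideal K ->
    (forall e : 'I_m -> nat, (\sum_i e i = N)%N -> K (\prod_i r i ^+ e i)) -> K x.

Lemma gpow_ideal N : is_ideal (gpow N).
Proof.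
split=> [K KP _|x y xI yI K KP h|a x xI K KP h]; first exact: ideal0.
  by apply: idealD => //; [exact: xI|exact: yI].
by apply: idealMl => //; exact: xI.
Qed.

Lemma gpowM M N x y : gpow M x -> gpow N y -> gpow (M + N) (x * y).
Proof.
move=> xM yN; apply: (xM (fun x => gpow (M + N) (x * y))).
  have GP := gpow_ideal (M + N); split.
  - by rewrite mul0r; exact: (ideal0 GP).
  - by move=> u v hu hv; rewrite mulrDl; exact: (idealD GP).
  - by move=> a u hu; rewrite -mulrA; exact: (idealMl GP).
move=> e eM; apply: (yN (fun y => gpow (M + N) (_ * y))).
  have GP := gpow_ideal (M + N); split.
  - by rewrite mulr0; exact: (ideal0 GP).
  - by move=> u v hu hv; rewrite mulrDr; exact: (idealD GP).
  - by move=> a u hu; rewrite mulrCA; exact: (idealMl GP).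
move=> e' eN K KP; rewrite -big_split /=; under eq_bigr do rewrite -exprD.
by apply; rewrite big_split /= eM eN.
Qed.

Lemma isqn_gpow (I : P -> Prop) j :
  (forall x, I x -> exists c, x = \sum_i c i * r i) ->
  forall x, isqn j I x -> gpow (2 ^ j) x.
Proof.
move=> Ir; elim: j => [|j IH] x /=.
  move=> /Ir[c ->]; apply: ideal_sum; first exact: gpow_ideal.
  move=> i _; apply: (idealMl (gpow_ideal _)) => K KP h.
  have e1 : (\sum_k (k == i) = 2 ^ 0)%N.
    by rewrite (bigD1 i) //= eqxx big1 // => k /negPf ->.
  have := h (fun k => (k == i)) e1; rewrite (bigD1 i) //= eqxx expr1 big1 ?mulr1 //.
  by move=> k /negPf ->; rewrite expr0.
move=> h; apply: (h (gpow (2 ^ j.+1))); first exact: gpow_ideal.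
by move=> u v /IH hu /IH hv; rewrite expnS mul2n -addnn; exact: gpowM.
Qed.

(** A monomial of degree above m q in m letters contains the q-th power of one. *)
Lemma gpow_pigeon (K : P -> Prop) q N : is_ideal K -> (m * q < N)%N ->
  (forall i, K (r i ^+ q)) -> forall x, gpow N x -> K x.
Proof.
move=> KP mN Kr x; apply=> // e eN.
have [i qi] : exists i, (q <= e i)%N.
  apply/existsP; rewrite -[X in is_true X]negbK negb_exists; apply/negP => /forallP h.
  move: mN; rewrite -eN ltnNge => /negP; apply.
  rewrite -[m in (m * q)%N]card_ord -sum_nat_const; apply: leq_sum => i _.
  by have := h i; rewrite -ltnNge => /ltnW.
rewrite (bigD1 i) //=; apply: idealMr => //.
by rewrite -(subnK qi) exprD; exact: idealMl.
Qed.

End Generators.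
End IdealSquares.

Lemma kernel_ideal (P R : comPzRingType) (q : {rmorphism P -> R}) :
  is_ideal (fun x => q x = 0).
Proof.
split; first exact: rmorph0.
  by move=> x y x0 y0; rewrite rmorphD x0 y0 addr0.
by move=> a x x0; rewrite rmorphM x0 mulr0.
Qed.

Section EtaleSelfMap.
Variables (S : comNzRingType) (R : comPzRingType) (f : {rmorphism S -> R}) (n : nat).
Local Notation P := {mpoly S[n]}.
Variable q : {rmorphism P -> R}.
Hypothesis fe : formally_etale f.
Hypothesis qf : forall c, q c%:MP = f c.
Hypothesis qs : forall y, exists x, q x = y.

(** The identity of R lifts to a map from R = P / I to P / I^2 over S, and lifting
    the images of the generators defines s on P. *)
Lemma etale_self_map : exists s : {rmorphism P -> P},
  (forall x, q (s x) = q x) /\ (forall x, q x = 0 -> isq (fun x => q x = 0) (s x)).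
Proof.
have IP := kernel_ideal q.
have [C [pi [pis piI]]] := quotient_ring (isq_ideal (fun x => q x = 0)).
have [|qb qbE] := ring_factor (f := q) pis.
  move=> x /piI h; apply: (h (fun x => q x = 0)); first exact: IP.
  by move=> u v u0 _; rewrite rmorphM u0 mul0r.
pose g : {rmorphism S -> C} := pi \o @mpolyC n S.
have [|||h' [h'f qh' _]] := fe (q := qb) (g := g) (h := idfun).
- by move=> y; have [x <-] := qs y; exists (pi x).
- move=> x y; have [x' <-] := pis x; have [y' <-] := pis y.
  by rewrite !qbE -rmorphM => x0 y0; apply/piI; exact: (isqM (I := fun x => q x = 0)).
- by move=> c; rewrite /= qbE qf.
have [X XP] := choice (fun i => pis (h' (q 'X_i))).
have [s [sC sX]] := mpoly_lift (@mpolyC n S : {rmorphism S -> P}) X.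
have pis_h x : pi (s x) = h' (q x).
  apply: (mpoly_hom_eq (G := pi \o s) (H := h' \o q)) => [c|i] /=.
    by rewrite sC qf h'f.
  by rewrite sX XP.
exists s; split=> x; first by rewrite -qbE pis_h qh'.
by move=> x0; apply/piI; rewrite pis_h x0 rmorph0.
Qed.

Lemma etale_self_map_iter j : exists s : {rmorphism P -> P},
  (forall x, q (s x) = q x) /\ (forall x, q x = 0 -> isqn j (fun x => q x = 0) (s x)).
Proof.
have [s [sq sI]] := etale_self_map.
elim: j => [|j [t [tq tI]]]; first by exists idfun.
exists (s \o t); split=> x /=; first by rewrite sq.
by move=> /tI; exact: isqn_map.
Qed.

End EtaleSelfMap.

Section FrobeniusSplitting.
Variable p : nat.
Hypothesis p_pr : prime p.

Lemma zdvd_frobD (A : comPzRingType) (x y : A) :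
  zdvd p ((x + y) ^+ p - (x ^+ p + y ^+ p)).
Proof.
have := prime_gt1 p_pr; case: p p_pr => // -[//|k] pr _.
rewrite exprDn big_ord_recl big_ord_recr /= subn0 expr0 mulr1 bin0 /bump /= add1n.
rewrite subnn expr0 mul1r binn.
set s := \sum_(_ < _) _; have -> : x ^+ k.+2 *+ 1 + (s + y ^+ k.+2 *+ 1) - (x ^+ k.+2 + y ^+ k.+2) = s.
  by rewrite !mulr1n; ring.
apply: zdvd_sum => i _; rewrite -mulr_natr; apply: zdvdMl; apply: zdvd_nat.
by apply: prime_dvd_bin => //; rewrite /bump /= add1n ltnS /=; exact: ltn_ord.
Qed.

(** A map modulo p that is linear over p-th powers and a left inverse of the
    Frobenius; the congruences replace the passage to S / p. *)
Record frob_split (S : comPzRingType) (tau : S -> S) : Prop := FrobSplit {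
  fsD : forall x y, zdvd p (tau (x + y) - (tau x + tau y));
  fsM : forall x y, zdvd p (tau (x ^+ p * y) - x * tau y);
  fs1 : zdvd p (tau 1 - 1) }.

Section Theory.
Variables (S : comPzRingType) (tau : S -> S).
Hypothesis tauP : frob_split tau.

Lemma fs0 : zdvd p (tau 0).
Proof.
have := fsD tauP 0 0; rewrite addr0 opprD addrA subrr add0r => /zdvdN.
by rewrite opprK.
Qed.

Lemma fsMn n x : zdvd p (tau (x *+ n) - tau x *+ n).
Proof.
elim: n => [|n IH]; first by rewrite !mulr0n subr0; exact: fs0.
rewrite !mulrS; apply: zdvd_chain (fsD tauP _ _) _.
by rewrite opprD addrACA subrr add0r.
Qed.

Lemma fs_cong x y : zdvd p (x - y) -> zdvd p (tau x - tau y).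
Proof.
move=> [z e]; have -> : x = y + z *+ p by rewrite -e addrC subrK.
apply: zdvd_chain (fsD tauP _ _) _; rewrite addrAC subrr add0r.
rewrite -[tau _](subrK (tau z *+ p)); apply: zdvdD; first exact: fsMn.
by exists (tau z).
Qed.

Lemma fs_sum (I : finType) (F : I -> S) :
  zdvd p (tau (\sum_i F i) - \sum_i tau (F i)).
Proof.
elim/big_ind2: _ => [|x x' y y' h h'|i _]; last by rewrite subrr; exact: zdvd0.
  by rewrite subr0; exact: fs0.
apply: zdvd_chain (fsD tauP _ _) _; rewrite opprD addrACA; exact: zdvdD.
Qed.

End Theory.

Lemma zdvd_mpoly (S : comNzRingType) n (x : {mpoly S[n]}) :
  (forall m, zdvd p x@_m) -> zdvd p x.
Proof.
move=> /choice[c cP]; exists (\sum_(m <- msupp x) c m *: 'X_[m]).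
rewrite -sumrMnl {1}[x]mpolyE; apply: eq_bigr => m _.
by rewrite cP scalerMnl.
Qed.

Lemma mcoeffMX0 (S : comNzRingType) n (x : {mpoly S[n]}) m k :
  ~~ (m <= k)%MM -> (x * 'X_[m])@_k = 0.
Proof.
move=> mk; apply: memN_msupp_eq0; rewrite (perm_mem (msuppMX _ _)).
by apply/negP => /mapP[k' _ e]; move: mk; rewrite e lem_addr.
Qed.

Lemma mulmn_inj n : injective (fun m : 'X_{1..n} => (m *+ p)%MM).
Proof.
move=> m1 m2 /mnmP e; apply/mnmP => i; have /eqP := e i.
by rewrite !mulmnE eqn_pmul2r ?prime_gt0 // => /eqP.
Qed.

Lemma mulmn_le n (m k : 'X_{1..n}) : (m *+ p <= k *+ p)%MM = (m <= k)%MM.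
Proof.
by apply/mnm_lepP/mnm_lepP => h i; have := h i; rewrite !mulmnE leq_pmul2r ?prime_gt0.
Qed.

(** Apply tau to the coefficients of the monomials whose exponents are divisible
    by p, divide these exponents by p, and drop the other monomials. *)
Lemma frob_split_mpoly (S : comNzRingType) (tau : S -> S) n :
  frob_split tau -> exists tau' : {mpoly S[n]} -> {mpoly S[n]}, frob_split tau'.
Proof.
move=> tauP.
have ex (x : {mpoly S[n]}) : exists y : {mpoly S[n]},
    forall k, zdvd p (y@_k - tau x@_(k *+ p)%MM).
  elim/mpolyind: x => [|c m x _ _ [y yP]].
    by exists 0 => k; rewrite !mcoeff0 sub0r; apply: zdvdN; exact: fs0.
  have [[k0 ->]|no] := pselect (exists k0, m = (k0 *+ p)%MM).
    exists (tau c *: 'X_[k0] + y) => k; apply: zdvd_sym.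
    rewrite !mcoeffD; apply: zdvd_chain (fsD tauP _ _) _; rewrite opprD addrACA.
    apply: zdvdD; last exact: zdvd_sym.
    rewrite !mcoeffZ !mcoeffX (inj_eq (@mulmn_inj n)).
    case: eqP => _; first by rewrite !mulr1 subrr; exact: zdvd0.
    by rewrite !mulr0 subr0; exact: fs0.
  exists y => k; rewrite mcoeffD mcoeffZ mcoeffX; case: eqP => [e|_].
    by exfalso; apply: no; exists k.
  by rewrite mulr0 add0r.
have [t tP] := choice ex.
exists t; split.
- move=> x y; apply: zdvd_mpoly => k; rewrite mcoeffB mcoeffD.
  apply: zdvd_chain (tP _ _) _; rewrite mcoeffD; apply: zdvd_chain (fsD tauP _ _) _.
  by rewrite opprD addrACA; apply: zdvdD; exact: zdvd_sym.
- have tD x y : zdvd p (t (x + y) - (t x + t y)).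
    apply: zdvd_mpoly => k; rewrite mcoeffB mcoeffD.
    apply: zdvd_chain (tP _ _) _; rewrite mcoeffD; apply: zdvd_chain (fsD tauP _ _) _.
    by rewrite opprD addrACA; apply: zdvdD; exact: zdvd_sym.
  have tc x y : zdvd p (x - y) -> zdvd p (t x - t y).
    move=> [z e]; apply: zdvd_mpoly => k; rewrite mcoeffB.
    apply: zdvd_chain (tP _ _) _; apply: zdvd_chain (zdvd_sym (tP _ _)).
    by apply: fs_cong => //; rewrite -mcoeffB e mcoeffMn; exists z@_(k *+ p)%MM.
  elim/mpolyind => [|c m x _ _ IH] y.
    rewrite expr0n (gtn_eqF (prime_gt0 p_pr)) !mul0r subr0.
    apply: zdvd_mpoly => k; rewrite -[_@_k](subrK (tau 0)); apply: zdvdD; last exact: fs0.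
    by have := tP 0 k; rewrite mcoeff0.
  apply: (@zdvd_chain _ _ (t ((c *: 'X_[m]) ^+ p * y + x ^+ p * y))).
    by apply: tc; rewrite -mulrDl -mulrBl; apply: zdvdMr; exact: zdvd_frobD.
  apply: zdvd_chain (tD _ _) _; rewrite mulrDl opprD addrACA.
  apply: zdvdD; last exact: IH.
  apply: zdvd_mpoly => k; rewrite mcoeffB; apply: zdvd_chain (tP _ _) _.
  have -> : (c *: 'X_[m]) ^+ p * y = c ^+ p *: (y * 'X_[(m *+ p)%MM]).
    by rewrite exprZn mpolyXn -scalerAl mulrC.
  rewrite -scalerAl [_ * t y]mulrC !mcoeffZ.
  have [mk|mk] := boolP (m <= k)%MM; last first.
    rewrite !mcoeffMX0 ?mulmn_le // !mulr0 subr0; exact: fs0.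
  have e : ((k - m) *+ p)%MM = (k *+ p - m *+ p)%MM.
    by apply/mnmP => i; rewrite !(mulmnE, mnmBE) mulnBl.
  rewrite -(submK mk) -{2}(addmC m) mcoeffMX.
  have -> : ((k - m + m) *+ p = m *+ p + (k - m) *+ p)%MM.
    by apply/mnmP => i; rewrite !(mulmnE, mnmDE) mulnDl addnC.
  rewrite mcoeffMX; apply: zdvd_chain (fsM tauP _ _) _.
  by rewrite -mulrBr; apply: zdvdMl; exact: zdvd_sym.
- apply: zdvd_mpoly => k; rewrite mcoeffB; apply: zdvd_chain (tP _ _) _.
  rewrite !mcoeff1; have -> : (k *+ p == 0)%MM = (k == 0)%MM.
    apply/eqP/eqP => [e|->]; apply/mnmP => i; last by rewrite mulmnE mnm0E.
    have := congr1 (fun m : 'X_{1..n} => m i) e; rewrite mulmnE !mnm0E => /eqP.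
    by rewrite muln_eq0 (gtn_eqF (prime_gt0 p_pr)) orbF => /eqP.
  case: eqP => _; first exact: (fs1 tauP).
  by rewrite subr0; exact: fs0.
Qed.

End FrobeniusSplitting.

Section EtaleReduced.
Variables (p : nat) (S : comNzRingType) (R : comPzRingType) (f : {rmorphism S -> R}).
Hypothesis p_pr : prime p.
Hypothesis fe : formally_etale f.
Hypothesis ff : finitely_presented f.
Variable tau : S -> S.
Hypothesis tauP : frob_split p tau.

(** Lift x and (x^p) / p to X and Y in a presentation P / I.  A map s as in
    [etale_self_map_iter], with enough iterations, sends X^p - p Y into
    p-th powers of the generators of I modulo p; the splitting of P / p then
    puts s X into I modulo p, and s X is another lift of x. *)
Lemma etale_reduced (x : R) : zdvd p (x ^+ p) -> zdvd p x.
Proof.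
have [n [q [m [r [qf qs qI]]]]] := ff; move=> [y xy].
have [t tP] := frob_split_mpoly p_pr n tauP.
(* 2 ^ (m p) exceeds m p, the exponent that the pigeonhole argument needs. *)
have [s [sq sI]] := etale_self_map_iter fe qf qs (m * p).
have [X Xx] := qs x; have [Y Yy] := qs y.
pose K (z : {mpoly S[n]}) := exists (a : 'I_m -> {mpoly S[n]}) w,
  z = \sum_i a i * r i ^+ p + w *+ p.
have KP : is_ideal K.
  split.
  - by exists (fun=> 0), 0; rewrite mul0rn addr0 big1 // => i _; rewrite mul0r.
  - move=> _ _ [a [w ->]] [b [v ->]]; exists (fun i => a i + b i), (w + v).
    under [in RHS]eq_bigr do rewrite mulrDl.
    by rewrite big_split /= mulrnDl addrACA.
  - move=> c _ [a [w ->]]; exists (fun i => c * a i), (c * w).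
    rewrite mulrDr mulrnAr mulr_sumr; congr (_ + _).
    by apply: eq_bigr => i _; rewrite mulrA.
have [a [w e]] : K (s (X ^+ p - Y *+ p)).
  apply: (@gpow_pigeon _ m r K p (2 ^ (m * p))%N KP).
  - exact: ltn_expl.
  - move=> i; exists (fun j => (j == i)%:R), 0; rewrite mul0rn addr0 (bigD1 i) //= eqxx.
    by rewrite mul1r big1 ?addr0 // => j /negPf ->; rewrite mul0r.
  - apply: (isqn_gpow (I := fun x => q x = 0)) => [z /qI[c ->]|]; first by exists c.
    by apply: sI; rewrite rmorphB rmorphXn rmorphMn Xx Yy -xy subrr.
have h : zdvd p (s X - \sum_i r i * t (a i)).
  have h1 : zdvd p (s X - t (s X ^+ p)).
    apply: zdvd_sym; rewrite -[s X ^+ p]mulr1; apply: zdvd_chain (fsM tP _ _) _.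
    by rewrite -[X in _ - X]mulr1 -mulrBr; apply: zdvdMl; exact: (fs1 tP).
  apply: zdvd_chain h1 _.
  apply: (@zdvd_chain _ _ (t (\sum_i r i ^+ p * a i))).
    apply: (fs_cong tP); exists (w + s Y).
    have -> : s X ^+ p = s (X ^+ p - Y *+ p) + s Y *+ p.
      by rewrite rmorphB rmorphXn rmorphMn subrK.
    rewrite e mulrnDl; under [X in _ - X]eq_bigr do rewrite mulrC.
    by rewrite addrC addrA addrC; ring.
  apply: zdvd_chain (fs_sum tP _) _; rewrite -sumrB.
  by apply: zdvd_sum => i _; exact: (fsM tP).
rewrite -Xx -sq; have := zdvd_additive (rmorphD q) h.
rewrite rmorphB rmorph_sum big1 ?subr0 // => i _.
have -> : q (r i * t (a i)) = q (r i) * q (t (a i)) by rewrite rmorphM.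
suff -> : q (r i) = 0 by rewrite mul0r.
apply/qI; exists (fun j => (j == i)%:R); rewrite (bigD1 i) //= eqxx mul1r big1 ?addr0 //.
by move=> j /negPf ->; rewrite mul0r.
Qed.

End EtaleReduced.

(** * Frobenius lifts modulo p^n on the Witt ring *)

Section Congruences.
Variable p : nat.
Hypothesis p_pr : prime p.

Lemma zdvd_pow_cong (A : comPzRingType) n (a b : A) m :
  zdvd m (a - b) -> zdvd m (a ^+ n - b ^+ n).
Proof. by rewrite subrXX => h; apply: zdvdMr. Qed.

(** The quotient (a^p - b^p) / (a - b) is congruent to p b^(p-1). *)
Lemma zdvd_pow_step (A : comPzRingType) m (a b : A) :
  zdvd (p ^ m.+1) (a - b) -> zdvd (p ^ m.+2) (a ^+ p - b ^+ p).
Proof.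
move=> ab; rewrite subrXX expnSr; apply: zdvdM => //.
have ab1 : zdvd p (a - b) by rewrite -[p]expn1; apply: zdvd_exp ab.
have -> : \sum_(i < p) a ^+ (p.-1 - i) * b ^+ i =
   \sum_(i < p) (a ^+ (p.-1 - i) - b ^+ (p.-1 - i)) * b ^+ i + (b ^+ p.-1) *+ p.
  rewrite -[X in _ *+ X]card_ord -sumr_const -big_split /=; apply: eq_bigr => i _.
  rewrite mulrBl -exprD subnK ?subrK //.
  by have := ltn_ord i; lia.
apply: zdvdD; last by exists (b ^+ p.-1).
by apply: zdvd_sum => i _; apply: zdvdMr; exact: zdvd_pow_cong.
Qed.

Lemma zdvd_pow_pexp (A : comPzRingType) m (a b : A) :
  zdvd p (a - b) -> zdvd (p ^ m.+1) (a ^+ (p ^ m) - b ^+ (p ^ m)).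
Proof.
move=> ab; elim: m => [|m IH]; first by rewrite !expr1.
by rewrite (expnSr p m) !exprM; exact: zdvd_pow_step.
Qed.

End Congruences.

Section ApproxFrobenius.
Variables (p : nat) (k : fieldType) (W : comNzRingType) (red : {rmorphism W -> k}).
Hypothesis p_pr : prime p.
Hypothesis kp : perfect_field p k.
Hypothesis Wk : is_witt_ring p red.

Let W_tf (x : W) : x *+ p = 0 -> x = 0. Proof. by case: Wk => _ h _ _; exact: h. Qed.
Let redP (x : W) : red x = 0 <-> zdvd p x. Proof. by case: Wk. Qed.

Lemma witt_reduced m (x y : W) :
  zdvd p (x ^+ (p ^ m) - y ^+ (p ^ m)) -> zdvd p (x - y).
Proof.
elim: m => [|m IH]; first by rewrite !expr1.
rewrite expnSr !exprM => /redP h; apply: IH; apply/redP.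
move: h; rewrite !rmorphB !rmorphXn.
set a := red x ^+ _; set b := red y ^+ _ => h.
have [pk _] := kp; have := pFrobenius_autB_comm pk (mulrC a b).
rewrite !pFrobenius_autE h => /eqP; rewrite expf_eq0 => /andP[_ /eqP].
by [].
Qed.

(** k is perfect, so the residue of w has a root of order p^m. *)
Lemma witt_decomp m (w : W) : exists x y, w = x ^+ (p ^ m) + y *+ p.
Proof.
have [pk kr] := kp; have [_ _ rs _] := Wk.
have [c cw] : exists c, c ^+ (p ^ m) = red w.
  elim: m => [|m [c cE]]; first by exists (red w); rewrite expr1.
  by have [d dc] := kr c; exists d; rewrite expnS exprM dc.
have [x xc] := rs c.
have /redP[y e] : red (w - x ^+ (p ^ m)) = 0 by rewrite rmorphB rmorphXn xc cw subrr.
by exists x, y; rewrite -e addrC subrK.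
Qed.

(** On x^(p^n) the maps agree modulo p^(n+1), on p y by induction, and every w is
    of the form x^(p^n) + p y. *)
Lemma witt_hom_eq (A : comPzRingType) (g1 g2 : {rmorphism W -> A}) :
  padic_sep A p -> (forall x, zdvd p (g1 x - g2 x)) -> g1 =1 g2.
Proof.
move=> As gp w; apply/eqP; rewrite -subr_eq0; apply/eqP/As => n.
elim: n w => [|n IH] w; first exact: zdvd1.
have [x [y ->]] := witt_decomp n w.
rewrite !rmorphD !rmorphXn !rmorphMn opprD addrACA -mulrnBl; apply: zdvdD.
  exact: zdvd_pow_pexp.
by rewrite expnSr; apply: zdvd_mulrn2.
Qed.

Record hom_mod (N : nat) (g : W -> W) : Prop := HomMod {
  hmD : forall x y, zdvd N (g (x + y) - (g x + g y));
  hmM : forall x y, zdvd N (g (x * y) - g x * g y);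
  hm1 : zdvd N (g 1 - 1) }.

Section HomModTheory.
Variables (N : nat) (g : W -> W).
Hypothesis gP : hom_mod N g.

Lemma hm0 : zdvd N (g 0).
Proof.
have := hmD gP 0 0; rewrite addr0 opprD addrA subrr add0r => /zdvdN.
by rewrite opprK.
Qed.

Lemma hmMn n x : zdvd N (g (x *+ n) - g x *+ n).
Proof.
elim: n => [|n IH]; first by rewrite !mulr0n subr0; exact: hm0.
rewrite !mulrS; apply: zdvd_chain (hmD gP _ _) _.
by rewrite opprD addrACA subrr add0r.
Qed.

Lemma hmX n x : zdvd N (g (x ^+ n) - g x ^+ n).
Proof.
elim: n => [|n IH]; first by rewrite !expr0; exact: hm1.
rewrite !exprS; apply: zdvd_chain (hmM gP _ _) _.
by rewrite -mulrBr; exact: zdvdMl.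
Qed.

Lemma hm_sum (I : finType) (F : I -> W) :
  zdvd N (g (\sum_i F i) - \sum_i g (F i)).
Proof.
elim/big_ind2: _ => [|x x' y y' h h'|i _]; last by rewrite subrr; exact: zdvd0.
  by rewrite subr0; exact: hm0.
apply: zdvd_chain (hmD gP _ _) _; rewrite opprD addrACA; exact: zdvdD.
Qed.

End HomModTheory.

(** The polynomial (a^q + b^q - (a + b)^q) / p, for q a power of p, which is the
    carry in the addition of Witt vectors. *)
Definition carry (A : comPzRingType) (q : nat) (a b : A) : A :=
  - \sum_(i < q.-1) a ^+ (q - i.+1) * b ^+ i.+1 *+ ('C(q, i.+1) %/ p).

Lemma dvd_bin_pexp m i : (0 < i < p ^ m)%N -> (p %| 'C(p ^ m, i))%N.
Proof.
move=> /andP[i0 im]; case: i i0 im => // i _ im.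
have e := mul_bin_diag (p ^ m) i.
have pd : (p ^ m %| i.+1 * 'C(p ^ m, i.+1))%N by rewrite -e dvdn_mulr.
apply/negPn/negP => np; move: pd; rewrite Gauss_dvdl; last first.
  by apply: coprimeXl; rewrite prime_coprime.
by move=> h; have := dvdn_leq (ltn0Sn i) h; rewrite leqNgt im.
Qed.

Lemma carryE (A : comPzRingType) m (a b : A) :
  a ^+ (p ^ m) + b ^+ (p ^ m) = (a + b) ^+ (p ^ m) + carry (p ^ m) a b *+ p.
Proof.
have q0 : (0 < p ^ m)%N by rewrite expn_gt0 prime_gt0.
move: (p ^ m)%N q0 (@dvd_bin_pexp m) => [//|[|q]] _ dv.
  by rewrite /carry big_ord0 oppr0 mul0rn addr0 !expr1.
rewrite exprDn big_ord_recl big_ord_recr /= subn0 expr0 mulr1 bin0 /bump /= add1n.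
rewrite subnn expr0 mul1r binn /carry /= mulNrn -sumrMnl.
rewrite (_ : \sum_(i < q.+1) _ *+ _ *+ p = \sum_(i < q.+1)
  a ^+ (q.+2 - bump 0 i) * b ^+ bump 0 i *+ 'C(q.+2, bump 0 i)); last first.
  apply: eq_bigr => i _; rewrite -[bump 0 i]/(i.+1) -mulrnA divnK //.
  by apply: dv; have := ltn_ord i; lia.
by rewrite !mulr1n; ring.
Qed.

Lemma hm_carry N g q a b : hom_mod N g ->
  zdvd N (g (carry q a b) - carry q (g a) (g b)).
Proof.
move=> gP; rewrite /carry.
have gN x : zdvd N (g (- x) - - g x).
  have := hmD gP x (- x); rewrite subrr => h; have := zdvdB (hm0 gP) h.
  by rewrite opprB addrC subrK opprK addrC.
apply: zdvd_chain (gN _) _; rewrite -opprD; apply: zdvdN.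
apply: zdvd_chain (hm_sum gP _) _; rewrite -sumrB; apply: zdvd_sum => i _.
apply: zdvd_chain (hmMn gP _ _) _; rewrite -mulrnBl; apply: zdvd_mulrn.
apply: zdvd_chain (hmM gP _ _) _.
apply: (@zdvd_chain _ _ (g a ^+ (q - i.+1) * g (b ^+ i.+1))).
  by rewrite -mulrBl; apply: zdvdMr; exact: hmX.
by rewrite -mulrBr; apply: zdvdMl; exact: hmX.
Qed.

(** By induction on n: with q = p^(n+1), put g'(x^q + p y) = g(x)^q + p g(y).
    This is independent of the decomposition modulo p^(n+2), because g is
    determined modulo p^(n+1) and q-th powers gain n + 1 factors p; sums and
    products are computed with carries, which g preserves. *)
Lemma approx_frobenius n : exists g : W -> W,
  hom_mod (p ^ n.+1) g /\ forall x, zdvd p (g x - x ^+ p).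
Proof.
elim: n => [|n [g [gP gp]]].
  exists (fun x => x ^+ p); split; last by move=> x; rewrite subrr; exact: zdvd0.
  rewrite expn1; split=> [x y|x y|].
  - exact: zdvd_frobD.
  - by rewrite exprMn subrr; exact: zdvd0.
  - by rewrite expr1n subrr; exact: zdvd0.
have [X XP] := choice (witt_decomp n.+1); have [Y YP] := choice XP.
pose N := (p ^ n.+1)%N.
have gx x x' : zdvd p (x - x') -> zdvd p (g x - g x').
  move=> h; apply: zdvd_chain (gp x) _; apply: zdvd_chain (zdvd_sym (gp x')).
  exact: zdvd_pow_cong.
pose g' w := g (X w) ^+ N + g (Y w) *+ p.
have key w x y : w = x ^+ N + y *+ p ->
    zdvd (p ^ n.+2) (g' w - (g x ^+ N + g y *+ p)).
  move=> e.
  have e' : X w ^+ N + Y w *+ p = x ^+ N + y *+ p by rewrite -YP.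
  have xx : zdvd p (X w - x).
    apply: (@witt_reduced n.+1); exists (y - Y w); rewrite mulrnBl.
    by apply/eqP; rewrite subr_eq addrAC [y *+ p + _]addrC -e' addrK.
  have [z zE] := zdvd_pow_pexp p_pr n.+1 xx.
  have yy : y = Y w + z *+ N.
    apply/eqP; rewrite -subr_eq0; apply/eqP/W_tf.
    rewrite mulrnBl mulrnDl -!mulrnA -expnSr -zE.
    have -> : y *+ p = X w ^+ N + Y w *+ p - x ^+ N by rewrite e' addrAC subrr add0r.
    by ring.
  rewrite opprD addrACA; apply: zdvdD.
    by apply: zdvd_pow_pexp => //; exact: gx.
  rewrite -mulrnBl expnSr; apply: zdvd_mulrn2; apply: zdvd_sym.
  rewrite yy; apply: zdvd_chain (hmD gP _ _) _; rewrite addrAC subrr add0r.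
  rewrite -[g _](subrK (g z *+ N)); apply: zdvdD; first exact: hmMn.
  by exists (g z).
exists g'; split; last first.
  move=> w; apply: (@zdvd_chain _ _ (g (X w) ^+ N)).
    by rewrite /g' addrAC subrr add0r; exists (g (Y w)).
  apply: (@zdvd_chain _ _ ((X w ^+ p) ^+ N)).
    exact: zdvd_pow_cong.
  rewrite exprAC; apply: zdvd_pow_cong; rewrite {2}(YP w) opprD addrA subrr add0r.
  by apply: zdvdN; exists (Y w).
have big_dvd (u v : W) : zdvd N (u - v) -> zdvd (p ^ n.+2) (u *+ p - v *+ p).
  by move=> h; rewrite -mulrnBl expnSr; exact: zdvd_mulrn2.
have small_dvd (u v : W) : zdvd N (u - v) -> zdvd p (u - v).
  by move=> h; rewrite -[p]expn1; apply: zdvd_exp h.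
split.
- move=> w1 w2; have {1}-> : w1 + w2 = (X w1 + X w2) ^+ N +
      (Y w1 + Y w2 + carry N (X w1) (X w2)) *+ p.
    rewrite {1}(YP w1) {1}(YP w2) addrACA carryE !mulrnDl; ring.
  apply: zdvd_chain (key _ _ _ erefl) _; rewrite /g'.
  have -> : g (X w1) ^+ N + g (Y w1) *+ p + (g (X w2) ^+ N + g (Y w2) *+ p) =
    (g (X w1) + g (X w2)) ^+ N +
      (g (Y w1) + g (Y w2) + carry N (g (X w1)) (g (X w2))) *+ p.
    by rewrite addrACA carryE !mulrnDl; ring.
  rewrite opprD addrACA; apply: zdvdD.
    by apply: zdvd_pow_pexp => //; apply: small_dvd; exact: (hmD gP).
  apply: big_dvd; apply: zdvd_chain (hmD gP _ _) _; rewrite opprD addrACA.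
  by apply: zdvdD; [exact: (hmD gP)|exact: hm_carry].
- move=> w1 w2; have {1}-> : w1 * w2 = (X w1 * X w2) ^+ N +
      (X w1 ^+ N * Y w2 + Y w1 * X w2 ^+ N + Y w1 * Y w2 *+ p) *+ p.
    by rewrite {1}(YP w1) {1}(YP w2) exprMn; ring.
  apply: zdvd_chain (key _ _ _ erefl) _; rewrite /g'.
  have -> : (g (X w1) ^+ N + g (Y w1) *+ p) * (g (X w2) ^+ N + g (Y w2) *+ p) =
    (g (X w1) * g (X w2)) ^+ N + (g (X w1) ^+ N * g (Y w2) +
       g (Y w1) * g (X w2) ^+ N + g (Y w1) * g (Y w2) *+ p) *+ p.
    by rewrite exprMn; ring.
  rewrite opprD addrACA; apply: zdvdD.
    by apply: zdvd_pow_pexp => //; apply: small_dvd; exact: (hmM gP).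
  apply: big_dvd; apply: zdvd_chain (hmD gP _ _) _; rewrite opprD addrACA.
  have hXY u v : zdvd N (g (u ^+ N * v) - g u ^+ N * g v).
    apply: zdvd_chain (hmM gP _ _) _; rewrite -mulrBl; apply: zdvdMr; exact: hmX.
  apply: zdvdD.
    apply: zdvd_chain (hmD gP _ _) _; rewrite opprD addrACA; apply: zdvdD => //.
    by rewrite mulrC [g _ * _]mulrC; exact: hXY.
  apply: zdvd_chain (hmMn gP _ _) _; rewrite -mulrnBl; apply: zdvd_mulrn.
  exact: (hmM gP).
- apply: zdvd_chain (key 1 1 0 _) _; first by rewrite expr1n mul0rn addr0.
  rewrite addrAC; apply: zdvdD.
    rewrite -[X in _ - X](expr1n _ N); apply: zdvd_pow_pexp => //.
    by apply: small_dvd; exact: (hm1 gP).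
  by rewrite expnSr; apply: zdvd_mulrn2; exact: hm0.
Qed.

(** The Frobenius of the perfect field k is bijective: its inverse is a
    splitting. *)
Lemma witt_frob_split : exists tau : W -> W, frob_split p tau.
Proof.
have [pk _] := kp.
have ex (w : W) : exists x, zdvd p (w - x ^+ p).
  have [x [y e]] := witt_decomp 1 w; exists x; exists y.
  by rewrite e expn1 addrAC subrr add0r.
have [t tP] := choice ex; exists t.
have inj (x y : W) : zdvd p (x ^+ p - y ^+ p) -> zdvd p (x - y).
  by move=> h; apply: (@witt_reduced 1); rewrite expn1.
split=> [x y|x y|]; apply: inj.
- apply: zdvd_chain (zdvd_sym (tP _)) _.
  apply: zdvd_chain _ (zdvd_sym (zdvd_frobD p_pr _ _)).
  by rewrite opprD addrACA; apply: zdvdD.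
- apply: zdvd_chain (zdvd_sym (tP _)) _.
  by rewrite exprMn -mulrBr; apply: zdvdMl.
- by rewrite expr1n; apply: zdvd_sym.
Qed.

End ApproxFrobenius.

(** * Flatness of étale algebras over p *)

Lemma mpoly_tf (S : comNzRingType) n N (x : {mpoly S[n]}) :
  (forall c : S, c *+ N = 0 -> c = 0) -> x *+ N = 0 -> x = 0.
Proof.
move=> Stf x0; apply/mpolyP => m; rewrite mcoeff0; apply: Stf.
by rewrite -mcoeffMn x0 mcoeff0.
Qed.

Lemma pairMn (A B : zmodType) (z : A * B) i : z *+ i = (z.1 *+ i, z.2 *+ i).
Proof. by elim: i => // i IH; rewrite !mulrS IH. Qed.

Section EtaleFlat.
Variables (p : nat) (k : fieldType) (W : comNzRingType) (red : {rmorphism W -> k}).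
Variables (d : nat) (R : comPzRingType) (f : {rmorphism {mpoly W[d]} -> R}).
Hypothesis p_pr : prime p.
Hypothesis kp : perfect_field p k.
Hypothesis Wk : is_witt_ring p red.
Hypothesis fe : etale f.

Lemma etale_mod_p_reduced (x : R) : zdvd p (x ^+ p) -> zdvd p x.
Proof.
have [tau tauP] := witt_frob_split p_pr kp Wk.
have [tau' tauP'] := frob_split_mpoly p_pr d tauP.
have [fe1 fe2] := fe; exact: (etale_reduced p_pr fe1 fe2 tauP').
Qed.

Let p_gt0 : (0 < p)%N. Proof. exact: prime_gt0. Qed.

Section Level.
Variables (P : comPzRingType) (q : {rmorphism P -> R}).
Variable cc : {rmorphism {mpoly W[d]} -> P}.
Hypothesis qf : forall c, q (cc c) = f c.
Hypothesis qs : forall y, exists x, q x = y.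
Variable n : nat.

(** Ghost components (w_0, w_1) of Witt vectors of length two.  For P without
    p-torsion, this subring of P * P is the ring of these vectors. *)
Definition ghost_pair (x : P * P) : Prop := zdvd p (x.2 - x.1 ^+ p).

Lemma ghost_pair_subring : is_subring ghost_pair.
Proof.
split; first by rewrite /ghost_pair /= expr1n subrr; exact: zdvd0.
  move=> [x y] [x' y']; rewrite /ghost_pair /= => h h'.
  have := zdvd_frobD p_pr (x - x') x'; rewrite subrK => h2.
  have -> : y - y' - (x - x') ^+ p = (y - x ^+ p) - (y' - x' ^+ p) +
    (x ^+ p - ((x - x') ^+ p + x' ^+ p)) by ring.
  by apply: zdvdD => //; exact: zdvdB.
move=> [x y] [x' y']; rewrite /ghost_pair /= => h h'.
have -> : y * y' - (x * x') ^+ p = (y - x ^+ p) * y' + x ^+ p * (y' - x' ^+ p).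
  by rewrite exprMn; ring.
by apply: zdvdD; [exact: zdvdMr|exact: zdvdMl].
Qed.

Definition ker_mod (x : P) : Prop := zdvd (p ^ n) (q x).

Lemma ker_mod_ideal : is_ideal ker_mod.
Proof.
split; rewrite /ker_mod; first by rewrite rmorph0; exact: zdvd0.
  by move=> x y; rewrite rmorphD; exact: zdvdD.
by move=> a x; rewrite rmorphM; exact: zdvdMl.
Qed.

Lemma ker_mod_pn x : ker_mod (x *+ p ^ n).
Proof. by rewrite /ker_mod rmorphMn; exists (q x). Qed.

Lemma ker_mod_carry x y : ker_mod x -> ker_mod y -> ker_mod (carry p p x y).
Proof.
move=> hx hy; have JP := ker_mod_ideal; rewrite /carry.
apply: (idealN JP); apply: (ideal_sum JP) => i _; apply: (idealMn JP).
by apply: (idealMl JP); rewrite exprS; apply: (idealMr JP).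
Qed.

(** Ghost components of the vectors with entries in the kernel of P -> R / p^n:
    the quotient is the ring of Witt vectors of length two of R / p^n. *)
Definition ghost_ker (x : P * P) : Prop :=
  ker_mod x.1 /\ exists z, ker_mod z /\ x.2 = x.1 ^+ p + z *+ p.

(** The carry of two elements of an ideal lies in the ideal. *)
Lemma ghost_kerD x y : ghost_ker x -> ghost_ker y -> ghost_ker (x + y).
Proof.
have JP := ker_mod_ideal.
case: x y => [x1 x2] [y1 y2] [/= hx [z [hz ->]]] [/= hy [t [ht ->]]].
split=> /=; first exact: (idealD JP).
exists (z + t + carry p p x1 y1); split.
  by apply: (idealD JP); [exact: (idealD JP)|exact: ker_mod_carry].
have := carryE p_pr 1 x1 y1; rewrite expn1 => e.
by rewrite addrACA e !mulrnDl; ring.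
Qed.

Lemma ghost_kerM x y : ghost_pair x -> ghost_ker y -> ghost_ker (x * y).
Proof.
have JP := ker_mod_ideal.
case: x y => [x1 x2] [y1 y2]; rewrite /ghost_pair /= => -[c e] [/= hy [z [hz ->]]].
split=> /=; first exact: (idealMl JP).
exists (c * y1 ^+ p + x1 ^+ p * z + (c * z) *+ p); split.
  apply: (idealD JP); last by apply: (idealMn JP); exact: (idealMl JP).
  apply: (idealD JP); apply: (idealMl JP) => //.
  by rewrite -(prednK p_gt0) exprS; exact: (idealMr JP).
have -> : x2 = x1 ^+ p + c *+ p by rewrite -e addrC subrK.
by rewrite exprMn; ring.
Qed.

Lemma ghost_quotient : exists (G C : comPzRingType) (j : {rmorphism G -> P * P})
    (pi : {rmorphism G -> C}),
  [/\ forall x, ghost_pair x <-> exists y, j y = x,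
      forall y, exists x, pi x = y & forall x, pi x = 0 <-> ghost_ker (j x)].
Proof.
have [G [j [jinj jP]]] := subring_exists ghost_pair_subring.
have [|C [pi [pis piK]]] := @quotient_ring G (fun x => ghost_ker (j x)).
  split.
  - rewrite rmorph0; split; first exact: (ideal0 ker_mod_ideal).
    exists 0; split; first exact: (ideal0 ker_mod_ideal).
    by rewrite /= expr0n (gtn_eqF p_gt0) mul0rn addr0.
  - by move=> x y; rewrite rmorphD; exact: ghost_kerD.
  - by move=> a x; rewrite rmorphM; apply: ghost_kerM; apply/jP; exists a.
by exists G, C, j, pi; split.
Qed.

(** The projection from Witt vectors of length two of R / p^n onto R / p^n has a
    kernel J with J^2 <= p J and p^n J = 0, so the map R -> R / p^n lifts to it,
    once it is lifted on the coordinate ring W[T].  On W this takes a Frobenius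
    lift modulo p^(n+1), on T_i the Teichmüller vector (T_i, T_i^p). *)
Lemma ghost_section : exists (G C : comPzRingType) (j : {rmorphism G -> P * P})
    (pi : {rmorphism G -> C}) (h : {rmorphism R -> C}),
  [/\ forall x, ghost_pair (j x),
      forall y, exists x, pi x = y, forall x, pi x = 0 <-> ghost_ker (j x)
    & forall x y, pi x = h y -> zdvd (p ^ n) (q (j x).1 - y)].
Proof.
have JP := ker_mod_ideal.
have [G [C [j [pi [jP pis piK]]]]] := ghost_quotient.
have idl : is_ideal (fun x : R => zdvd (p ^ n) x).
  by split; [exact: zdvd0|exact: zdvdD|move=> a y; exact: zdvdMl].
have [Q [piR [pRs pRK]]] := quotient_ring idl.
have [|||q0 q0E] := @rmorph_pack G Q (fun x => piR (q (j x).1)).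
- by move=> x y; rewrite rmorphD /= !rmorphD.
- by move=> x y; rewrite rmorphM /= !rmorphM.
- by rewrite !rmorph1.
have [|qb qbE] := ring_factor (f := q0) pis.
  by move=> x /piK[h _]; rewrite q0E; apply/pRK.
(* the Verschiebung of c, which parametrizes the kernel *)
have /choice[e eP] : forall c, exists g : G, j g = (0, c *+ p).
  move=> c; apply/jP.
  rewrite /ghost_pair /= expr0n (gtn_eqF p_gt0) subr0; by exists c.
have pie x : q0 x = 0 -> exists c, pi x = pi (e c).
  rewrite q0E => /pRK hx; have [c cE] : ghost_pair (j x) by apply/jP; exists x.
  exists c; apply/eqP; rewrite -subr_eq0 -rmorphB; apply/eqP/piK.
  rewrite rmorphB eP; split=> /=; first by rewrite subr0.
  exists 0; split; first exact: (ideal0 JP).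
  by rewrite -cE subr0 mul0rn addr0 opprB addrC subrK.
have qe c : qb (pi (e c)) = 0 by rewrite qbE q0E eP /= !rmorph0.
have [g [gP gp]] := approx_frobenius p_pr kp Wk n.
have /choice[u uP] : forall w, exists x : G, j x = (cc w%:MP, cc (g w)%:MP).
  move=> w; apply/jP; rewrite /ghost_pair /= -!rmorphXn -!rmorphB.
  by have [y ->] := gp w; exists (cc y%:MP); rewrite !rmorphMn.
(* a homomorphism modulo p^(n+1) becomes one into the quotient *)
have Kz (z : G) (y : W) : zdvd (p ^ n.+1) y -> (j z).1 = 0 -> (j z).2 = cc y%:MP ->
    pi z = 0.
  move=> [t ->] j1 j2; apply/piK; split; rewrite j1; first exact: (ideal0 JP).
  exists (cc t%:MP *+ p ^ n); split; first exact: ker_mod_pn.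
  by rewrite j2 expr0n (gtn_eqF p_gt0) add0r !rmorphMn -mulrnA -expnSr.
have [|||gW gWE] := @rmorph_pack W C (fun w => pi (u w)).
- move=> x y; apply/eqP; rewrite -rmorphD -subr_eq0 -rmorphB; apply/eqP.
  apply: Kz (hmD gP x y) _ _; rewrite !rmorphB !rmorphD /= !uP /=.
    by rewrite !rmorphD subrr.
  by [].
- move=> x y; apply/eqP; rewrite -rmorphM -subr_eq0 -rmorphB; apply/eqP.
  apply: Kz (hmM gP x y) _ _; rewrite rmorphB rmorphM /= !uP /=.
    by rewrite !rmorphM subrr.
  by rewrite ?rmorphB ?rmorphM.
- apply/eqP; rewrite -(rmorph1 pi) -subr_eq0 -rmorphB; apply/eqP.
  apply: Kz (hm1 gP) _ _; rewrite rmorphB rmorph1 /= uP /=.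
    by rewrite !rmorph1 subrr.
  by rewrite ?rmorphB ?rmorph1.
have /choice[v vP] : forall i, exists x : G, j x = (cc 'X_i, cc ('X_i ^+ p)).
  move=> i; apply/jP; rewrite /ghost_pair /= -rmorphXn subrr; exact: zdvd0.
have [gS [gSC gSX]] := mpoly_lift gW (fun i => pi (v i)).
have [|||s|h [_ qh _]] :=
    etale_lift_nilp (p := p) (n := n) (proj1 fe) (q := qb) (g := gS) (h := piR).
- by move=> y; have [x <-] := pRs y; have [x' <-] := qs x;
     have [z zE] : exists z, j z = (x', x' ^+ p);
     [apply/jP; rewrite /ghost_pair /= subrr; exact: zdvd0
     |exists (pi z); rewrite qbE q0E zE].
- move=> x y; have [x' <-] := pis x; have [y' <-] := pis y.
  rewrite !qbE => /pie[a ->] /pie[b ->]; exists (pi (e (a * b))); split=> //.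
  rewrite -rmorphM -rmorphMn; apply/eqP; rewrite -subr_eq0 -rmorphB; apply/eqP/piK.
  rewrite rmorphB rmorphM rmorphMn !eP.
  have -> : (0, a *+ p) * (0, b *+ p) - (0, (a * b) *+ p) *+ p = 0 :> P * P.
    apply/eqP; rewrite subr_eq0 pairMn; apply/eqP; apply: injective_projections => /=.
      by rewrite mul0r mul0rn.
    by rewrite mulrnAl mulrnAr.
  rewrite -(rmorph0 j); apply/piK; exact: rmorph0.
- move=> x; have [x' <-] := pis x; rewrite qbE => /pie[a ->].
  have -> : pi (e a) *+ p ^ n = pi (e (a *+ p ^ n)).
    apply/eqP; rewrite -rmorphMn -subr_eq0 -rmorphB; apply/eqP/piK.
    rewrite rmorphB rmorphMn !eP.
    have -> : (0, a *+ p) *+ p ^ n - (0, a *+ p ^ n *+ p) = 0 :> P * P.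
      apply/eqP; rewrite subr_eq0 pairMn; apply/eqP; apply: injective_projections => /=.
        by rewrite mul0rn.
      by rewrite mulrnAC.
    rewrite -(rmorph0 j); apply/piK; exact: rmorph0.
  apply/piK; rewrite eP; split; first exact: (ideal0 JP).
  exists (a *+ p ^ n); split; first exact: ker_mod_pn.
  by rewrite /= expr0n (gtn_eqF p_gt0) add0r.
- move: s; apply: (mpoly_hom_eq (G := qb \o gS) (H := piR \o f)) => [c|i] /=.
    by rewrite gSC gWE qbE q0E uP /= qf.
  by rewrite gSX qbE q0E vP /= qf.
exists G, C, j, pi, h; split=> // [x|x y e1]; first by apply/jP; exists x.
by apply/pRK; rewrite rmorphB -q0E -qbE e1 qh subrr.
Qed.

End Level.

(** If p^N x = p^(N+1) y in R, map x and y to the Witt vectors of length two of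
    R / p^N, where p^N (x - p y) = 0.  For the second ghost component b of x - p y
    this says that p^(N-1) b is divisible by p^N in R, so b is divisible by p by
    induction.  Modulo p it is the p-th power of the first component, whose class
    is x modulo p, and R / p is reduced. *)
Lemma presented_flat (P : comPzRingType) (q : {rmorphism P -> R})
    (cc : {rmorphism {mpoly W[d]} -> P}) n (x : R) :
  (forall c, q (cc c) = f c) -> (forall y, exists x, q x = y) ->
  (forall y : P, y *+ p = 0 -> y = 0) ->
  zdvd (p ^ n.+1) (x *+ p ^ n) -> zdvd p x.
Proof.
move=> qf qs P_tf.
elim: n x => [|n IH] x; first by rewrite mulr1n expn1.
move=> [y xy]; set N := n.+1 in xy *.
have [G [C [j [pi [h [jP pis piK hq]]]]]] := ghost_section qf qs N.
have [u uE] := pis (h x); have [v vE] := pis (h y).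
pose X := (j u).1; pose Y := (j u).2; pose X' := (j v).1; pose Y' := (j v).2.
pose a := X - X' *+ p; pose b := Y - Y' *+ p.
have [e1 e2] : (j ((u - v *+ p) *+ p ^ N)).1 = a *+ p ^ N /\
    (j ((u - v *+ p) *+ p ^ N)).2 = b *+ p ^ N.
  by rewrite rmorphMn rmorphB [j (v *+ p)]rmorphMn /= !pairMn.
have bE : b = Y - Y' *+ p by [].
clearbody a b.
have /piK[_ [z [zJ]]] : pi ((u - v *+ p) *+ p ^ N) = 0.
  rewrite rmorphMn rmorphB rmorphMn uE vE mulrnBl -mulrnA -expnS -!rmorphMn xy.
  by rewrite subrr.
rewrite e1 e2 exprMn_n -expnM => e3.
have Np : (N <= (N * p).-1)%N.
  by rewrite /N; have := prime_gt1 p_pr; case: (p) => // -[//|t] _; rewrite mulSn; lia.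
have e4 : b *+ p ^ n = a ^+ p *+ p ^ (N * p).-1 + z.
  apply/eqP; rewrite -subr_eq0; apply/eqP/P_tf; rewrite mulrnBl mulrnDl -!mulrnA.
  by rewrite -!expnSr prednK ?muln_gt0 //= e3 subrr.
have qb : zdvd p (q b).
  apply: IH; rewrite -rmorphMn e4 rmorphD rmorphMn rmorphXn; apply: zdvdD => //.
  by apply: (zdvd_exp Np); exists (q a ^+ p).
have qY : zdvd p (q Y).
  have -> : q Y = q b + q Y' *+ p by rewrite bE rmorphB rmorphMn subrK.
  by apply: zdvdD => //; exists (q Y').
have qX : zdvd p (q X).
  apply: etale_mod_p_reduced; have [c cE] := jP u.
  have -> : q X ^+ p = q Y - q c *+ p.
    by rewrite -rmorphMn -cE -rmorphB opprB addrC subrK rmorphXn.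
  by apply: zdvdB => //; exists (q c).
have := hq _ _ uE; rewrite /N => /(zdvd_exp (ltn0Sn n)); rewrite expn1 => hx.
have -> : x = q X - (q X - x) by ring.
exact: zdvdB.
Qed.

Lemma etale_flat n (x : R) : zdvd (p ^ n.+1) (x *+ p ^ n) -> zdvd p x.
Proof.
have [_ [m [q [_ [_ [qf qs _]]]]]] := fe.
apply: (@presented_flat _ q (@mpolyC m {mpoly W[d]})) => // y.
apply: mpoly_tf => c; apply: mpoly_tf => w.
by case: Wk => _ + _ _; exact.
Qed.

Lemma etale_flat_dvd n (x : R) : zdvd (p ^ n.+1) (x *+ p) -> zdvd (p ^ n) x.
Proof.
elim: n x => [|n IH] x h; first exact: zdvd1.
have [y xy] : zdvd (p ^ n) x by apply: IH; exact: zdvd_exp h.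
have [z zE] : zdvd p y.
  by apply: (@etale_flat n.+1); rewrite (expnSr p n) mulrnA -xy.
by exists z; rewrite xy zE -mulrnA -expnS.
Qed.

End EtaleFlat.

(** * Coordinates on the completion *)

Section Completion.
Variables (p : nat) (k : fieldType) (W : comNzRingType) (red : {rmorphism W -> k}).
Variables (d s : nat) (R A : comPzRingType).
Variables (f : {rmorphism {mpoly W[d]} -> R}) (iota : {rmorphism R -> A}).
Hypothesis p_pr : prime p.
Hypothesis p_gt2 : (2 < p)%N.
Hypothesis kp : perfect_field p k.
Hypothesis Wk : is_witt_ring p red.
Hypothesis fe : etale f.
Hypothesis Ai : is_padic_completion p iota.

Let chart : {rmorphism {mpoly W[d]} -> A} := iota \o f.
Local Notation T := (Tcoord chart).
Let p_gt0 : (0 < p)%N. Proof. exact: prime_gt0. Qed.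

Lemma completion_dense n y : exists x, zdvd (p ^ n) (y - iota x).
Proof. by case: Ai => _ _; apply. Qed.

Lemma completion_ker n x : zdvd (p ^ n) (iota x) -> zdvd (p ^ n) x.
Proof. by case: Ai => _ + _; apply. Qed.

(** The torsion of A can be tested on R modulo p^n, where [etale_flat_dvd]
    applies. *)
Lemma completion_padic_ring : padic_ring p A.
Proof.
have [Ac _ _] := Ai; split=> // a ap.
suff h : padic_sep A p.
  apply: h => n; have [x [y xy]] := completion_dense n.+1 a.
  have h : zdvd (p ^ n) x.
    apply: (etale_flat_dvd p_pr kp Wk fe); apply: completion_ker.
    exists (- (y *+ p)); rewrite mulNrn mulrnAC -xy rmorphMn.
    by rewrite mulrnBl ap sub0r opprK.
  rewrite -[a](subrK (iota x)) xy; apply: zdvdD.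
    by apply: (zdvd_exp (leqnSn n)); exists y.
  exact: zdvd_additive (rmorphD iota) h.
move=> x xd.
have [|l [_ lu]] := Ac (fun=> 0).
  by move=> n; rewrite subrr; exact: zdvd0.
transitivity l; first by apply/esym/lu => n; rewrite subr0; exact: xd.
by apply: lu => n; rewrite subr0; exact: zdvd0.
Qed.

Local Notation HA := completion_padic_ring.

Lemma completion_reduced (x : A) : zdvd p (x ^+ p) -> zdvd p x.
Proof.
move=> h; have [y yx] := completion_dense 1 x; rewrite expn1 in yx.
rewrite -[x](subrK (iota y)); apply: zdvdD => //.
apply: zdvd_additive (rmorphD iota) _; apply: (etale_mod_p_reduced p_pr kp Wk fe).
rewrite -[p in zdvd p _]expn1; apply: completion_ker; rewrite expn1 rmorphXn.
rewrite -[_ ^+ p](subrK (x ^+ p)); apply: zdvdD => //.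
by apply: zdvd_pow_cong; exact: zdvd_sym.
Qed.

Lemma completion_hom_eq (g1 g2 : {rmorphism A -> A}) :
  (forall x, g1 (chart x) = g2 (chart x)) -> (forall x, zdvd p (g1 x - g2 x)) ->
  g1 =1 g2.
Proof.
move=> gc gp a; have As := complete_sep HA; have [fe1 _] := fe.
have e : g1 \o iota =1 g2 \o iota.
  by apply: (hom_unique_padic fe1 As) => x; [exact: gc|exact: gp].
apply/eqP; rewrite -subr_eq0; apply/eqP/As => n.
have [x hx] := completion_dense n a.
apply: (@zdvd_chain _ _ (g1 (iota x))).
  by rewrite -rmorphB; apply: zdvd_additive hx; exact: rmorphD.
have := e x; rewrite /= => ->; rewrite -rmorphB.
by apply: zdvd_additive (rmorphD g2) (zdvd_sym hx).
Qed.

(** The map x |-> (x, D x) to the dual numbers of A exists on R by the lifting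
    property, and extends to the completion because D respects divisibility by
    p^n. *)
Lemma coord_der_exists l : exists D : A -> A,
  [/\ forall x y, D (x + y) = D x + D y,
      forall x y, D (x * y) = x * D y + D x * y,
      forall w, D (chart w%:MP) = 0
    & forall i, D (T i) = (i == l)%:R].
Proof.
have As := complete_sep HA; have Al := complete_lim HA.
have [|||gW gWE] := @rmorph_pack W (dual_num A) (fun w => (chart w%:MP, 0)).
- by move=> x y; apply: injective_projections; rewrite /= ?rmorphD ?addr0.
- move=> x y; apply: injective_projections; rewrite /= ?rmorphM //.
  by rewrite mulr0 mul0r addr0.
- by apply: injective_projections; rewrite /= ?rmorph1.
have [gS [gSC gSX]] :=
  mpoly_lift gW (fun i : 'I_d => (T i, (i == l)%:R) : dual_num A).
have [|||h [hf qh _]] := (proj1 fe) _ _ (@dual_re A) gS iota.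
- by move=> y; exists (y, 0).
- move=> x y x0 y0; apply: injective_projections.
    by apply: etrans (_ : dual_re x * dual_re y = 0) => //; rewrite x0 mul0r.
  apply: etrans (_ : dual_re x * y.2 + x.2 * dual_re y = 0) => //.
  by rewrite x0 y0 mul0r mulr0 addr0.
- move=> x; apply: (mpoly_hom_eq (G := @dual_re A \o gS) (H := chart)) => [c|i] /=.
    by rewrite gSC gWE.
  by rewrite gSX.
pose D0 x := (h x).2.
have D0D x y : D0 (x + y) = D0 x + D0 y by rewrite /D0 rmorphD.
have D0M x y : D0 (x * y) = iota x * D0 y + D0 x * iota y.
  by rewrite /D0 rmorphM -!qh.
have D0B x y : D0 (x - y) = D0 x - D0 y by rewrite /D0 rmorphB.
have D0d n x y : zdvd (p ^ n) (iota x - iota y) -> zdvd (p ^ n) (D0 x - D0 y).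
  rewrite -rmorphB => /completion_ker h1; rewrite -D0B.
  exact: zdvd_additive D0D h1.
have ex a : exists e, forall n x, zdvd (p ^ n) (a - iota x) -> zdvd (p ^ n) (e - D0 x).
  have [x xP] := choice (fun n => completion_dense n a).
  have [n|e eP] := Al (fun n => D0 (x n)).
    apply: D0d; apply: zdvd_chain (zdvd_sym _) (xP n).
    by apply: zdvd_exp (xP n.+1).
  exists e => n y ay; apply: zdvd_chain (eP n) _; apply: D0d.
  exact: zdvd_chain (zdvd_sym (xP n)) ay.
have [D DP] := choice ex.
have Diota x : D (iota x) = D0 x.
  apply/eqP; rewrite -subr_eq0; apply/eqP/As => n; apply: DP.
  by rewrite subrr; exact: zdvd0.
exists D; split.
- move=> a b; apply/eqP; rewrite -subr_eq0; apply/eqP/As => n.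
  have [x ax] := completion_dense n a; have [y bx] := completion_dense n b.
  apply: (@zdvd_chain _ _ (D0 (x + y))).
    by apply: DP; rewrite rmorphD opprD addrACA; exact: zdvdD.
  by rewrite D0D opprD addrACA; apply: zdvdD; apply: zdvd_sym; exact: DP.
- move=> a b; apply/eqP; rewrite -subr_eq0; apply/eqP/As => n.
  have [x ax] := completion_dense n a; have [y bx] := completion_dense n b.
  have hD := DP _ _ _ ax; have hD' := DP _ _ _ bx.
  apply: (@zdvd_chain _ _ (D0 (x * y))).
    apply: DP; rewrite rmorphM.
    have -> : a * b - iota x * iota y = (a - iota x) * b + iota x * (b - iota y) by ring.
    by apply: zdvdD; [exact: zdvdMr|exact: zdvdMl].
  rewrite D0M; apply: zdvd_sym.
  have -> : a * D b + D a * b - (iota x * D0 y + D0 x * iota y) =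
    (a - iota x) * D b + iota x * (D b - D0 y) + ((D a - D0 x) * b + D0 x * (b - iota y)).
    by ring.
  by apply: zdvdD; apply: zdvdD; (exact: zdvdMr || exact: zdvdMl).
- by move=> w; rewrite /chart /= Diota /D0 hf gSC gWE.
- by move=> i; rewrite /Tcoord /chart /= Diota /D0 hf gSX.
Qed.

Lemma coord_derP : is_coord_der chart (coord_der chart).
Proof.
have [D DP] := choice coord_der_exists.
rewrite /coord_der; case: xgetP => [//|no]; exfalso; exact: (no D DP).
Qed.

Let ld := log_der s chart.

Lemma log_derD l x y : ld l (x + y) = ld l x + ld l y.
Proof.
have [DD _ _ _] := coord_derP l; rewrite /ld /log_der DD.
by case: ifP => // _; rewrite mulrDr.
Qed.

Lemma log_derM l x y : ld l (x * y) = x * ld l y + ld l x * y.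
Proof.
have [_ DM _ _] := coord_derP l; rewrite /ld /log_der DM.
by case: ifP => // _; ring.
Qed.

Lemma log_der_W l w : ld l (chart w%:MP) = 0.
Proof.
have [_ _ DW _] := coord_derP l; rewrite /ld /log_der DW.
by case: ifP => // _; rewrite mulr0.
Qed.

Lemma log_der_T l i : ld l (T i) = (if (i < s)%N then T i else 1) *+ (i == l).
Proof.
have [_ _ _ DT] := coord_derP l; rewrite /ld /log_der DT.
case: eqP => [->|_]; last by rewrite mulr0n; case: ifP => //; rewrite mulr0.
by case: ifP => _; rewrite ?mulr1 !mulr1n.
Qed.

(** From T x = 0 modulo p, the derivation with D T = 1 gives x = - T D x, whence
    x^2 = 0, and A / p is reduced. *)
Lemma T_regular_mod_p i x : zdvd p (T i * x) -> zdvd p x.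
Proof.
have [DD DM _ DT] := coord_derP i => h; set D := coord_der chart i in DD DM DT.
have := zdvd_additive DD h; rewrite DM DT eqxx mul1r => h2.
have h3 : zdvd p (x ^+ 2).
  have -> : x ^+ 2 = (T i * D x + x) * x - (T i * x) * D x by ring.
  by apply: zdvdB; apply: zdvdMr.
apply: completion_reduced.
have -> : x ^+ p = x ^+ (p - 2) * x ^+ 2 by rewrite -exprD subnK // ltnW.
exact: zdvdMl.
Qed.

Lemma T_pow_regular_mod_p i n x : zdvd p (T i ^+ n * x) -> zdvd p x.
Proof.
elim: n => [|n IH]; first by rewrite mul1r.
by rewrite exprS -mulrA => /T_regular_mod_p.
Qed.

Lemma T_pow_regular i n x : T i ^+ n * x = 0 -> x = 0.
Proof.
have As := complete_sep HA; have Atf := padic_tf HA => Tx.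
apply: As => N; elim: N => [|N [y xy]]; first exact: zdvd1.
have Ty : T i ^+ n * y = 0.
  by apply: (tf_pexp HA (n := N)); rewrite -mulrnAr -xy.
have [z zE] : zdvd p y by apply: (@T_pow_regular_mod_p i n); rewrite Ty; exact: zdvd0.
by exists z; rewrite xy zE -mulrnA -expnS.
Qed.

Section TwoLifts.
Implicit Types Phi Psi : frob_lift p T.

(** Phi(T) is T^p modulo p and T is regular modulo p, so the unit in front of T^p
    is 1 modulo p. *)
Lemma frob_lift_T Phi i : exists w v a : A,
  [/\ w * v = 1, w = 1 + a *+ p & Phi (T i) = w * T i ^+ p].
Proof.
have [w [[v wv] e]] := frob_coord Phi i.
have [y hy] := frob_mod Phi (T i); rewrite e in hy.
have [a aE] : zdvd p (w - 1).
  by apply: (@T_pow_regular_mod_p i p); exists y; rewrite -hy; ring.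
by exists w, v, a; split=> //; rewrite -aE addrC subrK.
Qed.

Lemma frob_lift_W Phi Psi w : Phi (chart w%:MP) = Psi (chart w%:MP).
Proof.
pose g (Xi : frob_lift p T) : {rmorphism W -> A} := frob Xi \o chart \o @mpolyC d W.
apply: (witt_hom_eq p_pr kp Wk (g1 := g Phi) (g2 := g Psi) (complete_sep HA)) => x.
apply: zdvd_chain (frob_mod Phi _) (zdvd_sym (frob_mod Psi _)).
Qed.

(** The parameter of transport from Psi to Phi: logarithmic along the divisor,
    additive elsewhere. *)
Definition is_lam Phi Psi (i : 'I_d) (a : A) : Prop :=
  if (i < s)%N then Phi (T i) = pexp1 p a * Psi (T i)
  else Phi (T i) = Psi (T i) + a *+ p.

Definition lam Phi Psi (i : 'I_d) : A := xget 0 [set a | is_lam Phi Psi i a].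

Lemma lamP Phi Psi i : is_lam Phi Psi i (lam Phi Psi i).
Proof.
rewrite /lam; case: xgetP => [//|no]; exfalso.
suff [a ha] : exists a, is_lam Phi Psi i a by exact: (no a ha).
rewrite /is_lam; case: (i < s)%N.
  have [w [v [a [wv wa ->]]]] := frob_lift_T Phi i.
  have [w' [v' [a' [wv' wa' ->]]]] := frob_lift_T Psi i.
  have [c ce] := pexp1_surj HA ((a - a') * v').
  exists c; rewrite ce mulrA; congr (_ * _).
  have -> : 1 + (a - a') * v' *+ p = w * v'.
    have -> : (a - a') * v' *+ p = (w - w') * v' by rewrite wa wa'; ring.
    by rewrite mulrBl wv' addrC subrK.
  by rewrite -mulrA [_ * w']mulrC wv' mulr1.
have [x hx] := frob_mod Phi (T i); have [y hy] := frob_mod Psi (T i).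
exists (x - y); rewrite mulrnBl -hx -hy; ring.
Qed.

Lemma frob_T_regular Psi i x : Psi (T i) * x = 0 -> x = 0.
Proof.
have [w [v [a [wv _ ->]]]] := frob_lift_T Psi i => h.
apply: (@T_pow_regular i p).
have -> : T i ^+ p * x = v * (w * T i ^+ p * x).
  by rewrite -[w * _ * x]mulrA [RHS]mulrA [v * w]mulrC wv mul1r.
by rewrite h mulr0.
Qed.

Lemma lam_unique Phi Psi i a : is_lam Phi Psi i a -> lam Phi Psi i = a.
Proof.
have := lamP Phi Psi i; rewrite /is_lam; case: ifP => _ -> e.
  apply: (pexp1_inj HA); apply/eqP; rewrite -subr_eq0; apply/eqP.
  by apply: (@frob_T_regular Psi i); rewrite mulrBr ![Psi _ * _]mulrC e subrr.
by apply: (tf_inj HA p_gt0); exact: addrI e.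
Qed.

(** Exponentials multiply when exponents add. *)
Lemma lam_cocycle Phi1 Phi2 Phi3 i :
  lam Phi1 Phi3 i = lam Phi1 Phi2 i + lam Phi2 Phi3 i.
Proof.
apply: lam_unique; have := lamP Phi1 Phi2 i; have := lamP Phi2 Phi3 i.
rewrite /is_lam; case: ifP => _ -> ->; first by rewrite (pexp1D HA) mulrA.
by rewrite mulrnDl -addrA [_ *+ p + _]addrC.
Qed.

Lemma lam_refl Phi i : lam Phi Phi i = 0.
Proof.
apply: lam_unique; rewrite /is_lam (pexp10 HA) mul1r mul0rn addr0.
by case: ifP.
Qed.

(** The defining equation of dlog Psi(T_i) / p, or of d Psi(T_i) / p; its solution
    is unique since p and Psi(T_i) are regular. *)
Definition is_frob_form Psi (i l : 'I_d) (z : A) : Prop :=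
  if (i < s)%N then p%:R * Psi (T i) * z = ld l (Psi (T i))
  else p%:R * z = ld l (Psi (T i)).

Lemma frob_form_unique Psi i l y z :
  is_frob_form Psi i l y -> is_frob_form Psi i l z -> y = z.
Proof.
rewrite /is_frob_form; case: ifP => _ <- /eqP e; apply/eqP; rewrite eq_sym -subr_eq0.
  apply/eqP/(@frob_T_regular Psi i)/(padic_tf HA).
  by move: e; rewrite -subr_eq0 -mulrBr -mulrA mulr_natl => /eqP.
by apply/eqP/(padic_tf HA); move: e; rewrite -subr_eq0 -mulrBr mulr_natl => /eqP.
Qed.

Lemma frob_formP Psi i l : is_frob_form Psi i l (frob_form s Psi i l).
Proof.
have lD := log_derD l; have lM := log_derM l.
suff [z zP] : exists z, is_frob_form Psi i l z.
  move: zP; rewrite /is_frob_form /frob_form; case: ifP => _ zP;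
  by rewrite /exact_quo; case: xgetP => // no; have := no _ zP.
rewrite /is_frob_form; case si: (i < s)%N.
  have [w [v [a [wv wa ->]]]] := frob_lift_T Psi i.
  exists (v * (w *+ (i == l) + ld l a)).
  have lw : ld l w = ld l a *+ p by rewrite wa lD (der1 lM) add0r (derMn lD).
  have pE : T i ^+ p = T i ^+ p.-1 * T i by rewrite -exprSr prednK.
  transitivity ((w * v) * (p%:R * T i ^+ p * (w *+ (i == l) + ld l a))); first by ring.
  rewrite wv mul1r lM (derXn lM) log_der_T si lw pE.
  by case: (i == l); rewrite ?mulr0n ?mulr1n; ring.
have [y hy] := frob_mod Psi (T i).
exists (T i ^+ p.-1 * ld l (T i) + ld l y).
have -> : Psi (T i) = T i ^+ p + y *+ p by rewrite -hy addrC subrK.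
by rewrite lD (derXn lM) (derMn lD) mulr_natl mulrnDl.
Qed.

(** Take logarithmic differentials of Phi(T) = exp(p lam) Psi(T) and divide
    by p. *)
Lemma frob_form_lam Phi Psi i l :
  frob_form s Phi i l = frob_form s Psi i l + ld l (lam Phi Psi i).
Proof.
have lD := log_derD l; have lM := log_derM l.
apply: (frob_form_unique (frob_formP Phi i l)).
have := frob_formP Psi i l; have := lamP Phi Psi i; rewrite /is_lam /is_frob_form.
case: ifP => _ -> e.
  rewrite lM -e (der_pexp1 HA lD lM) -mulr_natl; ring.
by rewrite lD (derMn lD) -e -mulr_natl; ring.
Qed.

Lemma lop_ld_const mu n Psi x : (forall l, ld l x = 0) ->
  lop (ld : 'I_d -> A^o -> A^o) mu n.+1 (frob Psi : A^o -> A^o) x = 0.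
Proof.
move=> x0 /=; have z m : lop (ld : 'I_d -> A^o -> A^o) mu m (frob Psi : A^o -> A^o) 0 = 0.
  elim: m => [|m IH] /=; first exact: rmorph0.
  rewrite big1 // => l _; have -> : ld l 0 = 0 by exact: (der0 (log_derD l)).
  by rewrite IH scaler0.
by rewrite big1 // => l _; rewrite x0 z scaler0.
Qed.

(** The left side is multiplicative in c and congruent to Psi(c), hence to Phi(c),
    modulo p, so by uniqueness of lifts it suffices to evaluate it on W, where all
    terms of positive order vanish, and on the T_i: there the series is the
    exponential of p lam_i, or stops after the linear term. *)
Lemma taylor_frob Phi Psi c :
  ksum p 0 (fun m => lop (ld : 'I_d -> A^o -> A^o) (lam Phi Psi) m
                         (frob Psi : A^o -> A^o) c) = Phi c.
Proof.
have As : padic_sep A^o p := complete_sep HA.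
have Al : padic_lim A^o p := complete_lim HA.
set mu := lam Phi Psi.
pose L m (c : A) : A := lop (ld : 'I_d -> A^o -> A^o) mu m (frob Psi : A^o -> A^o) c.
pose Th c : A := ksum p 0 (fun m => (L m c : A^o)).
have fam : @is_family p A 0 A^o (fun _ _ => True) A^o Psi (fun _ => Psi : A^o -> A^o).
  by split=> // [r u v _ _ _|r a v _ _]; [exact: rmorphD|exact: rmorphM].
have ThD x y : Th (x + y) = Th x + Th y.
  exact: (@taylorD p A d HA 0 A^o ld (fun _ _ => True) p_gt0 (fun _ _ _ _ => I)
    log_derD A^o As Al Psi (fun _ => Psi : A^o -> A^o) fam mu 0%N x y).
have ThM x y : Th (x * y) = Th x * Th y.
  exact: (@taylorZ p A d HA 0 A^o ld ld (fun _ _ => True) p_gt0 (fun _ _ _ _ => I)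
    (fun _ _ _ => I) (fun _ _ _ _ => I) log_derD log_derM A^o As Al Psi
    (fun _ => Psi : A^o -> A^o) fam mu 0%N x y).
have Thc x : (forall l, ld l x = 0) -> Th x = Psi x.
  by move=> x0; rewrite /Th (ksum_eq0 HA) // => -[|m] // _; exact: lop_ld_const.
have Th1 : Th 1 = 1.
  by rewrite Thc ?rmorph1 // => l; exact: (der1 (log_derM l)).
have [Thm ThmE] := rmorph_pack ThD ThM Th1.
have Thp x : zdvd p (Th x - Psi x).
  have := ksumP HA Al (fun m => (L m x : A^o)) p_gt0 (leqnn (kbnd p 1)).
  have : (0 < kbnd p 1)%N by rewrite /kbnd; lia.
  case: (kbnd p 1) => // n _; rewrite big_ord_recl (kap_n0 HA) // scale1r expn1 => h.
  apply: zdvd_chain h _; rewrite addrAC subrr add0r; apply: zdvd_sum => i _.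
  by apply: zdvdZl; exact: (kap0_p HA).
have eq1 : Thm =1 Phi; last by rewrite -eq1 ThmE.
apply: completion_hom_eq; last first.
  move=> x; rewrite ThmE; apply: zdvd_chain (Thp x) _.
  exact: zdvd_chain (frob_mod Psi _) (zdvd_sym (frob_mod Phi _)).
move=> x; apply: (mpoly_hom_eq (G := Thm \o chart) (H := frob Phi \o chart)) => [w|i].
  rewrite /= ThmE Thc; first exact: frob_lift_W.
  by move=> l; exact: log_der_W.
rewrite /= ThmE -/(Tcoord chart i); have := lamP Phi Psi i; rewrite /is_lam -/mu.
case: ifP => si ->.
  have LT n : L n (T i) = mu i ^+ n * Psi (T i).
    elim: n => [|n IH]; first by rewrite mul1r.
    rewrite /L /= (bigD1 i) //= big1 => [|l li].
      by rewrite log_der_T si eqxx mulr1n -/(L n _) IH addr0 exprS -mulrA.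
    rewrite log_der_T eq_sym (negPf li) mulr0n.
    case: n {IH} => [|n]; first by rewrite /= rmorph0 scaler0.
    rewrite lop_ld_const ?scaler0 // => l'; exact: (der0 (log_derD l')).
  apply: etrans (eq_ksum (M := A^o) p 0 LT) _.
  by apply/esym; exact: (ksumZl HA (M := A^o)).
pose z n : A^o := if n is 0 then mu i else 0.
have LT n : L n (T i) = (if n is 0 then Psi (T i) else 0) + z n.-1 *+ n.
  case: n => [|n]; first by rewrite mulr0n addr0.
  rewrite /L /= add0r (bigD1 i) //= big1 => [|l li]; last first.
    rewrite log_der_T eq_sym (negPf li) mulr0n.
    case: n => [|n]; first by rewrite /= rmorph0 scaler0.
    by rewrite lop_ld_const ?scaler0 // => l'; exact: (der0 (log_derD l')).
  rewrite log_der_T si eqxx mulr1n addr0.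
  case: n => [|n]; first by rewrite /= rmorph1 [LHS]mulr1.
  rewrite lop_ld_const ?scaler0 /= ?mul0rn // => l'; exact: (der1 (log_derM l')).
apply: etrans (eq_ksum (M := A^o) p 0 LT) _.
rewrite (ksumD HA) //; congr (_ + _).
  by rewrite (ksum_eq0 HA) // => -[].
by rewrite (ksum_shift0 HA) // (ksum_eq0 HA) // => -[].
Qed.

End TwoLifts.
End Completion.

(** * The universal property of the twisted module *)

Section SemilinearQuotient.
Variables (A B : pzRingType) (Psi : {rmorphism A -> B}).
Variables (V : lmodType A) (M : lmodType B).

Definition semilinear_map (G : V -> M) : Prop :=
  (forall x y, G (x + y) = G x + G y) /\ (forall c x, G (c *: x) = Psi c *: G x).

Lemma semilinear0 G : semilinear_map G -> G 0 = 0.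
Proof. by move=> [GD _]; apply: (addrI (G 0)); rewrite -GD !addr0. Qed.

Lemma semilinearB G x y : semilinear_map G -> G (x - y) = G x - G y.
Proof. by move=> [GD _]; apply/eqP; rewrite eq_sym subr_eq -GD subrK. Qed.

Definition ker_pred G (GP : semilinear_map G) : {pred V} := fun x => `[< G x = 0 >].

Lemma ker_pred_closed G (GP : semilinear_map G) : submod_closed (ker_pred GP).
Proof.
split; first by apply/asboolP; exact: semilinear0.
move=> c x y /asboolP x0 /asboolP y0; apply/asboolP.
by have [GD GZ] := GP; rewrite GD GZ x0 y0 scaler0 addr0.
Qed.

HB.instance Definition _ G (GP : semilinear_map G) :=
  GRing.isSubmodClosed.Build A V (ker_pred GP) (ker_pred_closed GP).

Lemma span_ker (X : set V) G x : semilinear_map G -> (forall y, X y -> G y = 0) ->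
  x \in submod_span X -> G x = 0.
Proof.
move=> GP GX /asboolP /(_ (ker_pred GP : submodClosed V)) h.
suff /asboolP : x \in ker_pred GP by [].
by apply: h => y Xy; apply/asboolP; exact: GX.
Qed.

Lemma quotm_factor (X : set V) G : semilinear_map G -> (forall y, X y -> G y = 0) ->
  exists2 H : quotm (submod_span X) -> M,
    (forall x, H (quotm_pi _ x) = G x) &
    (forall x y, H (x + y) = H x + H y) /\ (forall c x, H (c *: x) = Psi c *: H x).
Proof.
move=> GP GX.
have HE x : G (repr (quotm_pi (submod_span X) x)) = G x.
  apply/eqP; rewrite -subr_eq0 -semilinearB //; apply/eqP.
  apply: (span_ker GP GX); exact: quotm_repr.
exists (fun y => G (repr y)) => //; split=> [x y|c x].
  rewrite -[x]quotm_reprK -[y]quotm_reprK -quotm_piD !HE; exact: (proj1 GP).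
have -> : c *: x = quotm_pi _ (c *: repr x) by rewrite -quotm_piZ quotm_reprK.
by rewrite HE; exact: (proj2 GP).
Qed.

End SemilinearQuotient.

Section BaseChangeTheory.
Variables (A B : pzRingType) (Phi : {rmorphism A -> B}) (M : lmodType A).
Local Notation bc := (base_change Phi M).

Lemma quotm_pi_linear (C : pzRingType) (V : lmodType C) (S : submodClosed V) c x y :
  quotm_pi S (c *: x + y) = c *: quotm_pi S x + quotm_pi S y.
Proof. by rewrite quotm_piD -quotm_piZ. Qed.

Lemma quotm_pi0 (C : pzRingType) (V : lmodType C) (S : submodClosed V) :
  quotm_pi S 0 = 0.
Proof. by apply: (addrI (quotm_pi S 0)); rewrite -quotm_piD !addr0. Qed.

Lemma span_in (C : pzRingType) (V : lmodType C) (X : set V) x :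
  X x -> x \in submod_span X.
Proof. by move=> Xx; apply/asboolP => S; apply. Qed.

Lemma tens1D (m m' : M) : tens1 Phi (m + m') = tens1 Phi m + tens1 Phi m'.
Proof.
rewrite /tens1 -quotm_piD; apply: quotm_piE; apply: span_in; left.
by exists m, m'; rewrite opprD addrA.
Qed.

Lemma tens1Z c (m : M) : tens1 Phi (c *: m) = Phi c *: tens1 Phi m.
Proof.
transitivity (quotm_pi (submod_span (@base_change_rel A B Phi M)) (Phi c *: free_gen B m)).
  by apply: quotm_piE; apply: span_in; right; exists c, m.
by apply/esym; exact: quotm_piZ.
Qed.

Lemma free_valD (x y : free_mod B M) m : val (x + y) m = val x m + val y m :> B.
Proof. by []. Qed.

Lemma free_valZ (c : B) (x : free_mod B M) m : val (c *: x) m = c * val x m :> B.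
Proof. by []. Qed.

Lemma free_val_sum (I : Type) (r : seq I) (F : I -> free_mod B M) m :
  val (\sum_(i <- r) F i) m = \sum_(i <- r) val (F i) m :> B.
Proof. by elim: r => [|i r IH]; rewrite ?big_nil ?big_cons // free_valD IH. Qed.

Lemma free_sum (x : free_mod B M) (s : seq M) : uniq s ->
  (forall m, m \notin s -> val x m = 0) ->
  x = \sum_(m <- s) (val x m : B) *: free_gen B m.
Proof.
move=> us xs; apply: val_inj; apply: funext => m.
apply/esym; apply: etrans (free_val_sum _ _ _) _.
under eq_bigr => i _ do rewrite free_valZ /=.
have [ms|/xs x0] := boolP (m \in s).
  rewrite (bigD1_seq m) //= eqxx mulr1 big1 ?addr0 // => i /negPf im.
  by rewrite eq_sym im mulr0.
rewrite x0 big1_seq // => i /= si; case: eqP => [mi|_]; last by rewrite mulr0.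
by rewrite -mi x0 mul0r.
Qed.

Lemma free_support (x : free_mod B M) :
  exists s, uniq s /\ forall m, m \notin s -> val x m = 0.
Proof.
have /asboolP[s sP] := valP x; exists (undup s); split; first exact: undup_uniq.
by move=> m; rewrite mem_undup; exact: sP.
Qed.

Lemma base_change_ind (P : bc -> Prop) :
  P 0 -> (forall x y, P x -> P y -> P (x + y)) -> (forall c x, P x -> P (c *: x)) ->
  (forall m : M, P (tens1 Phi m)) -> forall x, P x.
Proof.
move=> P0 PD PZ Pt x; rewrite -[x]quotm_reprK; move: (repr x) => {}x.
have [s [us xs]] := free_support x; rewrite (free_sum us xs).
elim: s {us xs} => [|m s IH]; first by rewrite big_nil quotm_pi0.
rewrite big_cons quotm_pi_linear; apply: PD => //; apply: PZ; exact: Pt.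
Qed.

Section Lift.
Variables (N : lmodType B) (h : M -> N).
Hypothesis hP : semilinear_map Phi h.

Definition free_eval (s : seq M) (x : free_mod B M) : N := \sum_(m <- s) (val x m : B) *: h m.

Lemma free_eval_sub s t x : uniq s -> uniq t -> {subset s <= t} ->
  (forall m, m \notin s -> val x m = 0) -> free_eval t x = free_eval s x.
Proof.
move=> us ut st xs; rewrite /free_eval (bigID (mem s)) /= [X in _ + X]big1 ?addr0.
  rewrite -big_filter; apply: perm_big; apply: uniq_perm => //.
    exact: filter_uniq.
  by move=> m; rewrite mem_filter; case: (boolP (m \in s)) => // /st ->.
by move=> m /xs ->; rewrite scale0r.
Qed.

Let supp (x : free_mod B M) : seq M :=
  xget [::] [set s : seq M | uniq s /\ forall m, m \notin s -> val x m = 0].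

Let suppP x : uniq (supp x) /\ forall m, m \notin supp x -> val x m = 0.
Proof.
by rewrite /supp; case: xgetP => // no; have [s sP] := free_support x; have := no s sP.
Qed.

Definition free_lift (x : free_mod B M) : N := free_eval (supp x) x.

Lemma free_liftE s x : uniq s -> (forall m, m \notin s -> val x m = 0) ->
  free_lift x = free_eval s x.
Proof.
move=> us xs; have [us' xs'] := suppP x.
pose t := undup (s ++ supp x); have ut : uniq t by exact: undup_uniq.
rewrite /free_lift -(free_eval_sub us' ut) //; last first.
  by move=> m; rewrite mem_undup mem_cat orbC => ->.
rewrite (free_eval_sub us ut) // => m; by rewrite mem_undup mem_cat => ->.
Qed.

Lemma free_lift_semilinear : semilinear_map idfun free_lift.
Proof.
split=> [x y|c x].
  have [sx [ux x0]] := free_support x; have [sy [uy y0]] := free_support y.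
  pose t := undup (sx ++ sy); have ut : uniq t by exact: undup_uniq.
  have tx m : m \notin t -> val x m = 0.
    by rewrite mem_undup mem_cat negb_or => /andP[/x0].
  have ty m : m \notin t -> val y m = 0.
    by rewrite mem_undup mem_cat negb_or => /andP[_ /y0].
  rewrite (free_liftE ut tx) (free_liftE ut ty) (@free_liftE t) //; last first.
    by move=> m mt; rewrite free_valD tx // ty // addr0.
  rewrite /free_eval -big_split; apply: eq_bigr => m _.
  by rewrite free_valD scalerDl.
have [s [us x0]] := free_support x.
rewrite (free_liftE us x0) (@free_liftE s) //; last first.
  by move=> m ms; rewrite free_valZ x0 // mulr0.
rewrite /free_eval scaler_sumr; apply: eq_bigr => m _.
by rewrite free_valZ scalerA.
Qed.

Lemma free_lift_gen m : free_lift (free_gen B m) = h m.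
Proof.
rewrite (@free_liftE [:: m]) //; first by rewrite /free_eval big_seq1 /= eqxx scale1r.
by move=> m'; rewrite inE => /negPf /= ->.
Qed.

Lemma base_change_lift : exists2 H : bc -> N,
  (forall m, H (tens1 Phi m) = h m) & linear H.
Proof.
have [hD hZ] := hP; have fP := free_lift_semilinear.
have [||H HE [HD HZ]] := @quotm_factor _ _ idfun _ _ (@base_change_rel A B Phi M) free_lift.
- exact: fP.
- move=> _ [[m [m' ->]]|[c [m ->]]].
    rewrite !(semilinearB _ _ fP) !free_lift_gen hD.
    by rewrite addrAC addrK subrr.
  by rewrite (semilinearB _ _ fP) (proj2 fP) !free_lift_gen hZ subrr.
exists H => [m|c x y]; first by rewrite /tens1 HE free_lift_gen.
by rewrite HD HZ.
Qed.

End Lift.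
End BaseChangeTheory.

Section TildeTheory.
Variables (p : nat) (A : comPzRingType) (V : lmodType A) (a b : int).
Variable Fil : int -> submodClosed V.
Hypothesis ab : a <= b.

Definition wdt := `|b - a|%N.
Local Notation n := wdt.

Lemma wdtE : a + n%:Z = b.
Proof. by rewrite /wdt; move: ab; lia. Qed.

Definition filn (r : nat) (v : V) : Prop := v \in Fil (a + r%:Z).

Lemma filn_add r u v : filn r u -> filn r v -> filn r (u + v).
Proof. by rewrite /filn; exact: rpredD. Qed.

Lemma filn_scale r c v : filn r v -> filn r (c *: v).
Proof. by rewrite /filn; exact: rpredZ. Qed.

Lemma dsum_inE r v l : (r <= n)%N -> filn r v ->
  val (dsum_in a b Fil (a + r%:Z) v) l = if (l : nat) == r then v else 0.
Proof.
move=> rn Fv; rewrite /dsum_in val_insubd /=.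
have -> : [ffun l0 : 'I_n.+1 => if a + l0%:Z == a + r%:Z then v else 0] \in dsum_pred (a := a) (b := b) Fil.
  apply/forallP => i; rewrite ffunE; case: eqP => [->//|_]; exact: rpred0.
by rewrite ffunE (inj_eq (addrI a)) eqz_nat.
Qed.

Lemma dsumP (y : dsum a b Fil) (l : 'I_n.+1) : filn l (val y l).
Proof. by have /forallP := valP y; apply. Qed.

Lemma dsum_eq (x y : dsum a b Fil) : (forall l, val x l = val y l) -> x = y.
Proof. by move=> xy; apply: val_inj; apply/ffunP. Qed.

Lemma dsum_valD (x y : dsum a b Fil) l : val (x + y) l = val x l + val y l.
Proof. by rewrite [LHS]ffunE. Qed.

Lemma dsum_valZ c (x : dsum a b Fil) l : val (c *: x) l = c *: val x l.
Proof. by rewrite [LHS]ffunE. Qed.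

Lemma dsum_val_sum (I : Type) (s : seq I) (F : I -> dsum a b Fil) l :
  val (\sum_(i <- s) F i) l = \sum_(i <- s) val (F i) l.
Proof.
elim: s => [|i s IH]; first by rewrite !big_nil [LHS]ffunE.
by rewrite !big_cons dsum_valD IH.
Qed.

Lemma dsum_decomp (y : dsum a b Fil) :
  y = \sum_(l < n.+1) dsum_in a b Fil (a + (l : nat)%:Z) (val y l).
Proof.
apply: dsum_eq => l; rewrite dsum_val_sum (bigD1 l) //= dsum_inE ?eqxx //.
- rewrite big1 ?addr0 // => i il; rewrite dsum_inE //; last exact: dsumP.
    by rewrite (_ : (l : nat) == i = false) //; apply/negbTE; rewrite eq_sym.
  by rewrite -ltnS.
- by rewrite -ltnS.
- exact: dsumP.
Qed.

Lemma tilde_inE r v :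
  tilde_in p a b Fil (a + r%:Z) v = quotm_pi _ (dsum_in a b Fil (a + r%:Z) v).
Proof.
by rewrite /tilde_in; case: eqP => // e; exfalso; move: e; lia.
Qed.

Lemma tilde_in_low v :
  tilde_in p a b Fil (a - 1) v = p%:R *: tilde_in p a b Fil a v.
Proof.
have := tilde_inE 0 v; rewrite addr0 => ->.
by rewrite /tilde_in eqxx.
Qed.

Lemma tilde_inD r u v : (r <= n)%N -> filn r u -> filn r v ->
  tilde_in p a b Fil (a + r%:Z) (u + v) =
  tilde_in p a b Fil (a + r%:Z) u + tilde_in p a b Fil (a + r%:Z) v.
Proof.
move=> rn Fu Fv; rewrite !tilde_inE -quotm_piD; congr (quotm_pi _ _).
apply: dsum_eq => l; rewrite dsum_valD !dsum_inE //; last exact: filn_add.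
by case: eqP; rewrite ?addr0.
Qed.

Lemma tilde_inZ r c v : (r <= n)%N -> filn r v ->
  tilde_in p a b Fil (a + r%:Z) (c *: v) = c *: tilde_in p a b Fil (a + r%:Z) v.
Proof.
move=> rn Fv; rewrite !tilde_inE.
transitivity (quotm_pi (submod_span (@tilde_rel A V p a b Fil))
  (c *: dsum_in a b Fil (a + r%:Z) v)); last by apply/esym; exact: quotm_piZ.
congr (quotm_pi _ _).
apply: dsum_eq => l; rewrite dsum_valZ !dsum_inE //; last exact: filn_scale.
by case: eqP; rewrite ?scaler0.
Qed.

Lemma tilde_in_rel r v : (r < n)%N -> filn r.+1 v ->
  tilde_in p a b Fil (a + r%:Z) v = tilde_in p a b Fil (a + r.+1%:Z) v *+ p.
Proof.
move=> rn Fv; rewrite !tilde_inE -scaler_nat.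
transitivity (quotm_pi (submod_span (@tilde_rel A V p a b Fil))
  (p%:R *: dsum_in a b Fil (a + r.+1%:Z) v)); last by apply/esym; exact: quotm_piZ.
apply: quotm_piE; apply: span_in; exists (a + r.+1%:Z), v; split=> //.
- by rewrite -[X in X < _]addr0 ltrD2l.
- by rewrite -wdtE lerD2l.
- by congr (dsum_in _ _ _ _ _ - _); rewrite -addn1 PoszD addrA addrK.
Qed.

Lemma tilde_ind (P : tilde p a b Fil -> Prop) :
  P 0 -> (forall x y, P x -> P y -> P (x + y)) ->
  (forall r v, (r <= n)%N -> filn r v -> P (tilde_in p a b Fil (a + r%:Z) v)) ->
  forall x, P x.
Proof.
move=> P0 PD Pt x; rewrite -[x]quotm_reprK; move: (repr x) => {}x.
rewrite (dsum_decomp x); elim/big_rec: _ => [|l y _ IH]; first by rewrite quotm_pi0.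
rewrite quotm_piD; apply: PD => //.
have := Pt l (val x l); rewrite tilde_inE; apply; last exact: dsumP.
by rewrite -ltnS.
Qed.

Section Lift.
Variables (B : comPzRingType) (Phi : {rmorphism A -> B}) (M : lmodType B).

Lemma tilde_lift (g : nat -> V -> M) :
  (forall r v, filn r.+1 v -> filn r v) ->
  (forall r u v, (r <= n)%N -> filn r u -> filn r v -> g r (u + v) = g r u + g r v) ->
  (forall r c v, (r <= n)%N -> filn r v -> g r (c *: v) = Phi c *: g r v) ->
  (forall r v, (r < n)%N -> filn r.+1 v -> g r v = g r.+1 v *+ p) ->
  exists2 H : tilde p a b Fil -> M,
    (forall r v, (r <= n)%N -> filn r v -> H (tilde_in p a b Fil (a + r%:Z) v) = g r v) &
    (forall x y, H (x + y) = H x + H y) /\ (forall c x, H (c *: x) = Phi c *: H x).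
Proof.
move=> Fdec gD gZ gR.
pose G (y : dsum a b Fil) : M := \sum_(l < n.+1) g l (val y l).
have GP : semilinear_map Phi G.
  split=> [x y|c x]; rewrite /G.
    rewrite -big_split; apply: eq_bigr => l _; rewrite dsum_valD gD //; try exact: dsumP.
    by rewrite -ltnS.
  rewrite scaler_sumr; apply: eq_bigr => l _; rewrite dsum_valZ gZ //; last exact: dsumP.
  by rewrite -ltnS.
have g0 r : (r <= n)%N -> g r 0 = 0.
  move=> rn; have F0 : filn r 0 by exact: rpred0.
  by apply: (addrI (g r 0)); rewrite -gD // !addr0.
have Gin r v : (r <= n)%N -> filn r v -> G (dsum_in a b Fil (a + r%:Z) v) = g r v.
  move=> rn Fv; rewrite /G (bigD1 (inord r)) //= dsum_inE // inordK ?ltnS // eqxx.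
  rewrite big1 ?addr0 // => l lr; rewrite dsum_inE //; case: eqP => [e|_].
    by move: lr; rewrite -e inord_val eqxx.
  by rewrite g0 // -ltnS.
have [||H HE [HD HZ]] := @quotm_factor _ _ Phi _ _ (@tilde_rel A V p a b Fil) G.
- exact: GP.
- move=> _ [i [v [ai ib Fv ->]]]; rewrite (semilinearB _ _ GP) (proj2 GP).
  have [r e] : exists r : nat, i = a + r.+1%:Z by exists (absz (i - a - 1)%R); lia.
  have rn : (r < n)%N by move: ib; rewrite e -wdtE lerD2l.
  have Fv' : filn r.+1 v by rewrite /filn -e.
  have -> : i - 1 = a + r%:Z by rewrite e; lia.
  rewrite e !Gin //; [|exact: ltnW|exact: Fdec].
  by rewrite rmorph_nat scaler_nat gR // subrr.
- exists H; last by split.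
  by move=> r v rn Fv; rewrite tilde_inE HE Gin.
Qed.

End Lift.
End TildeTheory.

(** * From local to global coordinates *)

Section LocalToGlobal.
Variables (A : comPzRingType) (V : lmodType A).

Lemma unimodular_pow r (f : 'I_r -> A) (u : 'I_r -> nat) : unimodular f ->
  exists c : 'I_r -> A, \sum_l c l * f l ^+ u l = 1.
Proof.
move=> [c c1].
pose J (x : A) := exists c : 'I_r -> A, \sum_l c l * f l ^+ u l = x.
have JP : is_ideal J.
  split.
  - by exists (fun=> 0); rewrite big1 // => i _; rewrite mul0r.
  - move=> _ _ [a <-] [b <-]; exists (fun l => a l + b l).
    by rewrite -big_split; apply: eq_bigr => l _; rewrite mulrDl.
  - move=> x _ [a <-]; exists (fun l => x * a l); rewrite mulr_sumr.
    by apply: eq_bigr => l _; rewrite mulrA.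
pose q := (\sum_l u l)%N.
have Jq l : J (f l ^+ q).
  rewrite /q (bigD1 l) //= exprD; apply: (idealMr JP).
  exists (fun i => (i == l)%:R); rewrite (bigD1 l) //= eqxx mul1r big1 ?addr0 //.
  by move=> i /negPf ->; rewrite mul0r.
have g1 : gpow f 1 1.
  apply: (isqn_gpow (I := fun x => exists c, x = \sum_i c i * f i) (j := 0)) => //.
  by exists c.
have gN N : gpow f N 1.
  elim: N => [|N IH].
    move=> K KP h; have := h (fun=> 0%N); rewrite big1 // => h1.
    by rewrite big1 // in h1; exact: h1.
  by rewrite -[1]mulr1 -add1n; exact: gpowM.
exact: (gpow_pigeon JP (leqnn (r * q).+1) Jq (gN _)).
Qed.

Record is_submod (K : V -> Prop) : Prop := IsSubmod {
  submod0 : K 0;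
  submodD : forall x y, K x -> K y -> K (x + y);
  submodZ : forall c x, K x -> K (c *: x) }.

Lemma submod_sum K (I : finType) (F : I -> V) : is_submod K ->
  (forall i, K (F i)) -> K (\sum_i F i).
Proof. by move=> KP h; elim/big_ind: _ => //; [exact: submod0|exact: submodD]. Qed.

(** Powers of the f l still generate the unit ideal. *)
Lemma local_global K r (f : 'I_r -> A) x : is_submod K -> unimodular f ->
  (forall l, exists u, K (f l ^+ u *: x)) -> K x.
Proof.
move=> KP fu /choice[u uP]; have [c c1] := unimodular_pow u fu.
rewrite -[x]scale1r -c1 scaler_suml; apply: submod_sum => // l.
by rewrite -scalerA; exact: submodZ.
Qed.

End LocalToGlobal.

Lemma submodB (A : pzRingType) (V : lmodType A) (S : submodClosed V) (x y : V) :
  x \in S -> y \in S -> x - y \in S.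
Proof. by move=> xS yS; rewrite -scaleN1r rpredD ?rpredZ. Qed.

Lemma submod_subl (A : pzRingType) (V : lmodType A) (S : submodClosed V) (x y : V) :
  x \in S -> x - y \in S -> y \in S.
Proof.
move=> xS xyS; have -> : y = x - (x - y) by rewrite opprB addrC subrK.
exact: submodB.
Qed.

Section QuasiBasis.
Variables (p : nat) (A : comPzRingType).
Hypothesis HA : padic_ring p A.
Hypothesis A_red : forall x : A, zdvd p (x ^+ p) -> zdvd p x.

Local Notation pe := (pexp A p).

Definition pz (e : option nat) (x : A) : Prop := exists c : A, x = pe e * c.

Lemma pz_ideal e : is_ideal (pz e).
Proof.
split; first by exists 0; rewrite mulr0.
  by move=> _ _ [c ->] [c' ->]; exists (c + c'); rewrite mulrDr.
by move=> a _ [c ->]; exists (a * c); rewrite mulrCA.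
Qed.

Lemma reduced_exp n (x : A) : (0 < n)%N -> zdvd p (x ^+ n) -> zdvd p x.
Proof.
move=> n0 h; have p1 := prime_gt1 (padic_prime HA).
have red k : zdvd p (x ^+ (p ^ k)) -> zdvd p x.
  by elim: k => [|k IH]; rewrite ?expr1 // expnSr exprM => /A_red.
apply: (red n); rewrite -(subnK (ltnW (ltn_expl n p1))) exprD.
exact: zdvdMl.
Qed.

Lemma reduced_eq0 n (x : A) : (0 < n)%N -> x ^+ n = 0 -> x = 0.
Proof.
move=> n0 xn; apply: (complete_sep HA) => N.
elim: N => [|N [y xy]]; first exact: zdvd1.
have yn : y ^+ n = 0.
  by apply: (tf_pexp HA (n := (N * n)%N)); rewrite expnM -exprMn_n -xy.
have [z zE] : zdvd p y by apply: (reduced_exp n0); rewrite yn; exact: zdvd0.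
by exists z; rewrite xy zE -mulrnA -expnS.
Qed.

(** Since A / p is reduced, an element killed by a power of f modulo p is killed
    by f. *)
Lemma reduced_mul (f : A) w (z : A) : zdvd p (f ^+ w * z) -> zdvd p (f * z).
Proof.
case: w => [|w]; first by rewrite mul1r; exact: zdvdMl.
move=> h; apply: (@reduced_exp w.+1) => //; rewrite exprMn.
by rewrite [z ^+ _]exprS mulrA; exact: zdvdMr.
Qed.

(** An exponent w such that f^w kills all f-power torsion of A / p^e: each of the e
    layers A / p needs one factor f. *)
Definition tors_bound (e : option nat) : nat := if e is Some n then n else 1.

Lemma tors_boundP e (f : A) w (z : A) m : (tors_bound e <= m)%N ->
  pz e (f ^+ w * z) -> pz e (f ^+ m * z).
Proof.
move=> em [c cE].
suff : pz e (f ^+ tors_bound e * z).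
  by rewrite -(subnK em) exprD -mulrA; exact: (idealMl (pz_ideal e)).
case: e {em} cE => [n|] /=; last first.
  rewrite mul0r => h; exists 0; rewrite mul0r expr1.
  apply: (@reduced_eq0 w.+1) => //.
  rewrite exprMn; have -> : f ^+ w.+1 * z ^+ w.+1 = f ^+ w * z * (f * z ^+ w).
    by rewrite !exprS; ring.
  by rewrite h mul0r.
have p0 := prime_gt0 (padic_prime HA).
rewrite mulr_natl; elim: n z c => [|n IH] z c h.
  by exists (f ^+ 0 * z); rewrite /= expn0 [RHS]mul1r.
have [y yE] : zdvd p (f * z).
  by apply: (@reduced_mul f w); rewrite h; exists (c *+ p ^ n); rewrite -mulrnA -expnSr.
have [|c' c'E] := IH y (f * c).
  apply: (tf_inj HA p0); rewrite -[LHS]mulrnAr -yE mulrCA h mulrnAr.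
  by rewrite -[RHS]mulrnA -expnSr.
by exists c'; rewrite exprSr -mulrA yE mulrnAr c'E /= expnSr natrM -mulr_natr; ring.
Qed.

Variable V : lmodType A.

(** A finite system of generators x_i of N / P, with coordinate functions lam_i
    that are linear modulo p^(e_i), such that p^(e_i) kills x_i.  The coordinates
    are not those of a basis, but they exhibit N / P as a direct summand of the sum
    of the A / p^(e_i). *)
Definition quasi_basis (N P : submodClosed V) : Prop :=
  exists (I : finType) (x : I -> V) (e : I -> option nat) (lam : I -> V -> A),
  [/\ forall i, x i \in N /\ pe (e i) *: x i \in P,
      forall i c u v, u \in N -> v \in N ->
        pz (e i) (lam i (c *: u + v) - (c * lam i u + lam i v)),
      forall i u, u \in P -> pz (e i) (lam i u)
    & forall u, u \in N -> u - \sum_i lam i u *: x i \in P].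

Definition local_data (f : A) n (N P : submodClosed V) (m : 'I_n -> V)
    (e : 'I_n -> option nat) : Prop :=
  [/\ forall j, m j \in N,
      forall x, x \in N -> exists (u : nat) (c : 'I_n -> A),
          f ^+ u *: x - \sum_j c j *: m j \in P
    & forall c : 'I_n -> A,
          (exists u : nat, f ^+ u *: (\sum_j c j *: m j) \in P) <->
          (exists u : nat, forall j, exists c', f ^+ u * c j = pe (e j) * c')].

(** Extension of a finite family by a default value, used to give all local data
    the same number of generators. *)
Definition ext0 (T : Type) (z : T) n (F : 'I_n -> T) (k : nat) : T :=
  if insub k is Some i then F i else z.

Lemma ext0E T (z : T) n (F : 'I_n -> T) (i : 'I_n) : ext0 z F i = F i.
Proof. by rewrite /ext0 valK. Qed.

Lemma ext0_out T (z : T) n (F : 'I_n -> T) k : (n <= k)%N -> ext0 z F k = z.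
Proof. by rewrite leqNgt => kn; rewrite /ext0 insubN. Qed.

Lemma big_pad n K (G : nat -> V) : (n <= K)%N -> (forall k, (n <= k)%N -> G k = 0) ->
  \sum_(j < K) G j = \sum_(i < n) G i.
Proof.
move=> nK G0; rewrite (big_ord_widen _ G nK) [RHS]big_mkcond; apply: eq_bigr => j _.
by case: ltnP => // /G0.
Qed.

Lemma pad_local_data f n N P m e K : (n <= K)%N -> @local_data f n N P m e ->
  exists m' e', @local_data f K N P m' e'.
Proof.
move=> nK [mN gen iffc].
pose m' (j : 'I_K) := ext0 0 m j; pose e' (j : 'I_K) := ext0 (Some 0%N) e j.
have sumE (c : nat -> A) : \sum_(j < K) c j *: m' j = \sum_(i < n) c i *: m i.
  rewrite (big_pad (G := fun k => c k *: ext0 0 m k) nK).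
    by apply: eq_bigr => i _; rewrite ext0E.
  by move=> k nk; rewrite ext0_out // scaler0.
exists m', e'; split.
- by move=> j; rewrite /m' /ext0; case: insubP => [i _ _|_]; [exact: mN|exact: rpred0].
- move=> x xN; have [u [c cP]] := gen x xN; exists u, (fun j => ext0 0 c j).
  rewrite (sumE (ext0 0 c)); under eq_bigr do rewrite ext0E.
  exact: cP.
- move=> c; pose cn := ext0 0 c.
  have -> : \sum_j c j *: m' j = \sum_(i < n) cn i *: m i.
    by rewrite -sumE; apply: eq_bigr => j _; rewrite /cn ext0E.
  apply: iff_trans (iffc (fun i => cn i)) _.
  split=> -[u h]; exists u => j.
    rewrite /e' /ext0; case: insubP => [i _ ij|_].
      by have [c' h'] := h i; exists c'; rewrite -h' ij /cn ext0E.
    by exists (f ^+ u * c j); rewrite /= expn0 [RHS]mul1r.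
  have jK := leq_trans (ltn_ord j) nK.
  have [c' h'] := h (Ordinal jK); exists c'.
  have -> : cn j = c (Ordinal jK) by rewrite /cn -(ext0E 0 c).
  by rewrite h' /e' (ext0E (Some 0%N) e j).
Qed.

(** On D(f l), a multiple of an element by a fixed power of f l has coordinates in
    the local generators; fixed, because f-power torsion of A / p^e is bounded
    ([tors_boundP]).  A partition of unity built from these powers assembles the
    local coordinates, times cut-off functions, into global ones. *)
Lemma quasi_basis_of_local (N P : submodClosed V) :
  (forall v, v \in P -> v \in N) -> locally_sum_cyclic p N P -> quasi_basis N P.
Proof.
move=> PN [r [f [fu loc]]].
have {loc}[K [m [e DP]]] : exists K (m : 'I_r -> 'I_K -> V) (e : 'I_r -> 'I_K -> option nat),
    forall l, @local_data (f l) K N P (m l) (e l).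
  have [n nP] := choice loc; exists (\sum_l n l)%N.
  have pad l : exists me : ('I_(\sum_l n l) -> V) * ('I_(\sum_l n l) -> option nat),
      local_data (f l) N P me.1 me.2.
    have [m [e h]] := nP l.
    have nK : (n l <= \sum_l n l)%N by rewrite (bigD1 l) //= leq_addr.
    have [m' [e' h']] := pad_local_data nK h; by exists (m', e').
  have [me meP] := choice pad.
  by exists (fun l => (me l).1), (fun l => (me l).2).
have mN l j : m l j \in N by have [] := DP l.
pose I : finType := ('I_r * 'I_K)%type.
pose q (i : I) : V := m i.1 i.2.
have qN i : q i \in N by exact: mN.
pose spanned (x : V) := exists c : I -> A, x - \sum_i c i *: q i \in P.
have spP : is_submod spanned.
  split.
  - by exists (fun=> 0); rewrite big1 ?subr0 ?rpred0 // => i _; rewrite scale0r.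
  - move=> x y [c cP] [c' cP']; exists (fun i => c i + c' i).
    under eq_bigr do rewrite scalerDl.
    by rewrite big_split opprD addrACA rpredD.
  - move=> a x [c cP]; exists (fun i => a * c i).
    under eq_bigr do rewrite -scalerA.
    by rewrite -scaler_sumr -scalerBr rpredZ.
have Nsp x : exists c : I -> A, x \in N -> x - \sum_i c i *: q i \in P.
  have [xN|] := boolP (x \in N); last by exists (fun=> 0).
  suff [c h] : spanned x by exists c.
  apply: (local_global spP fu) => l.
  have [_ gen _] := DP l; have [u [c cP]] := gen x xN; exists u.
  exists (fun i => if i.1 == l then c i.2 else 0).
  rewrite -(pair_bigA _ (fun l' j => (if l' == l then c j else 0) *: m l' j)) /=.
  rewrite (bigD1 l) //= eqxx [\sum_(i < r | i != l) _]big1 ?addr0 // => l' /negPf ll'.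
  by rewrite big1 // => j _; rewrite ll' scale0r.
have [a aP] := choice Nsp.
(* C l is the matrix of the global generators q in terms of the local ones m l,
   after multiplication by f l ^ U l *)
have uc l i : exists uc : nat * ('I_K -> A),
    f l ^+ uc.1 *: q i - \sum_j uc.2 j *: m l j \in P.
  by have [_ gen _] := DP l; have [u [c h]] := gen _ (qN i); exists (u, c).
have [g0 g0P] := choice (fun li : 'I_r * I => uc li.1 li.2).
pose g l i := g0 (l, i); have gP l i := g0P (l, i).
pose U l := (\sum_i (g l i).1)%N.
pose C l i j := f l ^+ (U l - (g l i).1) * (g l i).2 j.
have CP l i : f l ^+ U l *: q i - \sum_j C l i j *: m l j \in P.
  have Ui : ((g l i).1 <= U l)%N by rewrite /U (bigD1 i) //= leq_addr.
  rewrite -{1}(subnK Ui) exprD -scalerA; under eq_bigr do rewrite /C -scalerA.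
  by rewrite -scaler_sumr -scalerBr; apply: rpredZ; exact: (gP l i).
have CsP l (c : I -> A) : f l ^+ U l *: (\sum_i c i *: q i) -
    \sum_j (\sum_i c i * C l i j) *: m l j \in P.
  have -> : \sum_j (\sum_i c i * C l i j) *: m l j =
      \sum_i c i *: \sum_j C l i j *: m l j.
    under eq_bigr do rewrite scaler_suml.
    rewrite exchange_big; apply: eq_bigr => i _; rewrite scaler_sumr.
    by apply: eq_bigr => j _; rewrite scalerA.
  rewrite scaler_sumr -sumrB; apply: rpred_sum => i _.
  by rewrite scalerA mulrC -scalerA -scalerBr; apply: rpredZ; exact: CP.
pose Wt l := (\sum_j tors_bound (e l j))%N.
(* relations between the q have local coordinates zero modulo p^e, up to a power
   of f l that does not depend on the relation *)
have kerC l (c : I -> A) j : \sum_i c i *: q i \in P ->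
    pz (e l j) (f l ^+ Wt l * \sum_i c i * C l i j).
  move=> qP; have [_ _ iffc] := DP l.
  have hP : \sum_j (\sum_i c i * C l i j) *: m l j \in P.
    by apply: submod_subl (CsP l c); exact: rpredZ.
  have [|u h] := (iffc (fun j => \sum_i c i * C l i j)).1.
    by exists 0%N; rewrite scale1r.
  by apply: tors_boundP (h j); rewrite /Wt (bigD1 j) //= leq_addr.
have ann l j : exists u, f l ^+ u *: (pe (e l j) *: m l j) \in P.
  have [_ _ iffc] := DP l.
  have [|u h] := (iffc (fun j' => if j' == j then pe (e l j) else 0)).2.
    exists 0%N => j'; rewrite mul1r; case: eqP => [->|_].
      by exists 1; rewrite mulr1.
    by exists 0; rewrite mulr0.
  exists u; move: h; rewrite (bigD1 j) //= eqxx big1 ?addr0 // => i /negPf ->.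
  by rewrite scale0r.
have [u0 u0P] := choice (fun lj : 'I_r * 'I_K => ann lj.1 lj.2).
pose u' l j := u0 (l, j); have u'P l j := u0P (l, j).
pose U' l := (\sum_j u' l j)%N.
have U'P l j : f l ^+ U' l *: (pe (e l j) *: m l j) \in P.
  have uj : (u' l j <= U' l)%N by rewrite /U' (bigD1 j) //= leq_addr.
  by rewrite -(subnK uj) exprD -scalerA; apply: rpredZ; exact: (u'P l j).
have [cc cc1] := unimodular_pow (fun l => (U' l + (Wt l + U l))%N) fu.
pose lam (i : I) (x : V) := f i.1 ^+ Wt i.1 * \sum_k a x k * C i.1 k i.2.
exists I, (fun i => cc i.1 *: (f i.1 ^+ U' i.1 *: m i.1 i.2)), (fun i => e i.1 i.2), lam.
split.
- move=> [l j] /=; split; first by rewrite !rpredZ.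
  have -> : pe (e l j) *: (cc l *: (f l ^+ U' l *: m l j)) =
      cc l *: (f l ^+ U' l *: (pe (e l j) *: m l j)).
    by rewrite !scalerA; congr (_ *: _); ring.
  by apply: rpredZ.
- move=> [l j] c x y xN yN; rewrite /lam /=.
  have -> : f l ^+ Wt l * (\sum_k a (c *: x + y) k * C l k j) -
      (c * (f l ^+ Wt l * (\sum_k a x k * C l k j)) +
       f l ^+ Wt l * (\sum_k a y k * C l k j)) =
     f l ^+ Wt l * \sum_k (a (c *: x + y) k - (c * a x k + a y k)) * C l k j.
    rewrite mulrCA -mulrDr -mulrBr; congr (_ * _).
    rewrite mulr_sumr -big_split -sumrB; apply: eq_bigr => k _ /=; ring.
  apply: kerC.
  have -> : \sum_i (a (c *: x + y) i - (c * a x i + a y i)) *: q i =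
    c *: (x - \sum_i a x i *: q i) + (y - \sum_i a y i *: q i) -
    (c *: x + y - \sum_i a (c *: x + y) i *: q i).
    under eq_bigr do rewrite scalerBl scalerDl -scalerA.
    rewrite sumrB big_split -scaler_sumr /= scalerBr.
    by rewrite [in RHS]addrACA -opprD [in RHS]opprB [RHS]addrC [RHS]addrA subrK.
  by apply: submodB; [apply: rpredD; [apply: rpredZ|]|]; apply: aP; rewrite ?rpredD ?rpredZ.
- move=> [l j] x xP; rewrite /lam /=; apply: kerC.
  by apply: (submod_subl xP); apply: aP; exact: PN.
- move=> x xN.
  have -> : x - \sum_i lam i x *: (cc i.1 *: (f i.1 ^+ U' i.1 *: m i.1 i.2)) =
    \sum_l cc l *: (f l ^+ (U' l + (Wt l + U l)) *: x -
       \sum_j lam (l, j) x *: (f l ^+ U' l *: m l j)).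
    rewrite -(pair_bigA _ (fun l j => lam (l, j) x *: (cc l *: (f l ^+ U' l *: m l j)))) /=.
    under [RHS]eq_bigr do rewrite scalerBr scalerA.
    rewrite sumrB -scaler_suml cc1 scale1r; congr (_ - _).
    apply: eq_bigr => l _; rewrite scaler_sumr; apply: eq_bigr => j _.
    by rewrite !scalerA mulrCA mulrA.
  apply: rpred_sum => l _; rewrite rpredZ //.
  have -> : \sum_j lam (l, j) x *: (f l ^+ U' l *: m l j) =
     f l ^+ U' l *: (f l ^+ Wt l *: \sum_j (\sum_k a x k * C l k j) *: m l j).
    rewrite !scaler_sumr; apply: eq_bigr => j _; rewrite /lam /= !scalerA.
    by congr (_ *: _); ring.
  rewrite !exprD -!scalerA -!scalerBr !rpredZ //.
  rewrite -(subrK (f l ^+ U l *: (\sum_i a x i *: q i)) (f l ^+ U l *: x)) -addrA.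
  by apply: rpredD; [rewrite -scalerBr rpredZ // aP|exact: CsP].
Qed.

End QuasiBasis.

(** * Completeness of the twisted module *)

Section Adapted.
Variables (p : nat) (A : comPzRingType).
Hypothesis HA : padic_ring p A.
Hypothesis A_red : forall x : A, zdvd p (x ^+ p) -> zdvd p x.
Variables (V : lmodType A) (a b : int) (Fil : int -> submodClosed V).
Hypothesis ab : a <= b.
Hypothesis FP : is_filtration p a b Fil.

Local Notation n := (wdt a b).
Local Notation F := (filn a Fil).
Local Notation pe := (pexp A p).

Lemma filn0 v : F 0 v.
Proof. by rewrite /filn addr0; exact: (fil_low FP). Qed.

Lemma filn_dec r v : F r.+1 v -> F r v.
Proof. by rewrite /filn -addn1 PoszD addrA; exact: (fil_dec FP). Qed.

Lemma filn_top v : F n.+1 v -> v = 0.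
Proof.
rewrite /filn; apply: (fil_high FP); have := wdtE ab.
by move: (wdt a b) => m; lia.
Qed.

(** Locally V is P + C with P and C disjoint up to torsion, so c kills the
    C-component of x up to torsion; a partition of unity glues these components. *)
Lemma lift_torsion (P : submodClosed V) c x : locally_split P -> c *: x \in P ->
  exists y, x - y \in P /\ c *: y = 0.
Proof.
move=> [r [f [fu loc]]] cx.
have lift l : exists ky : nat * V, f l ^+ ky.1 *: x - ky.2 \in P /\ c *: ky.2 = 0.
  have [C [dec tor]] := loc l.
  have [k [y [z [yP zC e]]]] := dec x.
  have czP : c *: z \in P.
    have -> : c *: z = f l ^+ k *: (c *: x) - c *: y.
      by rewrite scalerA mulrC -scalerA e scalerDr addrAC subrr add0r.
    by apply: submodB; exact: rpredZ.
  have [k' h] := tor _ czP (rpredZ c zC).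
  exists ((k' + k)%N, f l ^+ k' *: z); split=> /=.
    by rewrite exprD -scalerA e scalerDr addrK; exact: rpredZ.
  by rewrite scalerA mulrC -scalerA.
have [ky kyP] := choice lift; have [g g1] := unimodular_pow (fun l => (ky l).1) fu.
exists (\sum_l g l *: (ky l).2); split.
  rewrite -[x]scale1r -g1 scaler_suml -sumrB; apply: rpred_sum => l _.
  by rewrite -scalerA -scalerBr; apply: rpredZ; have [] := kyP l.
rewrite scaler_sumr big1 // => l _; rewrite scalerA mulrC -scalerA.
by have [_ ->] := kyP l; rewrite scaler0.
Qed.

(** Generators of Fil^r, each in its own degree, with coordinates as in
    [quasi_basis] that vanish on the steps of the filtration above that degree. *)
Record adapted_basis (r : nat) (I : finType) (x : I -> V) (e : I -> option nat)
    (deg : I -> nat) (lam : I -> V -> A) : Prop := AdaptedBasis {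
  ab_deg : forall i, (deg i <= n)%N /\ F (deg i) (x i);
  ab_tor : forall i, pe (e i) *: x i = 0;
  ab_lin : forall i c u v, F r u -> F r v ->
    pz p (e i) (lam i (c *: u + v) - (c * lam i u + lam i v));
  ab_fil : forall i s u, (r <= s)%N -> (deg i < s)%N -> F s u -> pz p (e i) (lam i u);
  ab_sum : forall u, F r u -> u = \sum_i lam i u *: x i }.

(** Descending induction on the degree: lift the generators of Fil^r / Fil^(r+1),
    keeping their torsion exponents, and correct each element by its component
    along them. *)
Lemma adapted_basis_exists : exists I x e deg lam, @adapted_basis 0 I x e deg lam.
Proof.
suff h k : (k <= n.+1)%N ->
    exists I x e deg lam, @adapted_basis (n.+1 - k) I x e deg lam.
  by have := h n.+1 (leqnn _); rewrite subnn.
elim: k => [|k IH] kn.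
  exists void, (fun v : void => match v with end), (fun v : void => match v with end),
    (fun v : void => match v with end), (fun (v : void) _ => match v with end).
  split; try by case.
  by move=> u; rewrite subn0 => /filn_top ->; rewrite big1 // => -[].
have {IH}[I [x [e [deg [lam B]]]]] := IH (ltnW kn).
have rE : (n.+1 - k = (n.+1 - k.+1).+1)%N by lia.
set r := (n.+1 - k.+1)%N in rE *; rewrite rE in B.
have FE : Fil (a + r%:Z + 1) = Fil (a + r.+1%:Z) by rewrite -addrA -PoszD addn1.
have := fil_graded FP (a + r%:Z); rewrite FE => gr.
have PN v : v \in Fil (a + r.+1%:Z) -> v \in Fil (a + r%:Z) by exact: filn_dec.
have [J [y [t [mu [yP muL muP muS]]]]] := quasi_basis_of_local HA A_red PN gr.
have lift j : exists z, y j - z \in Fil (a + r.+1%:Z) /\ pe (t j) *: z = 0.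
  have [_ h] := yP j; exact: lift_torsion (fil_split FP _) h.
have [z zP] := choice lift.
have zF j : F r (z j).
  rewrite /filn; have [yN _] := yP j; apply: (submod_subl yN).
  by apply: PN; have [] := zP j.
have zT j : pe (t j) *: z j = 0 by have [] := zP j.
pose rest u := u - \sum_j mu j u *: z j.
have pzz j c : pz p (t j) c -> c *: z j = 0.
  by move=> [c' ->]; rewrite mulrC -scalerA zT scaler0.
have restF u : F r u -> F r.+1 (rest u).
  move=> Fu; rewrite /filn /rest.
  have -> : u - \sum_j mu j u *: z j =
      (u - \sum_j mu j u *: y j) + \sum_j mu j u *: (y j - z j).
    under [X in _ = _ + X]eq_bigr do rewrite scalerBr.
    by rewrite sumrB addrA subrK.
  apply: rpredD; first exact: muS.
  by apply: rpred_sum => j _; apply: rpredZ; have [] := zP j.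
have restE u s : (r < s)%N -> F s u -> rest u = u.
  move=> rs Fs; rewrite /rest big1 ?subr0 // => j _; apply: pzz; apply: muP.
  have : F r.+1 u by elim: s rs Fs => // s IH; rewrite ltnS leq_eqVlt => /orP[/eqP ->//|rs] /filn_dec; exact: IH.
  by [].
have restL c u v : F r u -> F r v -> rest (c *: u + v) = c *: rest u + rest v.
  move=> Fu Fv; rewrite /rest.
  have -> : \sum_j mu j (c *: u + v) *: z j =
      c *: (\sum_j mu j u *: z j) + \sum_j mu j v *: z j.
    rewrite scaler_sumr -big_split; apply: eq_bigr => j _ /=; apply/eqP.
    rewrite -subr_eq0 scalerA -scalerDl -scalerBl; apply/eqP/pzz; exact: muL.
  by rewrite scalerBr opprD addrACA.
exists (I + J)%type,
  (fun i => match i with inl i => x i | inr j => z j end),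
  (fun i => match i with inl i => e i | inr j => t j end),
  (fun i => match i with inl i => deg i | inr j => r end),
  (fun i u => match i with inl i => lam i (rest u) | inr j => mu j u end).
split.
- by case=> [i|j]; [exact: (ab_deg B)|split; [lia|exact: zF]].
- by case=> [i|j]; [exact: (ab_tor B)|exact: zT].
- case=> [i|j] c u v Fu Fv; last exact: muL.
  by rewrite restL //; apply: (ab_lin B); exact: restF.
- case=> [i|j] s u rs ds Fs.
    move: rs; rewrite leq_eqVlt => /orP[/eqP rs|rs].
      apply: (ab_fil B) (leqnn _) _ (restF u _); first by rewrite ltnW // rs.
      by rewrite rs.
    by rewrite (restE u s) //; apply: (ab_fil B) Fs.
  apply: muP; have : F r.+1 u; last by [].
  by elim: s ds {rs} Fs => // s IH; rewrite ltnS leq_eqVlt => /orP[/eqP ->//|rs] /filn_dec; exact: IH.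
- move=> u Fu; rewrite big_sumType /= -(ab_sum B (restF u Fu)) /rest subrK //.
Qed.

Section BaseChangeStructure.
Variable Phi : {rmorphism A -> A}.
Local Notation X := (base_change Phi (tilde p a b Fil)).
Local Notation gen r v := (tens1 Phi (tilde_in p a b Fil (a + (r : nat)%:Z) v)).

Lemma gen_rel r v : (r < n)%N -> F r.+1 v -> gen r v = gen r.+1 v *+ p.
Proof.
move=> rn Fv; rewrite tilde_in_rel // -scaler_nat tens1Z rmorph_nat.
by rewrite scaler_nat.
Qed.

Lemma genD r u v : (r <= n)%N -> F r u -> F r v -> gen r (u + v) = gen r u + gen r v.
Proof. by move=> rn Fu Fv; rewrite tilde_inD // tens1D. Qed.

Lemma genZ r c v : (r <= n)%N -> F r v -> gen r (c *: v) = Phi c *: gen r v.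
Proof. by move=> rn Fv; rewrite tilde_inZ // tens1Z. Qed.

Lemma gen0 r : (r <= n)%N -> gen r 0 = 0.
Proof.
move=> rn; have F0 : F r 0 by exact: rpred0.
by apply: (addrI (gen r 0)); rewrite -genD // !addr0.
Qed.

Lemma gen_sum r (I : finType) (P : pred I) (v : I -> V) : (r <= n)%N ->
  (forall i, P i -> F r (v i)) -> gen r (\sum_(i | P i) v i) = \sum_(i | P i) gen r (v i).
Proof.
move=> rn Fv; have F0 : F r 0 by exact: rpred0.
have g0 := gen0 rn.
suff [] : gen r (\sum_(i | P i) v i) = \sum_(i | P i) gen r (v i) /\
  F r (\sum_(i | P i) v i) by [].
elim/big_rec2: _ => [|i x y Pi [<- Fy]]; first by split.
by split; [rewrite genD //; exact: Fv|apply: filn_add => //; exact: Fv].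
Qed.

Lemma base_change_gen_ind (P : X -> Prop) :
  P 0 -> (forall x y, P x -> P y -> P (x + y)) -> (forall c x, P x -> P (c *: x)) ->
  (forall r v, (r <= n)%N -> F r v -> P (gen r v)) -> forall x, P x.
Proof.
move=> P0 PD PZ Pg; apply: base_change_ind => //.
apply: (tilde_ind ab (P := fun x => P (tens1 Phi x))) => [||r v rn Fv]; last exact: Pg.
  have -> : tens1 Phi (0 : tilde p a b Fil) = 0; last by [].
  by apply: (addrI (tens1 Phi (0 : tilde p a b Fil))); rewrite -tens1D !addr0.
by move=> x y Px Py; rewrite tens1D; exact: PD.
Qed.

(** An adapted basis x_i of degree d_i presents the twist of V~ as a direct summand
    of the sum of the A / p^(e_i): the generator x_i goes to the class of degree
    d_i, and the coordinate of [v]_r for r <= d_i is Phi(lam_i v) p^(d_i - r), which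
    is compatible with the relations of V~. *)
Lemma base_change_padic : padic_sep X p /\ padic_lim X p.
Proof.
have [I [x [e [deg [lam B]]]]] := adapted_basis_exists.
pose xx i : X := gen (deg i) (x i).
pose S i : set A^o := fun c => pz p (e i) c.
pose M i := quotm (submod_span (S i)).
pose pi i : A -> M i := quotm_pi (submod_span (S i)).
have PhiZ i c : pz p (e i) c -> pz p (e i) (Phi c).
  move=> [c' ->]; exists (Phi c'); rewrite rmorphM /=; congr (_ * _).
  by case: (e i) => [m|] /=; rewrite ?rmorph_nat ?rmorph0.
have piD i u v : pi i (u + v) = pi i u + pi i v by exact: quotm_piD.
have piZ i c u : pi i (c * u) = c *: pi i u by apply/esym; exact: quotm_piZ.
have pi0 i c : pz p (e i) c -> pi i c = 0.
  move=> h; rewrite /pi -(quotm_pi0 (submod_span (S i))); apply: quotm_piE.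
  by rewrite subr0; exact: span_in.
have piE i c c' : pz p (e i) (c - c') -> pi i c = pi i c'.
  by move=> h; apply: quotm_piE; exact: span_in.
have piMn i c k : pi i (c *+ k) = pi i c *+ k.
  elim: k => [|k IH]; first by rewrite !mulr0n; exact: (quotm_pi0 (submod_span (S i))).
  by rewrite !mulrS piD IH.
(* the projection to the i-th summand *)
have coord i : exists2 H : X -> M i, linear H & forall r v, (r <= n)%N -> F r v ->
    H (gen r v) = if (r <= deg i)%N then pi i (Phi (lam i v)) *+ p ^ (deg i - r) else 0.
  pose g r v : M i :=
    if (r <= deg i)%N then pi i (Phi (lam i v)) *+ p ^ (deg i - r) else 0.
  have gL r c u v : F r u -> F r v -> g r (c *: u + v) = Phi c *: g r u + g r v.
    move=> Fu Fv; rewrite /g; case: ifP => _; last by rewrite scaler0 addr0.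
    have F0 s w : F s w -> F 0 w by move=> _; exact: filn0.
    rewrite -scalerMnr -mulrnDl -piZ -piD; congr (_ *+ _); apply: piE.
    rewrite -rmorphM -rmorphD -rmorphB; apply: PhiZ.
    exact: (ab_lin B) (F0 _ _ Fu) (F0 _ _ Fv).
  have g0 r : g r 0 = 0.
    have := gL r 1 0 0 (rpred0 _) (rpred0 _); rewrite scale1r rmorph1 scale1r addr0.
    by move=> /eqP; rewrite -subr_eq0 opprD addrA subrr sub0r oppr_eq0 => /eqP.
  have [|||//|H HE [HD HZ]] := @tilde_lift p A V a b Fil ab A Phi (M i) g.
  - exact: filn_dec.
  - move=> r u v rn Fu Fv; have := gL r 1 u v Fu Fv.
    by rewrite !scale1r rmorph1 scale1r.
  - move=> r c v rn Fv; have := gL r c v 0 Fv (rpred0 _).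
    by rewrite !addr0 g0 addr0.
  - move=> r v rn Fv; rewrite /g; case: (ltngtP r (deg i)) => rd.
    + by rewrite -mulrnA -expnSr; congr (_ *+ _ ^ _); lia.
    + by rewrite mul0rn.
    + rewrite mul0rn; rewrite pi0 ?mul0rn //; apply: PhiZ.
      by apply: (ab_fil B) Fv; rewrite // rd.
  have [|H' H'E H'L] := @base_change_lift _ _ Phi (tilde p a b Fil) (M i) H.
    by split.
  by exists H' => // r v rn Fv; rewrite H'E HE.
(* the inclusion of the i-th summand *)
have ev i : exists2 G : M i -> X, (forall c, G (pi i c) = c *: xx i) & linear G.
  have [||G GE [GD GZ]] := @quotm_factor _ _ idfun A^o X (S i) (fun c => c *: xx i).
  - by split=> [u v|c u]; [exact: scalerDl|rewrite /= scalerA].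
  - move=> c [c' ->]; rewrite mulrC -scalerA.
    have -> : pe (e i) *: xx i = 0; last by rewrite scaler0.
    have [dn Fx] := ab_deg B i.
    have -> : pe (e i) = Phi (pe (e i)).
      by case: (e i) => [m|] /=; rewrite ?rmorph_nat ?rmorph0.
    by rewrite -genZ // (ab_tor B) gen0.
  by exists G => // c u v; rewrite GD GZ.
pose Hc i := s2val (cid2 (coord i)); pose Gc i := s2val (cid2 (ev i)).
have HL i : linear (Hc i) by rewrite /Hc; case: (cid2 _).
have HE i r v : (r <= n)%N -> F r v -> Hc i (gen r v) =
    if (r <= deg i)%N then pi i (Phi (lam i v)) *+ p ^ (deg i - r) else 0.
  by rewrite /Hc; case: (cid2 _) => /= H _; apply.
have GE i c : Gc i (pi i c) = c *: xx i by rewrite /Gc; case: (cid2 _).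
have GL i : linear (Gc i) by rewrite /Gc; case: (cid2 _).
have L0 (U U' : lmodType A) (f : U -> U') : linear f -> f 0 = 0.
  move=> fL; have := fL 1 0 0; rewrite !scale1r addr0 => /eqP.
  by rewrite -subr_eq0 opprD addrA subrr sub0r oppr_eq0 => /eqP.
have LD (U U' : lmodType A) (f : U -> U') u v : linear f -> f (u + v) = f u + f v.
  by move=> fL; have := fL 1 u v; rewrite !scale1r.
have LZ (U U' : lmodType A) (f : U -> U') c u : linear f -> f (c *: u) = c *: f u.
  by move=> fL; have := fL c u 0; rewrite (L0 _ _ f fL) !addr0.
have recon z : z = \sum_i Gc i (Hc i z).
  elim/base_change_gen_ind: z => [|z w hz hw|c z hz|r v rn Fv].
  - by rewrite big1 // => i _; rewrite (L0 _ _ _ (HL i)) (L0 _ _ _ (GL i)).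
  - rewrite {1}hz {1}hw -big_split /=; apply: eq_bigr => i _.
    by rewrite (LD _ _ (Hc i) z w (HL i)) (LD _ _ (Gc i) _ _ (GL i)).
  - rewrite {1}hz scaler_sumr; apply: eq_bigr => i _.
    by rewrite (LZ _ _ (Hc i) c z (HL i)) (LZ _ _ (Gc i) _ _ (GL i)).
  - have vE : v = \sum_(i | (r <= deg i)%N) lam i v *: x i.
      rewrite {1}(ab_sum B (filn0 v)) (bigID (fun i => (r <= deg i)%N)) /=.
      rewrite [X in _ + X]big1 ?addr0 // => i; rewrite -ltnNge => dr.
      have [c ->] := ab_fil B (leq0n _) dr Fv.
      by rewrite mulrC -scalerA (ab_tor B) scaler0.
    have Fx i : (r <= deg i)%N -> F r (x i).
      move=> rd; have [_ ] := ab_deg B i.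
      by elim: (deg i) rd => [|s IH]; [case: (r)|rewrite leq_eqVlt => /orP[/eqP <-//|rs] /filn_dec; exact: IH].
    rewrite {1}vE gen_sum //; last by move=> i rd; apply: filn_scale; exact: Fx.
    rewrite [RHS](bigID (fun i => (r <= deg i)%N)) /= [X in _ = _ + X]big1 ?addr0; last first.
      by move=> i /negPf rd; rewrite HE // rd (L0 _ _ _ (GL i)).
    apply: eq_bigr => i rd; rewrite HE // rd -piMn GE genZ //; last exact: Fx.
    rewrite -scalerMnl scalerMnr; congr (_ *: _).
    have [dn Fxd] := ab_deg B i; rewrite /xx.
    have lvl s : (s <= deg i)%N -> gen (deg i - s) (x i) = gen (deg i) (x i) *+ p ^ s.
      elim: s => [|s IH] sd; first by rewrite subn0 mulr1n.
      have e1 : (deg i - s = (deg i - s.+1).+1)%N by lia.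
      rewrite gen_rel; [|lia|].
        by rewrite -e1 IH ?(ltnW sd) // -mulrnA -expnSr.
      rewrite -e1; move: Fxd; have : (deg i - s <= deg i)%N by lia.
      move: (deg i - s)%N => k; elim: (deg i) => [|m IHm]; first by case: k.
      by rewrite leq_eqVlt => /orP[/eqP ->//|km] /filn_dec; exact: IHm.
    by rewrite -lvl ?leq_subr // subKn.
split.
- move=> z zd; rewrite (recon z) big1 // => i _.
  have hd N : zdvd (p ^ N) (Hc i z).
    by apply: zdvd_additive (zd N) => u v; exact: (LD _ _ _ _ _ (HL i)).
  suff -> : Hc i z = 0 by exact: (L0 _ _ _ (GL i)).
  have [c cE] : exists c, Hc i z = pi i c by exists (repr (Hc i z)); rewrite /pi quotm_reprK.
  case eE : (e i) => [m|].
    have [y ->] := hd m.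
    have [c' ->] : exists c, y = pi i c by exists (repr y); rewrite /pi quotm_reprK.
    by rewrite -piMn; apply: pi0; rewrite eE; exists c'; rewrite /= mulr_natl.
  have pi_inj u : pi i u = 0 -> u = 0.
    rewrite -(quotm_pi0 (submod_span (S i))) => h.
    have h2 : u - 0 \in submod_span (S i).
      rewrite -[_ \in _]/(_ \in as_zmod (submod_span (S i))) Quotient.idealrBE.
      by apply/eqP.
    rewrite subr0 in h2.
    have := @span_ker _ _ idfun _ A^o (S i) (idfun : A^o -> A^o) u _ _ h2; apply.
      by split.
    by move=> w [w' ->]; rewrite eE /= mul0r.
  rewrite cE; suff -> : c = 0 by exact: (quotm_pi0 (submod_span (S i))).
  apply: (complete_sep HA) => N; have [y yE] := hd N.
  have [c' yE'] : exists c, y = pi i c by exists (repr y); rewrite /pi quotm_reprK.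
  exists c'; apply/eqP; rewrite -subr_eq0; apply/eqP/pi_inj.
  have piN w : pi i (- w) = - pi i w by rewrite -mulN1r piZ scaleN1r.
  by rewrite piD piN piMn -yE' -yE cE subrr.
- move=> u ud; have Al := complete_lim HA.
  have [y yE] := choice ud.
  have cf k : exists c : I -> A, y k = \sum_i c i *: xx i.
    exists (fun i => repr (Hc i (y k))); rewrite {1}(recon (y k)).
    by apply: eq_bigr => i _; rewrite -GE /pi quotm_reprK.
  have [c cE] := choice cf.
  have lim i : exists l, forall N, zdvd (p ^ N) (l - \sum_(k < N) c k i *+ p ^ k).
    apply: Al => N; rewrite big_ord_recr /= addrAC subrr add0r.
    by exists (c N i).
  have [l lP] := choice lim.
  exists (u 0%N + \sum_i l i *: xx i) => N.
  have -> : u N = u 0%N + \sum_i (\sum_(k < N) c k i *+ p ^ k) *: xx i.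
    elim: N => [|N IH].
      by rewrite big1 ?addr0 // => i _; rewrite big_ord0 scale0r.
    under eq_bigr do rewrite big_ord_recr /= scalerDl.
    rewrite big_split /= addrA -IH; apply/eqP; rewrite addrC -subr_eq yE cE; apply/eqP.
    by rewrite -sumrMnl; apply: eq_bigr => i _; rewrite scalerMnl.
  rewrite opprD addrACA subrr add0r -sumrB; apply: zdvd_sum => i _.
  by rewrite -scalerBl; apply: zdvdZl.
Qed.

End BaseChangeStructure.
End Adapted.

(** * The comparison of two Frobenius twists *)

Section Transport.
Variables (p : nat) (k : fieldType) (W : comNzRingType) (red : {rmorphism W -> k}).
Variables (d s : nat) (R A : comPzRingType).
Variables (f : {rmorphism {mpoly W[d]} -> R}) (iota : {rmorphism R -> A}).
Hypothesis p_pr : prime p.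
Hypothesis p_gt2 : (2 < p)%N.
Hypothesis kp : perfect_field p k.
Hypothesis Wk : is_witt_ring p red.
Hypothesis fe : etale f.
Hypothesis Ai : is_padic_completion p iota.
Local Notation chart := (iota \o f).
Local Notation lift := (frob_lift p (Tcoord chart)).
Local Notation lam := (lam s).
Local Notation HA := (completion_padic_ring p_pr p_gt2 kp Wk fe Ai).
Local Notation A_red := (completion_reduced p_pr kp Wk fe Ai).

Variables a b : int.
Hypothesis ab : a <= b.
Local Notation n := (wdt a b).
Hypothesis np : (n < p)%N.

Section OneModule.
Variables (V : lmodType A) (nab : 'I_d -> V -> V) (Fil : int -> submodClosed V).
Hypothesis nabP : is_log_connection s chart nab.
Hypothesis FP : is_filtration p a b Fil.
Hypothesis griffiths : forall i l v, v \in Fil i -> nab l v \in Fil (i - 1).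
Local Notation F := (filn a Fil).
Local Notation X Phi := (base_change Phi (tilde p a b Fil)).
Local Notation gen Phi r v := (tens1 Phi (tilde_in p a b Fil (a + (r : nat)%:Z) v)).

Let nabD := let: And3 nD _ _ := nabP in nD.
Let nab_leibniz := let: And3 _ nL _ := nabP in nL.
Let nabC := let: And3 _ _ nC := nabP in nC.

Lemma filn_nab r l v : F r v -> F r.-1 (nab l v).
Proof.
case: r => [|r] Fv; first exact: (filn0 FP).
by move: (griffiths l Fv); rewrite /filn /= -addn1 PoszD addrA addrK.
Qed.

Lemma gen_family (Psi : lift) : is_family p n F Psi (fun r v => gen Psi r v).
Proof.
split=> [r u v rn Fu Fv|r c v rn Fv|r v rn Fv].
- exact: genD.
- exact: genZ.
- exact: gen_rel.
Qed.

(** [lower] matches the convention [v]_(a-1) = p [v]_a. *)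
Lemma lower_gen (Psi : lift) (M : lmodType A) (h : {linear X Psi -> M}) r w :
  h (tens1 Psi (tilde_in p a b Fil (a + r%:Z - 1) w)) =
  lower p (fun s w => h (gen Psi s w)) r w.
Proof.
case: r => [|r] /=.
  rewrite addr0; have -> := @tilde_in_low p A V a b Fil ab w.
  by rewrite (@tens1Z _ _ Psi (tilde p a b Fil)) rmorph_nat linearZ /= scaler_nat.
by rewrite -addn1 PoszD addrA addrK.
Qed.

(** The transported family is semilinear over Phi instead of Psi, by
    [taylor_frob], and satisfies the relations of V~. *)
Lemma comparison_exists (Phi Psi : lift) : exists h : {linear X Phi -> X Psi},
  forall r v, (r <= n)%N -> F r v ->
    h (gen Phi r v) = taylor p nab (lam Phi Psi) (fun r v => gen Psi r v) r v.
Proof.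
have [Xs Xl] := base_change_padic HA A_red ab FP Psi.
have gF := gen_family Psi; have Fd := filn_dec FP; have Fn := filn_nab.
have [||||t tE tL] := @tilde_lift p A V a b Fil ab A Phi (X Psi)
  (taylor p nab (lam Phi Psi) (fun r v => gen Psi r v)).
- exact: Fd.
- move=> r u v rn Fu Fv; exact: (taylorD HA np Fn nabD Xs Xl gF _ rn Fu Fv).
- move=> r c v rn Fv.
  rewrite (taylorZ HA np (@filn_scale _ _ a Fil) Fd Fn nabD nab_leibniz Xs Xl gF) //.
  by rewrite (taylor_frob s p_pr p_gt2 kp Wk fe Ai).
- move=> r v rn Fv; exact: (taylor_rel HA np Fn Xs Xl gF _ rn Fv).
have [h hE hL] := base_change_lift tL.
pose hl := GRing.isLinear.Build A _ _ *:%R h hL.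
pose H : {linear X Phi -> X Psi} := HB.pack h hl.
by exists H => r v rn Fv; rewrite /H /= hE tE.
Qed.

Definition comparison (Phi Psi : lift) : {linear X Phi -> X Psi} :=
  sval (cid (comparison_exists Phi Psi)).

Lemma comparison_gen (Phi Psi : lift) r v : (r <= n)%N -> F r v ->
  comparison Phi Psi (gen Phi r v) =
  taylor p nab (lam Phi Psi) (fun r v => gen Psi r v) r v.
Proof. by move=> rn Fv; rewrite /comparison; case: cid => h /= ->. Qed.

Lemma linear_gen_eq (Phi : lift) (M : lmodType A) (g h : {linear X Phi -> M}) :
  (forall r v, (r <= n)%N -> F r v -> g (gen Phi r v) = h (gen Phi r v)) -> g =1 h.
Proof.
move=> gh; apply: (base_change_gen_ind ab) => [|x y e e'|c x e|]; last exact: gh.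
- by rewrite !linear0.
- by rewrite !linearD e e'.
- by rewrite !linearZ e.
Qed.

Lemma comparison_comp (Phi1 Phi2 Phi3 : lift) x :
  comparison Phi2 Phi3 (comparison Phi1 Phi2 x) = comparison Phi1 Phi3 x.
Proof.
have pad Psi := base_change_padic HA A_red ab FP Psi.
apply: (@linear_gen_eq Phi1 _ (comparison Phi2 Phi3 \o comparison Phi1 Phi2)).
move=> r v rn Fv; rewrite /= !comparison_gen //.
have [X2s X2l] := pad Phi2; have [X3s X3l] := pad Phi3.
have rp := leq_ltn_trans rn np.
apply: etrans (taylor_map HA nab (G := comparison Phi2 Phi3) _ _ _ rp X2l X3s X3l
  (linearP _)) _.
apply: etrans (taylor_ext p filn_nab _
  (g' := taylor p nab (lam Phi2 Phi3) (fun r v => gen Phi3 r v)) _ Fv) _.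
  by move=> t w tr Fw; apply: comparison_gen => //; exact: leq_trans tr rn.
apply: etrans (taylor_taylor HA np filn_nab nabC X3s X3l _ _ _ rn Fv) _.
have -> // : (fun l => lam Phi1 Phi2 l + lam Phi2 Phi3 l) = lam Phi1 Phi3.
by apply: funext => i; rewrite (lam_cocycle s p_pr p_gt2 kp Wk fe Ai Phi1 Phi2 Phi3).
Qed.

Lemma comparison_refl (Phi : lift) x : comparison Phi Phi x = x.
Proof.
apply: (@linear_gen_eq Phi _ (comparison Phi Phi) idfun) => r v rn Fv.
have [Xs Xl] := base_change_padic HA A_red ab FP Phi.
rewrite comparison_gen //; have -> : lam Phi Phi = fun _ => 0.
  by apply: funext => i; rewrite (lam_refl s p_pr p_gt2 kp Wk fe Ai).
exact: (taylor_id HA nab np Xs Xl).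
Qed.

Lemma comparison_bij (Phi Psi : lift) : bijective (comparison Phi Psi).
Proof.
by exists (comparison Psi Phi) => x; rewrite comparison_comp comparison_refl.
Qed.

Section Frobenius.
Variables (Phi Psi : lift) (phi : {linear X Psi -> V}).
Hypothesis phi_bij : bijective phi.

(** Carried over from the twist of V~ along the bijection phi. *)
Lemma module_padic : padic_sep V p /\ padic_lim V p.
Proof.
have [Xs Xl] := base_change_padic HA A_red ab FP Psi.
have [psi psiK phiK] := phi_bij.
have psiB x y : psi (x - y) = psi x - psi y.
  by apply: (can_inj psiK); rewrite linearB !phiK.
have psi_dvd m x : zdvd m x -> zdvd m (psi x).
  move=> [y ->]; exists (psi y); apply: (can_inj psiK).
  by rewrite linearMn !phiK.
split=> [x xd|x xd].
  rewrite -[x]phiK (Xs (psi x)) ?linear0 // => m; exact: psi_dvd.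
have [|l lP] := Xl (psi \o x); first by move=> m; rewrite /= -psiB; exact: psi_dvd.
exists (phi l) => m; rewrite -[x m]phiK -linearB.
by have [y ->] := lP m; exists (phi y); rewrite linearMn.
Qed.

Definition twisted_phi : {linear X Phi -> V} := phi \o comparison Phi Psi.

(** phi commutes with the convergent series of the transport. *)
Lemma twisted_phi_gen r v : (r <= n)%N -> F r v ->
  twisted_phi (gen Phi r v) =
  taylor p nab (lam Phi Psi) (fun r v => phi (gen Psi r v)) r v.
Proof.
move=> rn Fv; have [Vs Vl] := module_padic.
have [Xs Xl] := base_change_padic HA A_red ab FP Psi.
rewrite /= comparison_gen //; have rp := leq_ltn_trans rn np.
exact: (taylor_map HA nab (G := phi) _ _ _ rp Xl Vs Vl (linearP _)).
Qed.

Lemma twisted_phi_bij : bijective twisted_phi.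
Proof. exact: (bij_comp phi_bij (comparison_bij Phi Psi)). Qed.

Hypothesis horizontal : forall i v l, a <= i <= b -> v \in Fil i ->
  nab l (phi (tens1 Psi (tilde_in p a b Fil i v))) =
  \sum_j frob_form s Psi j l *: phi (tens1 Psi (tilde_in p a b Fil (i - 1) (nab j v))).

(** The connection matrix changes by d lam under transport, as the forms attached
    to Psi and Phi do. *)
Lemma twisted_phi_horizontal i v l : a <= i <= b -> v \in Fil i ->
  nab l (twisted_phi (tens1 Phi (tilde_in p a b Fil i v))) =
  \sum_j frob_form s Phi j l *:
    twisted_phi (tens1 Phi (tilde_in p a b Fil (i - 1) (nab j v))).
Proof.
have nE := wdtE ab; have [Vs Vl] := module_padic.
move=> /andP[ai ib]; have [r e] : exists r : nat, i = a + r%:Z by exists (absz (i - a)); lia.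
have rn : (r <= n)%N by rewrite -lez_nat -(lerD2l a) nE -e.
rewrite {}e => Fv {i ai ib}.
under eq_bigr do rewrite lower_gen.
rewrite twisted_phi_gen //.
have lD := log_derD s p_pr p_gt2 kp Wk fe Ai l.
have lM := log_derM s p_pr p_gt2 kp Wk fe Ai l.
rewrite (@taylor_derive _ _ _ HA _ _ _ _ np filn_nab nabC _ Vs Vl _ _ (nab l)
  (fun j => log_der s chart l (lam Phi Psi j)) (fun j => frob_form s Psi j l)) //.
- apply: eq_bigr => j _; rewrite (frob_form_lam s p_pr p_gt2 kp Wk fe Ai Phi Psi).
  congr (_ *: _); have := filn_nab j Fv.
  case: r {Fv} rn => [|r] rn Fv /=; last by rewrite -twisted_phi_gen // ltnW.
  by rewrite -twisted_phi_gen.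
- move=> m x; rewrite nab_leibniz.
  have -> : log_der s chart l (kap p A r m) = 0.
    by rewrite -[kap _ _ _ _]mulr1 (der_kap HA lD lM) ?(leq_ltn_trans rn) // (der1 lM) mulr0.
  by rewrite scale0r addr0.
- move=> t w tn Fw; have tb : a + t%:Z <= b.
    by move: tn; rewrite -lez_nat -(lerD2l a) nE.
  rewrite horizontal //; last by rewrite lerDl.
  by apply: eq_bigr => j _; rewrite lower_gen.
Qed.

End Frobenius.
End OneModule.
End Transport.

(** * Functors that change the Frobenius only *)

Lemma functor_eq_maps (C D : category) (o : C -> D)
    (m m' : forall X Y : C, Mor X Y -> Mor (o X) (o Y)) i i' c c' :
  (forall X Y (g : Mor X Y), m X Y g = m' X Y g) ->
  @Functor C D o m i c = @Functor C D o m' i' c'.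
Proof.
move=> mm'; have {}mm' : m = m'.
  by do 3!(apply: functional_extensionality_dep => ?); exact: mm'.
case: _ / mm' in i' c' *.
by rewrite (Prop_irrelevance i i') (Prop_irrelevance c c').
Qed.

Section TwistFunctor.
Variables (p : nat) (W : comNzRingType) (d s : nat) (A : comPzRingType).
Variable chart : {rmorphism {mpoly W[d]} -> A}.
Variables a b : int.
Local Notation lift := (frob_lift p (Tcoord chart)).
Local Notation fil_bc Phi X := (base_change Phi (tilde p a b (mf_fil X))).

(** Separating the choice of the new Frobenius from its construction reduces
    equality of such functors to equality of linear maps. *)
Definition new_phi (Phi Psi : lift) : Type :=
  forall X : mf_module s a b Psi, {linear fil_bc Phi X -> X}.

Definition new_horizontal (Phi Psi : lift) (ph : new_phi Phi Psi) : Prop :=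
  forall (X : mf_module s a b Psi) i v l, a <= i <= b -> v \in mf_fil X i ->
    mf_nabla l (ph X (tens1 Phi (tilde_in p a b (mf_fil X) i v))) =
    \sum_j frob_form s Phi j l *:
      ph X (tens1 Phi (tilde_in p a b (mf_fil X) (i - 1) (mf_nabla j v))).

Definition with_phi (Phi Psi : lift) (ph : new_phi Phi Psi)
    (bij : forall X, bijective (ph X)) (hor : new_horizontal ph)
    (X : mf_module s a b Psi) : mf_module s a b Phi :=
  MFModule (mf_fg X) (mf_connection X) (mf_filtration X) (@mf_griffiths _ _ _ _ _ _ _ _ _ X)
    (bij X) (@hor X).

Section Functor.
Variables (Phi Psi : lift) (ph : new_phi Phi Psi).
Hypothesis bij : forall X, bijective (ph X).
Hypothesis hor : new_horizontal ph.
Local Notation E := (with_phi bij hor).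

Definition keeps_mor : Prop :=
  forall (X Y : mf_module s a b Psi) (g : X -> Y), is_mf_mor g ->
    @is_mf_mor p W d s A chart a b Phi (E X) (E Y) g.

Hypothesis mor : keeps_mor.

Definition with_phi_hom (X Y : MF s a b Psi) (g : Mor X Y) : Mor (E X : MF s a b Phi) (E Y) :=
  exist _ (sval g) (mor (svalP g)).

Lemma with_phi_hom1 X : with_phi_hom (idc X) = idc (E X : MF s a b Phi).
Proof. exact: mf_hom_eq. Qed.

Lemma with_phi_homM X Y Z (h : Mor Y Z) (g : Mor X Y) :
  with_phi_hom (compc h g) = compc (with_phi_hom h) (with_phi_hom g).
Proof. exact: mf_hom_eq. Qed.

Definition twist_functor : functor (MF s a b Psi) (MF s a b Phi) :=
  Functor with_phi_hom1 with_phi_homM.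

End Functor.

(** The objects of both sides have the same module, connection and filtration, so
    only the Frobenius has to be compared; the other fields are propositions. *)
Lemma twist_functor_comp (Phi1 Phi2 Phi3 : lift)
    (ph12 : new_phi Phi1 Phi2) (ph23 : new_phi Phi2 Phi3) (ph13 : new_phi Phi1 Phi3)
    bij12 hor12 mor12 bij23 hor23 mor23 bij13 hor13 mor13 :
  (forall X, ph12 (with_phi bij23 hor23 X) = ph13 X) ->
  functor_comp (@twist_functor _ _ ph12 bij12 hor12 mor12)
               (@twist_functor _ _ ph23 bij23 hor23 mor23) =
  @twist_functor _ _ ph13 bij13 hor13 mor13.
Proof.
move=> e; have {}e : (fun X => ph12 (with_phi bij23 hor23 X)) = ph13.
  exact: functional_extensionality_dep.
case: _ / e in bij13 hor13 mor13 *.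
pose bij0 X := bij12 (with_phi bij23 hor23 X).
pose hor0 X := @hor12 (with_phi bij23 hor23 X).
have eb : bij13 = bij0 by exact: Prop_irrelevance.
have eh : hor13 = hor0 by exact: Prop_irrelevance.
rewrite {}eb {}eh in mor13 *.
pose mor0 : keeps_mor bij0 hor0 := fun X Y g gP => mor12 _ _ _ (mor23 X Y g gP).
rewrite (Prop_irrelevance mor13 mor0).
apply: (@functor_eq_maps (MF s a b Phi3) (MF s a b Phi1) (with_phi bij0 hor0)) => X Y g.
exact: mf_hom_eq.
Qed.

(** The identity maps are strict morphisms, since they respect phi. *)
Lemma twist_functor_id (Phi : lift) (ph : new_phi Phi Phi) bij hor mor :
  (forall X x, ph X x = mf_phi X x) ->
  nat_iso (@twist_functor _ _ ph bij hor mor) (functor_id (MF s a b Phi)).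
Proof.
move=> phE; pose E := with_phi bij hor.
have to X : @is_strict_mor p W d s A chart a b Phi (E X) X id.
  by split=> // [i v vF|i v ib vF]; [exists v|rewrite /= phE].
have from X : @is_strict_mor p W d s A chart a b Phi X (E X) id.
  by split=> // [i v vF|i v ib vF]; [exists v|rewrite /= phE].
exists (fun X => exist _ id (StrictMor (to X))), (fun X => exist _ id (StrictMor (from X))).
by split=> *; exact: mf_hom_eq.
Qed.

End TwistFunctor.

(** * Independence of the Frobenius lift *)

Lemma linear_eq (A : pzRingType) (V V' : lmodType A) (g h : {linear V -> V'}) :
  g =1 h -> g = h.
Proof.
case: g h => [g [g1 g2]] [h [h1 h2]] /= /funext gh; case: _ / gh in h1 h2 *.
case: g1 h1 g2 h2 => g1 [h1] [g2] [h2].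
by rewrite (Prop_irrelevance g1 h1) (Prop_irrelevance g2 h2).
Qed.

Section Independence.
Variables (p : nat) (k : fieldType) (W : comNzRingType) (red : {rmorphism W -> k}).
Variables (d s : nat) (R A : comPzRingType).
Variables (f : {rmorphism {mpoly W[d]} -> R}) (iota : {rmorphism R -> A}).
Hypothesis p_pr : prime p.
Hypothesis p_gt2 : (2 < p)%N.
Hypothesis kp : perfect_field p k.
Hypothesis Wk : is_witt_ring p red.
Hypothesis fe : etale f.
Hypothesis Ai : is_padic_completion p iota.
Local Notation chart := (iota \o f).
Local Notation lift := (frob_lift p (Tcoord chart)).
Local Notation HA := (completion_padic_ring p_pr p_gt2 kp Wk fe Ai).

Variables a b : int.
Hypothesis ab : a <= b.
Local Notation n := (wdt a b).
Hypothesis np : (n < p)%N.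
Local Notation gen X Phi r v :=
  (tens1 Phi (tilde_in p a b (mf_fil X) (a + (r : nat)%:Z) v)).

Definition change_phi (Phi Psi : lift) : new_phi s a b Phi Psi := fun X =>
  twisted_phi p_pr p_gt2 kp Wk fe Ai ab np (mf_connection X) (mf_filtration X)
    (@mf_griffiths _ _ _ _ _ _ _ _ _ X) Phi (mf_phi X).

Lemma change_phi_bij (Phi Psi : lift) X : bijective (@change_phi Phi Psi X).
Proof. by apply: twisted_phi_bij; exact: mf_phi_iso. Qed.

Lemma change_phi_horizontal (Phi Psi : lift) : new_horizontal (@change_phi Phi Psi).
Proof.
move=> X i v l; apply: twisted_phi_horizontal; first exact: mf_phi_iso.
exact: mf_horizontal.
Qed.

Lemma change_phi_gen (Phi Psi : lift) X r v : (r <= n)%N -> filn a (mf_fil X) r v ->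
  @change_phi Phi Psi X (gen X Phi r v) =
  taylor p (@mf_nabla _ _ _ _ _ _ _ _ _ X) (lam s Phi Psi)
    (fun r v => mf_phi X (gen X Psi r v)) r v.
Proof. by apply: twisted_phi_gen; exact: mf_phi_iso. Qed.

Definition change_module (Phi Psi : lift) :=
  with_phi (@change_phi_bij Phi Psi) (@change_phi_horizontal Phi Psi).

Lemma gen_degree i : a <= i <= b -> exists2 r : nat, (r <= n)%N & i = a + r%:Z.
Proof.
move=> /andP[ai ib]; have e : i = a + (absz (i - a))%:Z by lia.
by exists (absz (i - a)) => //; rewrite -lez_nat -(lerD2l a) (wdtE ab) -e.
Qed.

(** A morphism is linear and commutes with nabla, hence with each term of the
    transport. *)
Lemma change_strict (Phi Psi : lift) (X Y : mf_module s a b Psi) (g : X -> Y) :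
  is_strict_mor g ->
  @is_strict_mor p W d s A chart a b Phi (change_module Phi X) (change_module Phi Y) g.
Proof.
move=> gP; split=> [||||i v ib vF].
- exact: mor_linear gP.
- exact: mor_nabla gP.
- exact: mor_fil gP.
- exact: mor_strict gP.
have [r rn e] := gen_degree ib; have rp := leq_ltn_trans rn np; subst i.
have gF t w : filn a (mf_fil X) t w -> filn a (mf_fil Y) t (g w) by exact: (mor_fil gP).
have [Xs Xl] := module_padic p_pr p_gt2 kp Wk fe Ai ab (mf_filtration X) (mf_phi_iso X).
have [Ys Yl] := module_padic p_pr p_gt2 kp Wk fe Ai ab (mf_filtration Y) (mf_phi_iso Y).
apply: etrans (congr1 g (@change_phi_gen Phi Psi X r v rn vF)) _.
apply: etrans _ (esym (@change_phi_gen Phi Psi Y r (g v) rn (gF r v vF))).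
apply: etrans (taylor_map HA _ (G := g) _ _ _ rp Xl Ys Yl (mor_linear gP)) _.
have Fn := filn_nab (mf_filtration X) (@mf_griffiths _ _ _ _ _ _ _ _ _ X).
apply: etrans (taylor_ext p Fn _ (g' := fun t w => mf_phi Y (gen Y Psi t (g w))) _ vF) _.
  move=> t w tr Fw; apply: (mor_phi gP) => //.
  by rewrite lerDl /= -[Z in _ <= Z](wdtE ab) lerD2l lez_nat (leq_trans tr).
apply: eq_ksum => m.
by apply: (@lop_morph A d _ _ _ _ _ _ m (fun w => mf_phi Y (gen Y Psi (r - m)%N w)) g) => l u;
  exact: (mor_nabla gP).
Qed.

(** Morphisms are composites of strict ones. *)
Lemma change_mor (Phi Psi : lift) :
  keeps_mor (@change_phi_bij Phi Psi) (@change_phi_horizontal Phi Psi).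
Proof.
move=> X Y g; elim=> {X Y g} [X Y g gP|X Y Z h g _ hP _ gP].
  by apply: StrictMor; exact: change_strict.
exact: CompMor hP gP.
Qed.

Definition change_functor (Phi Psi : lift) : functor (MF s a b Psi) (MF s a b Phi) :=
  twist_functor (@change_mor Phi Psi).

Lemma change_phi_comp (Phi1 Phi2 Phi3 : lift) (X : mf_module s a b Phi3) x :
  change_phi Phi1 (change_module Phi2 X) x = change_phi Phi1 X x.
Proof. by rewrite /change_phi /= comparison_comp. Qed.

Lemma change_phi_refl (Phi : lift) (X : mf_module s a b Phi) x :
  change_phi Phi X x = mf_phi X x.
Proof. by rewrite /change_phi /= comparison_refl. Qed.

Lemma change_cocycle (Phi1 Phi2 Phi3 : lift) :
  functor_comp (change_functor Phi1 Phi2) (change_functor Phi2 Phi3) =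
  change_functor Phi1 Phi3.
Proof.
apply: twist_functor_comp => X; apply: linear_eq => x; exact: change_phi_comp.
Qed.

Lemma change_equivalence (Phi Psi : lift) : is_equivalence (change_functor Phi Psi).
Proof.
exists (change_functor Psi Phi); rewrite !change_cocycle.
by split; apply: twist_functor_id => X x; exact: change_phi_refl.
Qed.

(** Changing the lift back to Psi restores the original phi, so strictness comes
    back from the twisted modules. *)
Lemma change_strict_iff (Phi Psi : lift) (X Y : MF s a b Psi) (g : Mor X Y) :
  is_strict_mor (sval (fmap (change_functor Phi Psi) g)) <-> is_strict_mor (sval g).
Proof.
split=> [gP|]; last exact: change_strict.
have g2P := change_strict Psi gP; split.
- exact: mor_linear gP.
- exact: mor_nabla gP.
- exact: mor_fil gP.
- exact: mor_strict gP.
have back (Z : mf_module s a b Psi) x :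
    change_phi Psi (change_module Phi Z) x = mf_phi Z x.
  by rewrite change_phi_comp change_phi_refl.
move=> i v ib vF.
exact: etrans (congr1 _ (esym (back X _))) (etrans (mor_phi g2P ib vF) (back Y _)).
Qed.

End Independence.

Theorem theorem2p3
  (p : nat) (k : fieldType) (W : comNzRingType) (red : {rmorphism W -> k})
  (d s : nat) (R R' : comPzRingType)
  (f : {rmorphism {mpoly W[d]} -> R}) (iota : {rmorphism R -> R'})
  (a b : int) :
  prime p -> (2 < p)%N -> perfect_field p k -> is_witt_ring p red ->
  (s <= d)%N -> etale f -> is_padic_completion p iota ->
  0 <= b - a <= p%:Z - 1 ->
  let chart : {rmorphism {mpoly W[d]} -> R'} := iota \o f in
  exists E : forall Phi Psi : frob_lift p (Tcoord chart),
      functor (MF s a b Psi) (MF s a b Phi),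
    (forall Phi Psi, is_equivalence (E Phi Psi)) /\
    (forall (Phi Psi : frob_lift p (Tcoord chart)) (X Y : MF s a b Psi) (g : Mor X Y),
      is_strict_mor (sval (fmap (E Phi Psi) g)) <-> is_strict_mor (sval g)) /\
    (forall Phi1 Phi2 Phi3,
      functor_comp (E Phi1 Phi2) (E Phi2 Phi3) = E Phi1 Phi3).
Proof.
move=> p_pr p_gt2 kp Wk _ fe Ai /andP[ab0 abp] chart.
have ab : a <= b by lia.
have np : (wdt a b < p)%N by rewrite /wdt; lia.
exists (@change_functor p k W red d s R R' f iota p_pr p_gt2 kp Wk fe Ai a b ab np).
split; first by move=> Phi Psi; exact: change_equivalence.
split; first by move=> Phi Psi X Y g; exact: change_strict_iff.
by move=> Phi1 Phi2 Phi3; exact: change_cocycle.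
Qed.
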